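(* Let $C$ be a convex planar body which is not a polygon and has piecewise $\mathcal{C}^{2}$ boundary. Then there exists $c>0$ such that for every integer $N\geqslant1$ and every set $\mathcal{P}_{N}$ of $N$ points in $\mathbb{T}^{2}$ we have $$\int_{0}^{1}\int_{\mathbb{T}^{2}}\left\vert \mathrm{card}\left(\mathcal{P}_{N}\cap\left(\lambda C+t\right)\right)-\lambda^{2}N\left\vert C\right\vert \right\vert ^{2}\,dt\,d\lambda\geqslant cN^{2/5}.$$
   Context: $\mathbb{T}^{2}=\mathbb{R}^{2}/\mathbb{Z}^{2}$. A planar convex body is a bounded convex subset of $\mathbb{R}^2$ with non-empty interior, and $|C|$ is its area. Piecewise $\mathcal{C}^2$ boundary means that $\partial C$ is a finite union of consecutive $\mathcal{C}^2$ arcs (in the arc length parameterization). For $\mathcal{P}_N=\{u_1,\dots,u_N\}\subset\mathbb{T}^2$, $\lambda>0$ and $t\in\mathbb{T}^2$, $\mathrm{card}(\mathcal{P}_N\cap(\lambda C+t))$ denotes $\sum_{j=1}^N\sum_{k\in\mathbb{Z}^2}\chi_{\lambda C}(u_j-t+k)$, where $\chi_{\lambda C}$ is the characteristic function of $\lambda C\subset\mathbb{R}^2$; this is the ordinary number of points of $\mathcal{P}_N$ in the translated set $\lambda C+t$ whenever $\lambda C$ projects injectively to $\mathbb{T}^2$. *)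

(* Defs.v *)
From HB Require Import structures.
From mathcomp Require Import all_boot all_order all_algebra finmap.
From mathcomp Require Import generic_quotient ring_quotient.
From mathcomp Require Import all_classical all_reals all_analysis.

Set Implicit Arguments.
Unset Strict Implicit.
Unset Printing Implicit Defensive.

Import Order.TTheory GRing.Theory Num.Theory.
Import numFieldNormedType.Exports.

Local Open Scope classical_set_scope.
Local Open Scope ring_scope.
Local Open Scope quotient_scope.
Local Open Scope convex_scope.

Notation plane R := (R * R)%type (only parsing).

Definition int_lattice (R : realType) : {pred plane R} :=
  [pred x | (x.1 \is a Num.int) && (x.2 \is a Num.int)].

Lemma int_lattice_zmod_closed (R : realType) : zmod_closed (@int_lattice R).
Proof.
split=> [|x y]; rewrite !inE /= ?rpred0// => /andP[x1 x2] /andP[y1 y2].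
by rewrite !rpredB.
Qed.

HB.instance Definition _ (R : realType) :=
  GRing.isZmodClosed.Build _ (@int_lattice R) (@int_lattice_zmod_closed R).

Notation torus R := {ideal_quot (@int_lattice R)}.

Notation lebesgue2 R := (@lebesgue_measure R \x @lebesgue_measure R)%E.

(* For a convex C every vertical section is an interval, so that lebesgue2 C is
   the area of C even when C is not Borel. *)
Definition area (R : realType) (C : set (plane R)) : R := fine (lebesgue2 R C).

Definition unit_square (R : realType) : set (plane R) := `[0, 1[ `*` `[0, 1[.

(* The integral against the normalized Haar measure of R^2 / Z^2, computed on
   a fundamental domain. For f >= 0 the integral of the library is a supremum
   over Borel simple functions below f, hence it is the usual one as soon as f
   is Lebesgue measurable. *)
Definition torus_integral (R : realType) (f : torus R -> \bar R) : \bar R :=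
  (\int[lebesgue2 R]_(x in @unit_square R) f (\pi_(torus R) x))%E.

Definition convex_body (R : realType) (C : set (plane R)) : Prop :=
  [/\ convex_set C, bounded_set C & interior C !=set0].

Definition boundary (R : realType) (C : set (plane R)) : set (plane R) :=
  closure C `\` interior C.

Definition segment (R : realType) (a b : plane R) : set (plane R) :=
  range (fun t : {i01 R} => (a : convex_lmodType (plane R)) <| t |> b).

(* The boundary is a closed polygonal chain; which boundary points belong to C
   is irrelevant, e.g. an open square is a polygon. *)
Definition polygon (R : realType) (C : set (plane R)) : Prop :=
  exists v : seq (plane R), boundary C =
    [set p | exists2 i, (i < size v)%N & segment v`_i (rot 1 v)`_i p].

Definition C2 (R : realType) (f : R -> R) : Prop :=
  [/\ forall s, derivable f s 1, forall s, derivable (derive1 f) s 1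
    & continuous (derive1n 2 f)].

(* A C^2 function on the closed interval [a, b] (with one-sided derivatives at
   the end points) is the restriction of a C^2 function on R. The last equation
   says that the parameter is the arc length. *)
Definition C2_arc (R : realType) (g : R -> plane R) (a b : R) : Prop :=
  exists x y : R -> R,
    [/\ C2 x, C2 y &
      {in `[a, b], forall s,
        g s = (x s, y s) /\ derive1 x s ^+ 2 + derive1 y s ^+ 2 = 1}].

(* The boundary is the simple closed curve g, of length L, and the points of s
   cut it into consecutive C^2 arcs. *)
Definition piecewise_C2_boundary (R : realType) (C : set (plane R)) : Prop :=
  exists (L : R) (g : R -> plane R) (s : seq R),
    [/\ itv_partition 0 L s,
        {in `[0, L[ &, injective g}, g L = g 0, g @` `[0, L] = boundary C
      & forall i, (i < size s)%N -> C2_arc g (0 :: s)`_i s`_i].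

Definition dilate (R : realType) (l : R) (C : set (plane R)) : set (plane R) :=
  [set l *: x | x in C].

Lemma torus_eqP (R : realType) (x y : plane R) :
  \pi_(torus R) x = \pi_(torus R) y <->
  exists k : int * int, x - y = (k.1%:~R, k.2%:~R).
Proof.
have xyE : (x - y \in @int_lattice R) = (x == y %[mod torus R]).
  exact: Quotient.idealrBE.
split=> [/eqP|[k xyk]]; last first.
  by apply/eqP; rewrite -xyE xyk inE /= !intr_int.
rewrite -xyE inE => /andP[/intrP[m xm] /intrP[n yn]].
by exists (m, n); rewrite -xm -yn; apply/eqP; rewrite xpair_eqE !eqxx.
Qed.

(* Every point of t + A is counted with its multiplicity under the projection
   of R^2 to the torus. For A bounded finitely many k contribute. *)
Definition card_translate (R : realType) (P : {fset torus R})
    (A : set (plane R)) (t : torus R) : R :=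
  \sum_(u <- P) \sum_(k \in [set: int * int])
    (\1_A (repr u - repr t + (k.1%:~R, k.2%:~R)) : R).

Lemma card_translateE (R : realType) (P : {fset torus R}) (A : set (plane R))
    (r : torus R -> plane R) (t : plane R) : cancel r \pi_(torus R) ->
  card_translate P A (\pi_(torus R) t) =
  \sum_(u <- P) \sum_(k \in [set: int * int])
      (\1_A (r u - t + (k.1%:~R, k.2%:~R)) : R).
Proof.
move=> rK; apply: eq_bigr => u _.
have [m mE] : exists k : int * int, repr u - r u = (k.1%:~R, k.2%:~R).
  by apply/torus_eqP; rewrite reprK rK.
have [n nE] : exists k : int * int,
    repr (\pi_(torus R) t) - t = (k.1%:~R, k.2%:~R).
  by apply/torus_eqP; rewrite reprK.
rewrite [RHS](reindex_fsbigT (fun k : int * int => k + (m - n))); last first.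
  by exists (fun k => k - (m - n)) => k; rewrite ?addrK ?subrK.
apply: eq_fsbigr => -[k1 k2] _; congr (\1_A _).
case: m n mE nE => [m1 m2] [n1 n2] /= mE nE.
have -> : repr u = r u + (m1%:~R, m2%:~R) by rewrite -mE addrC subrK.
have -> : repr (\pi_(torus R) t) = t + (n1%:~R, n2%:~R).
  by rewrite -nE addrC subrK.
case: (r u) t {nE mE} => [a b] [c d].
by congr pair; rewrite /= intrD rmorphB opprD addrACA -[LHS]addrA; congr +%R;
  rewrite addrC.
Qed.

(* Main.v *)
Require Import Defs.
From mathcomp Require Import all_boot all_order all_algebra finmap.
From mathcomp Require Import generic_quotient ring_quotient.
From mathcomp Require Import all_classical all_reals all_analysis.
From mathcomp Require Import measurable_realfun ring lra zify.

(** Let O be the interior of C, and let e(s) stand for exp(2 i pi s).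

Fourier analysis on the torus. As a function of the translation t, the
discrepancy of the dilate l C has at a nonzero frequency k a Fourier coefficient
of squared modulus S(k) E(k, l), where S(k) = |sum_u e(k.u)|^2 only depends on
the points (the structure factor) and E(k, l) is the squared modulus of the
Fourier transform of the indicator of l O at k (the energy). The subtracted area
term only affects the frequency 0, so that by Bessel's inequality the inner
integral is at least the sum of S(k) E(k, l) over any finite set of nonzero k
([torus_energy_lower]). The points of C outside O lie on the boundary, which is a
null set ([null_rim]) and is absorbed by an error term of integral 0. After
integration in l it remains to find, for each point set, finitely many nonzero k
such that the sum of W(k) S(k) is at least c N^(2/5), where the weight W(k) is
the integral of E(k, l) over l in ]0, 1].

Weights. Integrating along the lines orthogonal to k, the two dimensional
coefficient becomes the coefficient of a function of one variable: the length
f(y) of the chord of O orthogonal to k at depth y / (2 pi |k1|) ([energyE]). This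
f is concave on the interval where it does not vanish. Averaging over l makes the
zeros of the Fourier transform harmless: the integral of (f(y) - f(y - 1)) J(y)
is bounded by the square root of the average, where J is a nonnegative kernel of
decay y^-3, and concavity bounds it below by a multiple of f(1/2)
([spectral_mass_ge], [kern_pairing_large]). Hence W(k) is at least a multiple of
|k|^-2 times the square of the length of the chord at depth about 1 / |k|. By
convexity a chord of depth t has length at least a multiple of t, so
W(k) >= c |k|^-4 for every k ([weight_generic_lower]). Near a point of the
boundary where the curvature is not zero the chord of depth t has length at least
a multiple of sqrt t, which gives W(k) >= c |k|^-3 ([weight_cap_lower]) when k is
normal to the boundary there. As C is not a polygon some C^2 arc of its boundary
is not straight ([curved_arc]); the direction of the tangent varies along it, so
that the better bound holds for all k of a cone ([curved_cap]).

Lattice points. For a finite set Omega of frequencies, the sum of S(q - p) over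
p, q in Omega equals the sum over pairs of points u, v of
|sum_(p in Omega) e(p.(u - v))|^2, and the pairs u = v contribute N |Omega|^2
([sum_structure_factor_ge]). Let M be about N^(1/5) and apply this to M boxes of
length 2 M^3 and thickness M^2 along M directions equally spaced in the cone: a
box has about 2 M^5 >= 2 N points, so that the terms p = q, of sum N^2 |Omega|,
leave half of the total. A frequency k is a difference of two points of a box
for O(1 + M^3 / |k|) of the M directions when k is in the cone, and only occurs
with |k| = O(M^2) when it is not; in both cases W(k) is at least c M^-9 times
this multiplicity ([weight_ge_direction_count]). Altogether the sum of W(k) S(k)
is at least c M^-9 . M . N M^5 = c N / M^3, of order N^(2/5)
([lattice_energy_lower]). *)

Set Implicit Arguments.
Unset Strict Implicit.
Unset Printing Implicit Defensive.

Import Order.TTheory GRing.Theory Num.Theory.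
Import numFieldNormedType.Exports.

Local Open Scope classical_set_scope.
Local Open Scope ring_scope.

(** * Integration of bounded Borel functions with bounded support *)

Section tame.
Variable R : realType.
Implicit Types (f g : R -> R) (F G : R * R -> R).
Local Notation leb := (@lebesgue_measure R).

(** One constant bounds both the values and the support: this class is stable
under all the operations used below and contained in the integrable functions. *)
Definition tame f : Prop := measurable_fun setT f /\
  exists M, forall x, `|f x| <= M /\ (M < `|x| -> f x = 0).

Definition integ f : R := \int[leb]_x f x.

Lemma tame_integrable f : tame f -> leb.-integrable setT (EFin \o f).
Proof.
move=> [mf [M fM]].
have iM : leb.-integrable `[-M, M] (EFin \o f).
  apply: measurable_bounded_integrable => //=.
  - by rewrite lebesgue_measure_itv/=; case: ifP => // _; rewrite -EFinD ltry.
  - exact: measurable_funS mf.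
  - exists M; split; first exact: num_real.
    by move=> K MK x _; apply: le_trans (ltW MK); have [] := fM x.
move: iM; rewrite integrable_mkcond//; congr (integrable _ _ _).
apply/funext => x; rewrite patchE /=; case: ifPn => //.
rewrite notin_setE /= in_itv /= => /negP xM; have [_ ->//] := fM x.
by rewrite ltNge ler_norml.
Qed.

Lemma tame0 : tame (fun=> 0).
Proof.
by split=> //; exists 0 => x; rewrite normr0.
Qed.

Lemma tameMb f g K : tame f -> measurable_fun setT g -> (forall x, `|g x| <= K) ->
  tame (fun x => f x * g x).
Proof.
move=> [mf [M fM]] mg gK; split; first exact: measurable_funM.
exists (Num.max M (M * K)) => x; have [fM1 fM2] := fM x; split.
  rewrite le_max normrM; apply/orP; right.
  by apply: ler_pM.
by rewrite gt_max => /andP[/fM2 -> _]; rewrite mul0r.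
Qed.

Lemma tameZ k f : tame f -> tame (fun x => k * f x).
Proof.
move=> tf; have -> : (fun x => k * f x) = (fun x => f x * k).
  by apply/funext => x; rewrite mulrC.
by apply: (@tameMb _ _ `|k|).
Qed.

Lemma tameD f g : tame f -> tame g -> tame (fun x => f x + g x).
Proof.
move=> [mf [M fM]] [mg [N gN]]; split; first exact: measurable_funD.
exists (M + N) => x; have [f1 f2] := fM x; have [g1 g2] := gN x.
have M0 : 0 <= M by exact: le_trans f1.
have N0 : 0 <= N by exact: le_trans g1.
split; first by rewrite (le_trans (ler_normD _ _))// lerD.
move=> MN; rewrite f2 ?g2 ?addr0//; apply: le_lt_trans MN; lra.
Qed.

Lemma tameN f : tame f -> tame (fun x => - f x).
Proof.
by move=> /(tameZ (-1)); under eq_fun do rewrite mulN1r.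
Qed.

Lemma tameB f g : tame f -> tame g -> tame (fun x => f x - g x).
Proof. by move=> tf /tameN; exact: tameD. Qed.

Lemma tame_sum (J : Type) (s : seq J) (h : J -> R -> R) :
  (forall j, tame (h j)) -> tame (fun x => \sum_(j <- s) h j x).
Proof.
move=> th; elim: s => [|j s IH].
  by under eq_fun do rewrite big_nil; exact: tame0.
by under eq_fun do rewrite big_cons; exact: tameD.
Qed.

Lemma tameM f g : tame f -> tame g -> tame (fun x => f x * g x).
Proof.
by move=> tf [mg [N gN]]; apply: (@tameMb _ _ N) => // x; have [] := gN x.
Qed.

Lemma tame_itv (a b : R) ba bb : tame (\1_[set` Interval (BSide ba a) (BSide bb b)]).
Proof.
split=> //.
exists (Num.max 1 (`|a| + `|b|)) => x; split.
  by rewrite le_max indicE; case: (_ \in _); rewrite ?normr1 ?normr0 ?lexx ?ler01.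
rewrite gt_max => /andP[_ xab]; rewrite indicE memNset//= => xI.
have : a <= x <= b.
  move: xI; rewrite in_itv /=.
  by case: ba; case: bb => /= /andP[]; lra.
have := ler_norm a; have := ler_norm b; have := ler_norm (-a).
have := ler_norm (-b); rewrite !normrN => *.
by move: xab; apply/negP; rewrite -leNgt ler_norml; lra.
Qed.

Lemma integD f g : tame f -> tame g ->
  integ (fun x => f x + g x) = integ f + integ g.
Proof. by move=> tf tg; rewrite /integ RintegralD//; exact: tame_integrable. Qed.

Lemma integZ k f : tame f -> integ (fun x => k * f x) = k * integ f.
Proof. by move=> tf; rewrite /integ RintegralZl//; exact: tame_integrable. Qed.

Lemma integB f g : tame f -> tame g ->
  integ (fun x => f x - g x) = integ f - integ g.
Proof. by move=> tf tg; rewrite /integ RintegralB//; exact: tame_integrable. Qed.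

Lemma integ0 : integ (fun=> 0) = 0.
Proof. by rewrite /integ /Rintegral integral0. Qed.

Lemma integ_sum (J : Type) (s : seq J) (h : J -> R -> R) :
  (forall j, tame (h j)) ->
  integ (fun x => \sum_(j <- s) h j x) = \sum_(j <- s) integ (h j).
Proof.
move=> th; elim: s => [|j s IH].
  by under eq_fun do rewrite big_nil; rewrite big_nil integ0.
under eq_fun do rewrite big_cons.
by rewrite integD// ?IH ?big_cons//; exact: tame_sum.
Qed.

Lemma le_integ f g : tame f -> tame g -> (forall x, f x <= g x) ->
  integ f <= integ g.
Proof.
by move=> tf tg fg; apply: le_Rintegral => //; exact: tame_integrable.
Qed.

Lemma integ_ge0 f : (forall x, 0 <= f x) -> 0 <= integ f.
Proof. by move=> f0; apply: Rintegral_ge0. Qed.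

Lemma integ_itv (a b : R) ba bb : a <= b ->
  integ (\1_[set` Interval (BSide ba a) (BSide bb b)]) = b - a.
Proof.
move=> ab; rewrite /integ /Rintegral integral_indic// setIT/= lebesgue_measure_itv/= lte_fin.
case: ltP => [_|ba'] //=; have -> : a = b by apply/le_anti/andP.
by rewrite subrr.
Qed.

Lemma measurable_affine (c e : R) : measurable_fun setT (fun y : R => c * y + e).
Proof. by apply: measurable_funD => //; exact: mulrl_measurable. Qed.

Lemma tame_affine f c e : c != 0 -> tame f -> tame (fun y => f (c * y + e)).
Proof.
move=> c0 [mf [M fM]]; split.
  by apply: (measurableT_comp mf); exact: measurable_affine.
exists (Num.max M ((M + `|e|) / `|c|)) => x; have [f1 f2] := fM (c * x + e).
split; first by rewrite le_max f1.
rewrite gt_max => /andP[_]; rewrite ltr_pdivrMr ?normr_gt0// => Mx.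
apply: f2; have := lerB_normD (c * x) e; rewrite normrM mulrC => *; lra.
Qed.

(** Lebesgue measure is determined by the lengths of bounded intervals, so it
equals |c| times its own image by the affine map. *)
Lemma ge0_integral_affine (c e : R) (f : R -> \bar R) : c != 0 ->
  measurable_fun setT f -> (forall x, 0 <= f x)%E ->
  (\int[leb]_x f x = `|c|%:E * \int[leb]_y f (c * y + e)%R)%E.
Proof.
move=> c0 mf f0.
pose phi (y : measurableTypeR R) : measurableTypeR R := c * y + e.
have mphi : measurable_fun setT phi by exact: measurable_affine.
pose m1 : {measure set (measurableTypeR R) -> \bar R} :=
  measure_function_pushforward__canonical__measure_function_Measure leb mphi.
pose m2 : {measure set (measurableTypeR R) -> \bar R} :=
  mscale (NngNum (normr_ge0 c)) m1.
have m2E : forall A, measurable A -> leb A = m2 A.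
  apply: lebesgue_measure_unique.
  move=> _ [[a b]] _ <- /=; rewrite /m2 /mscale /= /m1 /= /pushforward/=.
  have [c_gt0|c_lt0|/esym/eqP] := ltgtP 0 c; last by rewrite (negbTE c0).
  - rewrite (_ : _ @^-1` _ = `](a - e) / c, (b - e) / c]%classic); last first.
      apply/seteqP; split => y /=; rewrite !in_itv/= /phi;
        by rewrite ltr_pdivrMr// ler_pdivlMr// ltrBlDr lerBrDr mulrC.
    rewrite !lebesgue_measure_itv/= !lte_fin ltr_pM2r ?invr_gt0// ltrD2r.
    case: ifP => _; last by rewrite mule0.
    rewrite -EFinB -EFinM gtr0_norm//; congr EFin; field=> //.
  - rewrite (_ : _ @^-1` _ = `[(b - e) / c, (a - e) / c[%classic); last first.
      apply/seteqP; split => y /=; rewrite !in_itv/= /phi andbC;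
        by rewrite ltr_ndivlMr// ler_ndivrMr// ltrBlDr lerBrDr mulrC.
    rewrite !lebesgue_measure_itv/= !lte_fin ltr_nM2r ?invr_lt0// ltrD2r.
    case: ifP => _; last by rewrite mule0.
    rewrite -EFinB -EFinM ltr0_norm//; congr EFin; field=> //.
have mfphi : measurable_fun setT (f \o phi) by exact: measurableT_comp.
rewrite (@eq_measure_integral _ _ _ setT m2); last by move=> A mA _; exact: m2E.
rewrite ge0_integral_mscale// /m1.
by rewrite ge0_integral_pushforward//= preimage_setT.
Qed.

Lemma integ_affine f c e : c != 0 -> tame f ->
  integ f = `|c| * integ (fun y => f (c * y + e)).
Proof.
move=> c0 tf; have ti := tame_integrable tf.
have tg := tame_affine e c0 tf; have tgi := tame_integrable tg.
have mf : measurable_fun setT (EFin \o f) by apply/measurable_EFinP; case: tf.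
rewrite /integ /Rintegral integralE [X in _ = _ * fine X]integralE.
have E1 := @ge0_integral_affine c e _ c0 (measurable_funepos mf) (funepos_ge0 _).
have E2 := @ge0_integral_affine c e _ c0 (measurable_funeneg mf) (funeneg_ge0 _).
have p := integrable_pos_fin_num measurableT tgi.
have n := integrable_neg_fin_num measurableT tgi.
rewrite E1 E2; set g := EFin \o _ in p n.
transitivity (fine (`|c|%:E * (\int[leb]_y g^\+ y) - `|c|%:E * (\int[leb]_y g^\- y))%E).
  by congr (fine (_ * _ - _ * _)%E); apply: eq_integral => y _; rewrite ?funeposE ?funenegE.
rewrite [in RHS]fineB// mulrBr [LHS]fineB ?fin_numM// !fineM//.
Qed.

Definition tame2 F : Prop := measurable_fun setT F /\
  exists M, forall x, `|F x| <= M /\ (M < `|x.1| \/ M < `|x.2| -> F x = 0).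

(** An iterated integral, so that one variable computations apply to it directly;
[integ2E] identifies it with the integral over the plane. *)
Definition integ2 F : R := integ (fun x => integ (fun y => F (x, y))).

Lemma tame2_section1 F x : tame2 F -> tame (fun y => F (x, y)).
Proof.
move=> [mF [M FM]]; split; first exact: measurable_fun_pair2.
by exists M => y; have [F1 F2] := FM (x, y); split=> // My; apply: F2; right.
Qed.

Lemma tame2_section2 F y : tame2 F -> tame (fun x => F (x, y)).
Proof.
move=> [mF [M FM]]; split; first exact: measurable_fun_pair1.
by exists M => x; have [F1 F2] := FM (x, y); split=> // My; apply: F2; left.
Qed.

Lemma tame2_swap F : tame2 F -> tame2 (fun z => F (z.2, z.1)).
Proof.
move=> [mF [M FM]]; split.
  by apply: (measurableT_comp mF); apply: measurable_fun_pair => //.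
by exists M => -[x y]; have [F1 F2] := FM (y, x); split=> // -[] My;
  apply: F2; [right|left].
Qed.

Lemma tame2_integrable F : tame2 F ->
  (lebesgue2 R).-integrable setT (EFin \o F).
Proof.
move=> [mF [M FM]].
have mD : measurable (`[-M, M]%classic `*` `[-M, M]%classic : set (R * R)).
  by apply: measurableX => //; exact: measurable_itv.
have iM : (lebesgue2 R).-integrable (`[-M, M] `*` `[-M, M]) (EFin \o F).
  apply: measurable_bounded_integrable => //=.
  - rewrite product_measure1E//= !lebesgue_measure_itv/=.
    by case: ifP => // _; rewrite ?mul0e// -EFinD -EFinM ltry.
  - exact: measurable_funS mF.
  - exists M; split; first exact: num_real.
    by move=> K MK x _; apply: le_trans (ltW MK); have [] := FM x.
move: iM; rewrite integrable_mkcond//; congr (integrable _ _ _).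
apply/funext => x; rewrite patchE /=; case: ifPn => //.
rewrite notin_setE /= !in_itv /= => xM; have [_ ->//] := FM x.
apply: contrapT => /not_orP[/negP + /negP]; rewrite -!leNgt !ler_norml => a b; exact: xM.
Qed.

Lemma EFin_integ f : tame f -> (integ f)%:E = (\int[leb]_x (f x)%:E)%E.
Proof.
move=> tf; rewrite /integ fineK//; apply: integrable_fin_num => //.
exact: tame_integrable.
Qed.

Lemma tame2_integ F : tame2 F -> tame (fun x => integ (fun y => F (x, y))).
Proof.
move=> tF; split.
  apply/measurable_EFinP.
  have := measurable_fubini_F (tame2_integrable tF).
  by congr measurable_fun; apply/funext => x /=; rewrite EFin_integ//;
    exact: tame2_section1.
have [mF [M FM]] := tF; have M0 : 0 <= M.
  by apply: le_trans (FM (0, 0)).1.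
exists (Num.max M (M * (2 * M))) => x; split; last first.
  rewrite gt_max => /andP[Mx _].
  have -> : (fun y => F (x, y)) = (fun=> 0).
    by apply/funext => y; apply: (FM (x, y)).2; left.
  by rewrite integ0.
rewrite le_max; apply/orP; right; rewrite ler_norml.
have tI : tame (fun y => M * \1_`[-M, M] y) by apply: tameZ; exact: tame_itv.
have EI : integ (fun y => M * \1_`[-M, M] y) = M * (2 * M).
  rewrite integZ ?integ_itv; first by congr (_ * _); ring.
  - lra.
  - exact: tame_itv.
have FI y : `|F (x, y)| <= M * \1_`[-M, M] y.
  have [F1 F2] := FM (x, y); rewrite indicE; case: (boolP (y \in _)) => /= yM.
    by rewrite mulr1.
  rewrite mulr0 F2 ?normr0//; right; move: yM.
  by rewrite notin_setE/= in_itv/= ltNge ler_norml => /negP.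
have tx := tame2_section1 x tF.
apply/andP; split; last first.
  rewrite -EI; apply: le_integ => // y; exact: le_trans (ler_norm _) (FI y).
rewrite -EI -mulN1r -integZ//; apply: le_integ => //; first exact: tameZ.
by move=> y; rewrite mulN1r lerNl (le_trans (ler_norm _))// normrN.
Qed.

Lemma integ2E F : tame2 F -> (integ2 F)%:E = (\int[lebesgue2 R]_z (F z)%:E)%E.
Proof.
move=> tF; rewrite -(integral12_prod_meas1 (tame2_integrable tF)) /integ2.
rewrite EFin_integ; last exact: tame2_integ.
by apply: eq_integral => x _; rewrite EFin_integ//; exact: tame2_section1.
Qed.

Lemma integ2_swap F : tame2 F -> integ2 F = integ2 (fun z => F (z.2, z.1)).
Proof.
move=> tF; apply: EFin_inj; rewrite integ2E//.
rewrite -(integral21_prod_meas1 (tame2_integrable tF)) /integ2.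
rewrite EFin_integ; last by apply: tame2_integ (tame2_swap tF).
apply: eq_integral => x _; rewrite EFin_integ//=; exact: tame2_section2.
Qed.

Lemma tame2Mb F G K : tame2 F -> measurable_fun setT G ->
  (forall x, `|G x| <= K) -> tame2 (fun x => F x * G x).
Proof.
move=> [mF [M FM]] mG GK; split; first exact: measurable_funM.
exists (Num.max M (M * K)) => x; have [F1 F2] := FM x; split.
  by rewrite le_max normrM; apply/orP; right; apply: ler_pM.
move=> xM; rewrite F2 ?mul0r//.
by case: xM; rewrite gt_max => /andP[xM _]; [left|right].
Qed.

Lemma tame2Z k F : tame2 F -> tame2 (fun x => k * F x).
Proof.
move=> tF; have -> : (fun x => k * F x) = (fun x => F x * k).
  by apply/funext => x; rewrite mulrC.
by apply: (@tame2Mb _ _ `|k|).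
Qed.

Lemma tame2D F G : tame2 F -> tame2 G -> tame2 (fun x => F x + G x).
Proof.
move=> [mF [M FM]] [mG [N GN]]; split; first exact: measurable_funD.
exists (M + N) => x; have [F1 F2] := FM x; have [G1 G2] := GN x.
have M0 : 0 <= M by exact: le_trans F1.
have N0 : 0 <= N by exact: le_trans G1.
split; first by rewrite (le_trans (ler_normD _ _))// lerD.
by move=> MN; rewrite F2 ?G2 ?addr0//; case: MN => MN;
  [left|right|left|right]; apply: le_lt_trans MN; lra.
Qed.

Lemma tame2B F G : tame2 F -> tame2 G -> tame2 (fun x => F x - G x).
Proof.
move=> tF tG; have -> : (fun x => F x - G x) = (fun x => F x + (-1) * G x).
  by apply/funext => x; rewrite mulN1r.
by apply: tame2D => //; exact: tame2Z.
Qed.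

Lemma tame2M F G : tame2 F -> tame2 G -> tame2 (fun x => F x * G x).
Proof.
by move=> tF [mG [N GN]]; apply: (@tame2Mb _ _ N) => // x; have [] := GN x.
Qed.

Lemma tame20 : tame2 (fun=> 0).
Proof. by split=> //; exists 0 => x; rewrite normr0. Qed.

Lemma tame2_sum (J : Type) (s : seq J) (h : J -> R * R -> R) :
  (forall j, tame2 (h j)) -> tame2 (fun x => \sum_(j <- s) h j x).
Proof.
move=> th; elim: s => [|j s IH].
  by under eq_fun do rewrite big_nil; exact: tame20.
by under eq_fun do rewrite big_cons; exact: tame2D.
Qed.

Lemma tame2_prod f g : tame f -> tame g -> tame2 (fun z => f z.1 * g z.2).
Proof.
move=> [mf [M fM]] [mg [N gN]]; split.
  by apply: measurable_funM; [apply: (measurableT_comp mf)|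
    apply: (measurableT_comp mg)].
exists (Num.max (M * N) (Num.max M N)) => -[x y]/=.
have [f1 f2] := fM x; have [g1 g2] := gN y; split.
  by rewrite normrM le_max ler_pM.
by rewrite !gt_max => -[] /and3P[_ a b]; [rewrite f2// mul0r|rewrite g2// mulr0].
Qed.

Lemma integ2_prod f g : tame f -> tame g ->
  integ2 (fun z => f z.1 * g z.2) = integ f * integ g.
Proof.
move=> tf tg; rewrite /integ2 /=; under eq_fun do rewrite integZ//.
under eq_fun do rewrite mulrC.
by rewrite integZ// mulrC.
Qed.

Lemma integ2D F G : tame2 F -> tame2 G ->
  integ2 (fun x => F x + G x) = integ2 F + integ2 G.
Proof.
move=> tF tG; rewrite /integ2 -integD; [|exact: tame2_integ..].
by congr integ; apply/funext => x; rewrite integD//; exact: tame2_section1.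
Qed.

Lemma integ2Z k F : tame2 F -> integ2 (fun x => k * F x) = k * integ2 F.
Proof.
move=> tF; rewrite /integ2 -integZ; last exact: tame2_integ.
by congr integ; apply/funext => x; rewrite integZ//; exact: tame2_section1.
Qed.

Lemma integ2B F G : tame2 F -> tame2 G ->
  integ2 (fun x => F x - G x) = integ2 F - integ2 G.
Proof.
move=> tF tG; have -> : (fun x => F x - G x) = (fun x => F x + (-1) * G x).
  by apply/funext => x; rewrite mulN1r.
by rewrite integ2D ?integ2Z ?mulN1r//; exact: tame2Z.
Qed.

Lemma integ20 : integ2 (fun=> 0) = 0.
Proof. by rewrite /integ2; under eq_fun do rewrite integ0; rewrite integ0. Qed.

Lemma integ2_sum (J : Type) (s : seq J) (h : J -> R * R -> R) :
  (forall j, tame2 (h j)) ->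
  integ2 (fun x => \sum_(j <- s) h j x) = \sum_(j <- s) integ2 (h j).
Proof.
move=> th; elim: s => [|j s IH].
  by under eq_fun do rewrite big_nil; rewrite big_nil integ20.
under eq_fun do rewrite big_cons.
by rewrite integ2D// ?IH ?big_cons//; exact: tame2_sum.
Qed.

Lemma le_integ2 F G : tame2 F -> tame2 G -> (forall x, F x <= G x) ->
  integ2 F <= integ2 G.
Proof.
move=> tF tG FG; apply: le_integ; [exact: tame2_integ..|] => x.
by apply: le_integ => //; exact: tame2_section1.
Qed.

Lemma integ2_ge0 F : (forall x, 0 <= F x) -> 0 <= integ2 F.
Proof. by move=> F0; apply: integ_ge0 => x; apply: integ_ge0. Qed.

Lemma tame2_affine F c e c' e' : c != 0 -> c' != 0 -> tame2 F ->
  tame2 (fun z => F (c * z.1 + e, c' * z.2 + e')).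
Proof.
move=> c0 c'0 [mF [M FM]]; split.
  apply: (measurableT_comp mF); apply: measurable_fun_pair => /=.
    by apply: (measurableT_comp (measurable_affine c e)).
  by apply: (measurableT_comp (measurable_affine c' e')).
exists (Num.max M (Num.max ((M + `|e|) / `|c|) ((M + `|e'|) / `|c'|))) => -[x y].
have [F1 F2] := FM (c * x + e, c' * y + e').
split; first by rewrite le_max F1.
rewrite !gt_max => -[] /and3P[_]; rewrite !ltr_pdivrMr ?normr_gt0//= => Mx My;
  apply: F2; rewrite /=; [left|right].
  by have := lerB_normD (c * x) e; rewrite normrM mulrC => *; lra.
by have := lerB_normD (c' * y) e'; rewrite normrM mulrC => *; lra.
Qed.

Lemma integ2_affine F c e c' e' : c != 0 -> c' != 0 -> tame2 F ->
  integ2 F = `|c| * `|c'| * integ2 (fun z => F (c * z.1 + e, c' * z.2 + e')).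
Proof.
move=> c0 c'0 tF; rewrite /integ2 (integ_affine e c0 (tame2_integ tF)) -mulrA.
congr (_ * _); rewrite -integZ; last exact: tame2_integ (tame2_affine e e' c0 c'0 tF).
congr integ; apply/funext => x; rewrite (integ_affine e' c'0)//.
exact: tame2_section1.
Qed.

End tame.

(** The integral of a nonnegative function is a supremum over the simple
functions below it, hence monotone without any measurability. The discrepancy
is not known to be Borel in t when C is not Borel. *)
Lemma ge0_le_integral_nonmeasurable d (T : measurableType d) (R : realType)
    (mu : {measure set T -> \bar R}) (D : set T) (f1 f2 : T -> \bar R) :
  (forall x, D x -> 0 <= f1 x)%E -> (forall x, D x -> f1 x <= f2 x)%E ->
  (\int[mu]_(x in D) f1 x <= \int[mu]_(x in D) f2 x)%E.
Proof.
move=> f10 f12; rewrite integral_mkcond [leRHS]integral_mkcond.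
have g1 x : (0 <= (f1 \_ D) x)%E.
  by rewrite patchE; case: ifPn => // /set_mem; exact: f10.
have g12 x : ((f1 \_ D) x <= (f2 \_ D) x)%E.
  by rewrite !patchE; case: ifPn => // /set_mem; exact: f12.
rewrite !ge0_integralTE//; last by move=> x; exact: le_trans (g12 x).
apply: ereal_sup_le => _ [h /= hf <-]; exists h => //= x.
exact: le_trans (hf x) (g12 x).
Qed.

(** A minorant g of f may be negative somewhere; its positive part is still a
minorant, as f is nonnegative. *)
Lemma le_integral_integrable d (T : measurableType d) (R : realType)
    (mu : {measure set T -> \bar R}) (D : set T) (g : T -> R) (f : T -> \bar R) :
  measurable D -> mu.-integrable D (EFin \o g) -> (forall x, D x -> 0 <= f x)%E ->
  (forall x, D x -> (g x)%:E <= f x)%E ->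
  (\int[mu]_(x in D) (g x)%:E <= \int[mu]_(x in D) f x)%E.
Proof.
move=> mD ig f0 gf; apply: (@le_trans _ _ (\int[mu]_(x in D) (EFin \o g)^\+ x)%E).
  apply: le_integral => //; first exact: integrable_funepos.
  by move=> x _; rewrite funeposE le_max lexx.
apply: ge0_le_integral_nonmeasurable => x Dx //.
by rewrite funeposE ge_max gf// f0.
Qed.

(** * The averaging kernel *)

Section kernel.
Variable R : realType.
Implicit Types (f g F : R -> R).

Lemma is_derive_continuous f F : (forall x : R, is_derive x 1 F (f x)) ->
  continuous F.
Proof.
move=> dF x; apply: differentiable_continuous; apply/derivable1_diffP.
by have := dF x.
Qed.

Lemma integ_FTC f F (a b : R) : a < b -> (forall x : R, is_derive x 1 F (f x)) ->
  continuous f -> integ (fun x => \1_`[a, b] x * f x) = F b - F a.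
Proof.
move=> ab dF cf; rewrite /integ.
have -> : (fun x => \1_`[a, b] x * f x) = (f \_ `[a, b]).
  by apply/funext => x; rewrite patchE indicE; case: ifP => _; rewrite ?mul1r ?mul0r.
rewrite -Rintegral_mkcond /Rintegral (@continuous_FTC2 _ f F)//.
- exact: continuous_subspaceT.
- have cF := is_derive_continuous dF.
  split=> [x _||]; first by have := dF x.
    exact/cvg_at_right_filter/cF.
  exact/cvg_at_left_filter/cF.
- by move=> x _; rewrite derive1E; have [_ ->] := dF x.
Qed.

(** This weight makes the kernel below nonnegative with decay y^-3. Being at most l
near 0, it is also compatible with the factor l^4 of [spectral_mass]. *)
Definition bump (l : R) : R := \1_`[0, 1] l * (l * (1 - l) ^+ 2).

Definition kern (y : R) : R := integ (fun l => bump l * sin (l * y)).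

Lemma continuous_measurable f : continuous f -> measurable_fun setT f.
Proof. exact: continuous_measurable_fun. Qed.

Lemma tame_cont_itv f (a b : R) : continuous f -> tame (fun x => \1_`[a, b] x * f x).
Proof.
move=> cf; have [ab|ba] := leP a b; last first.
  rewrite (_ : (fun _ => _) = fun=> 0); first exact: tame0.
  apply/funext => x; rewrite indicE memNset ?mul0r//= in_itv/=.
  by case/andP => ax xb; move: ba; rewrite ltNge (le_trans ax xb).
have [M [_ Mf]] : bounded_set (f @` `[a, b]).
  apply: compact_bounded; apply: continuous_compact; last exact: segment_compact.
  exact: continuous_subspaceT.
split; first by apply: measurable_funM => //; exact: continuous_measurable.
exists (Num.max (`|M| + 1) (`|a| + `|b|)) => x; split.
  rewrite le_max; apply/orP; left; rewrite indicE.
  case: (boolP (x \in _)) => [/set_mem xab|_].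
    by rewrite mul1r; apply: Mf; [rewrite ltr_pwDr// ler_norm|exists x].
  by rewrite mul0r normr0 addr_ge0.
rewrite gt_max => /andP[_ xM]; rewrite indicE memNset ?mul0r//= in_itv/= => xab.
move: xM; apply/negP; rewrite -leNgt ler_norml.
have := ler_norm a; have := ler_norm b; have := ler_norm (-a).
have := ler_norm (-b); rewrite !normrN => *; lra.
Qed.

Lemma continuous_bump_poly : continuous (fun l : R => l * (1 - l) ^+ 2).
Proof.
exact: is_derive_continuous.
Qed.

Lemma tame_bump : tame bump.
Proof. exact/tame_cont_itv/continuous_bump_poly. Qed.

Lemma continuous_sin_scale (y : R) : continuous (fun l : R => sin (l * y)).
Proof.
apply: is_derive_continuous => l.
Qed.

(** The primitive comes from three integrations by parts. *)
Lemma kernE (y : R) : y != 0 ->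
  kern y = (2 * cos y + 4) / y ^+ 3 - 6 * sin y / y ^+ 4.
Proof.
move=> y0.
pose f (l : R) := (l * (1 - l) ^+ 2) * sin (l * y).
pose F (l : R) := - (l - 2 * l ^+ 2 + l ^+ 3) * cos (l * y) / y +
  (1 - 4 * l + 3 * l ^+ 2) * sin (l * y) / y ^+ 2 +
  (6 * l - 4) * cos (l * y) / y ^+ 3 - 6 * sin (l * y) / y ^+ 4.
rewrite /kern; have -> : (fun l => bump l * sin (l * y)) =
   (fun l => \1_`[0, 1] l * f l).
  by apply/funext => l; rewrite /bump /f -!mulrA.
have dF (l : R) : is_derive l 1 F (f l).
  have dl : is_derive l 1 (fun l : R => l * y) y.
    by apply: is_derive_eq; rewrite /GRing.scale/=; ring.
  have dc : is_derive l 1 (fun l : R => cos (l * y)) (- sin (l * y) * y).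
    by apply: is_derive_eq; rewrite /GRing.scale/=; ring.
  have ds : is_derive l 1 (fun l : R => sin (l * y)) (cos (l * y) * y).
    by apply: is_derive_eq; rewrite /GRing.scale/=; ring.
  rewrite /F /f; apply: is_derive_eq.
  by rewrite /GRing.scale/=; field.
rewrite (integ_FTC ltr01 dF)//.
  rewrite /F !mul0r !mul1r !expr1n !expr0n /= !mulr0 !mulr1 sin0 cos0.
  by field.
by rewrite /f; exact: is_derive_continuous.
Qed.

Lemma mean_value f df (a b : R) : (forall x : R, is_derive x 1 f (df x)) -> a <= b ->
  exists2 c, a <= c <= b & f b - f a = df c * (b - a).
Proof.
move=> df_f ab; apply: (MVT_segment ab).
exact/continuous_subspaceT/is_derive_continuous.
Qed.

Lemma abs_sin_le (y : R) : 0 <= y -> `|sin y| <= y.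
Proof.
move=> y0.
have [c _] := mean_value (@is_derive_sin R) y0.
rewrite sin0 !subr0 => ->; rewrite normrM [X in _ * X]ger0_norm//.
by rewrite ler_piMl// cos_max.
Qed.

Lemma abs_1Bcos_le (y : R) : 0 <= y -> `|1 - cos y| <= y.
Proof.
move=> y0.
have [c _] := mean_value (@is_derive_cos R) y0.
rewrite cos0 !subr0 distrC => ->.
rewrite normrM normrN [X in _ * X]ger0_norm//.
by rewrite ler_piMl// sin_max.
Qed.

Lemma bump_ge0 l : 0 <= bump l.
Proof.
rewrite /bump indicE; case: (boolP (l \in _)) => [/set_mem|_]; last by rewrite mul0r.
by rewrite /= in_itv/= => /andP[l0 _]; rewrite mul1r mulr_ge0// sqr_ge0.
Qed.

Lemma bump_le l : bump l <= \1_`[0, 1] l * l.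
Proof.
rewrite /bump indicE; case: (boolP (l \in _)) => [/set_mem|_]; last by rewrite !mul0r.
rewrite /= in_itv/= => /andP[l0 l1]; rewrite !mul1r ler_piMr// expr_le1//; lra.
Qed.

Lemma bump_sin_ge0 (l y : R) : 0 <= y <= pi -> 0 <= bump l * sin (l * y).
Proof.
move=> /andP[y0 ypi]; have [l01|l01] := boolP (l \in `[0, 1]%classic); last first.
  by rewrite /bump indicE (negbTE l01) !mul0r.
apply: mulr_ge0; first exact: bump_ge0.
move: l01 => /set_mem/=; rewrite in_itv/= => /andP[l0 l1].
apply: sin_ge0_pi; rewrite mulr_ge0//=; apply: le_trans ypi.
by rewrite ler_piMl.
Qed.

Lemma measurable_sin_mul : measurable_fun setT (fun z : R * R => sin (z.1 * z.2)).
Proof.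
apply: (measurableT_comp (continuous_measurable (@continuous_sin R))).
exact: measurable_funM.
Qed.

Lemma measurable_cos_mul : measurable_fun setT (fun z : R * R => cos (z.1 * z.2)).
Proof.
apply: (measurableT_comp (continuous_measurable (@continuous_cos R))).
exact: measurable_funM.
Qed.

Lemma tame_bump_sin y : tame (fun l => bump l * sin (l * y)).
Proof.
apply: (@tameMb _ _ _ 1); first exact: tame_bump.
  exact: (continuous_measurable (@continuous_sin_scale y)).
by move=> x; exact: sin_max.
Qed.

(** The integrand is nonnegative for y <= pi. In closed form the sign is that of
(2 cos y + 4) y - 6 sin y, where the sine is nonpositive on [pi, 2 pi] and
2 y >= 6 afterwards. *)
Lemma kern_ge0 (y : R) : 0 < y -> 0 <= kern y.
Proof.
move=> y0; have [ypi|piy] := leP y pi.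
  by apply: integ_ge0 => l; apply: bump_sin_ge0; rewrite ypi ltW.
rewrite kernE ?gt_eqF//.
have -> : (2 * cos y + 4) / y ^+ 3 - 6 * sin y / y ^+ 4 =
  ((2 * cos y + 4) * y - 6 * sin y) / y ^+ 4 by field; rewrite gt_eqF.
apply: divr_ge0; last by rewrite exprn_ge0// ltW.
have c1 := cos_geN1 y; have s1 := sin_le1 y; have p2 := @pi_ge2 R.
have cy : 2 * y <= (2 * cos y + 4) * y by rewrite ler_pM2r//; lra.
have [y2pi|pi2y] := leP y (pi *+ 2); last by rewrite mulr2n in pi2y; lra.
suff : sin y <= 0 by lra.
rewrite -[y](subrK pi) sinDpi oppr_le0 sin_ge0_pi//.
by rewrite mulr2n in y2pi; lra.
Qed.

Lemma kern_le1 (y : R) : kern y <= 1.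
Proof.
apply: (@le_trans _ _ (integ (\1_`[0, 1] : R -> R))).
  apply: le_integ; [exact: tame_bump_sin|exact: tame_itv|] => l.
  rewrite /bump indicE; case: (boolP (l \in _)) => [/set_mem|_]; last by rewrite !mul0r.
  rewrite /= in_itv/= => /andP[l0 l1]; rewrite mul1r (le_trans (ler_norm _))//.
  have b0 : 0 <= l * (1 - l) ^+ 2 by rewrite mulr_ge0// sqr_ge0.
  have b1 : l * (1 - l) ^+ 2 <= 1.
    by rewrite mulr_ile1// ?sqr_ge0// expr_le1//; lra.
  by rewrite normrM (ger0_norm b0) mulr_ile1// sin_max.
by rewrite integ_itv// subr0.
Qed.

Lemma kern_le3 (y : R) : 0 < y -> kern y <= 12 / y ^+ 3.
Proof.
move=> y0; rewrite kernE ?gt_eqF//.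
have -> : (2 * cos y + 4) / y ^+ 3 - 6 * sin y / y ^+ 4 =
  ((2 * cos y + 4) * y - 6 * sin y) / y ^+ 4 by field; rewrite gt_eqF.
have -> : 12 / y ^+ 3 = 12 * y / y ^+ 4 by field; rewrite gt_eqF.
rewrite ler_pM2r ?invr_gt0 ?exprn_gt0//.
have c1 := cos_le1 y; have := abs_sin_le (ltW y0); rewrite ler_norml => /andP[s1 s2].
have : (2 * cos y + 4) * y <= 6 * y by rewrite ler_pM2r//; lra.
lra.
Qed.

(** A majorant with a known integral, the derivative of 24 atan. *)
Lemma kern_le_atan (y : R) : 0 < y -> kern y <= 24 / (1 + y ^+ 2).
Proof.
move=> y0; have [y1|y1] := leP y 1.
  apply: le_trans (kern_le1 y) _; rewrite ler_pdivlMr ?mul1r.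
    by have : y ^+ 2 <= 1 by [rewrite expr_le1// ltW]; lra.
  by have := sqr_ge0 y; lra.
apply: le_trans (kern_le3 y0) _.
rewrite ler_pdivrMr ?exprn_gt0// mulrAC ler_pdivlMr; last by have := sqr_ge0 y; lra.
have : 1 <= y ^+ 2 by rewrite expr_ge1// ltW.
have : y ^+ 2 <= y ^+ 3 by rewrite [y ^+ 3]exprS ler_peMl ?sqr_ge0// ltW.
lra.
Qed.

Definition kern_lb : R := sin (8^-1) / 64.

Lemma kern_lb_gt0 : 0 < kern_lb.
Proof.
by apply: divr_gt0 => //; apply: sin_gt0_pi; have := @pi_ge2 R; lra.
Qed.

(** For l in [1/4, 1/2] the weight is at least 1/16 and the sine at least
sin (1/8); this interval has length 1/4. *)
Lemma kern_ge_lb (y : R) : 2^-1 <= y <= 1 -> kern_lb <= kern y.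
Proof.
move=> /andP[y0 y1]; have p2 := @pi_ge2 R.
pose g (l : R) : R := (\1_`[4^-1, 2^-1] l) * (sin (8^-1) / 16).
have tI : tame (\1_`[4^-1, 2^-1] : R -> R) by exact: tame_itv.
have tg : tame g.
  by rewrite /g; under eq_fun do rewrite mulrC; exact: tameZ.
have -> : kern_lb = integ g.
  rewrite /g; under eq_fun do rewrite mulrC.
  by rewrite integZ// integ_itv ?/kern_lb; [field|lra].
apply: le_integ => //; first exact: tame_bump_sin.
move=> l; rewrite /g indicE.
have [l01|_] := boolP (l \in _); last first.
  by rewrite mul0r; apply: bump_sin_ge0; lra.
rewrite mul1r; move: l01 => /set_mem/=; rewrite in_itv/= => /andP[l0 l1].
rewrite /bump indicE mem_set/=; last by rewrite in_itv/=; lra.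
rewrite mul1r mulrC; apply: ler_pM.
- by [].
- by apply: sin_ge0_pi; lra.
- have -> : 16^-1 = 4^-1 * (2^-1) ^+ 2 :> R by field.
  by apply: ler_pM => //; rewrite ?lerXn2r// ?nnegrE; lra.
have ly1 : 4^-1 * 2^-1 <= l * y by apply: ler_pM; lra.
have ly2 : l * y <= 2^-1 * 1 by apply: ler_pM; lra.
by rewrite leNgt ltr_sin ?in_itv/= -?leNgt; lra.
Qed.

Lemma continuous_atan_deriv : continuous (fun y : R => (1 + y ^+ 2)^-1).
Proof.
have c2 : continuous (fun y : R => 1 + y ^+ 2).
  apply: (@is_derive_continuous (fun y : R => 2 * y)) => x.
  by apply: is_derive_eq; rewrite /GRing.scale/=; ring.
move=> y; apply: (continuousV _ (c2 y)).
by have := sqr_ge0 y; lra.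
Qed.

Lemma integ_atan_le (B : R) : 0 < B ->
  integ (fun y => \1_`[0, B] y * (1 + y ^+ 2)^-1) <= 2.
Proof.
move=> B0.
rewrite (integ_FTC B0 (@is_derive1_atan R)).
  by rewrite atan0 subr0 (le_trans (ltW (atan_ltpi2 _)))// ltW// pihalf_lt2.
exact: continuous_atan_deriv.
Qed.

End kernel.

(** * Kernel pairing and spectral mass *)

Section profile.
Variable R : realType.
Implicit Types (f g : R -> R).

Definition cos_coef f (l : R) : R := integ (fun y => f y * cos (l * y)).
Definition sin_coef f (l : R) : R := integ (fun y => f y * sin (l * y)).
(** Subtracting the translate of f produces the factors 1 - cos l and sin l of
[kern_pairingE], which are O(l) and supply the missing half of the factor l^4. *)
Definition kern_pairing f : R := integ (fun y => (f y - f (y - 1)) * kern y).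
(** The factor l^4 is the square of the scaling l^2 of areas under dilation. *)
Definition spectral_mass f : R := integ (fun l =>
  \1_`]0, 1] l * (l ^+ 4 * (cos_coef f l ^+ 2 + sin_coef f l ^+ 2))).

Lemma tame_shift f (e : R) : tame f -> tame (fun y => f (y + e)).
Proof.
by move=> tf; have := tame_affine e (oner_neq0 R) tf; under eq_fun do rewrite mul1r.
Qed.

Lemma integ_shift f (e : R) : tame f -> integ (fun y => f (y + e)) = integ f.
Proof.
move=> tf; rewrite (integ_affine e (oner_neq0 R) tf) normr1 mul1r.
by under [in RHS]eq_fun do rewrite mul1r.
Qed.

Lemma tame_mul_cos f (l e : R) : tame f -> tame (fun y => f y * cos (l * y + e)).
Proof.
move=> tf; apply: (@tameMb _ _ _ 1) => //.
  apply: continuous_measurable; exact: is_derive_continuous.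
by move=> x; exact: cos_max.
Qed.

Lemma tame_mul_sin f (l e : R) : tame f -> tame (fun y => f y * sin (l * y + e)).
Proof.
move=> tf; apply: (@tameMb _ _ _ 1) => //.
  apply: continuous_measurable; exact: is_derive_continuous.
by move=> x; exact: sin_max.
Qed.

Lemma tame_window_cos_coef f : tame f -> tame (fun l => \1_`]0, 1] l * cos_coef f l).
Proof.
move=> tf; rewrite /cos_coef.
have -> : (fun l => \1_`]0, 1] l * integ (fun y => f y * cos (l * y))) =
  fun l => integ (fun y => (\1_`]0, 1] l * f y) * cos (l * y)).
  apply/funext => l; rewrite -integZ; last first.
    by have := tame_mul_cos l 0 tf; under eq_fun do rewrite addr0.
  by congr integ; apply/funext => y; rewrite mulrA.
apply: (@tame2_integ _ (fun z => (\1_`]0, 1] z.1 * f z.2) * cos (z.1 * z.2))).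
apply: (@tame2Mb _ _ _ 1); first by apply: tame2_prod => //; exact: tame_itv.
  exact: measurable_cos_mul.
by move=> x; exact: cos_max.
Qed.

Lemma tame_window_sin_coef f : tame f -> tame (fun l => \1_`]0, 1] l * sin_coef f l).
Proof.
move=> tf; rewrite /sin_coef.
have -> : (fun l => \1_`]0, 1] l * integ (fun y => f y * sin (l * y))) =
  fun l => integ (fun y => (\1_`]0, 1] l * f y) * sin (l * y)).
  apply/funext => l; rewrite -integZ; last first.
    by have := tame_mul_sin l 0 tf; under eq_fun do rewrite addr0.
  by congr integ; apply/funext => y; rewrite mulrA.
apply: (@tame2_integ _ (fun z => (\1_`]0, 1] z.1 * f z.2) * sin (z.1 * z.2))).
apply: (@tame2Mb _ _ _ 1); first by apply: tame2_prod => //; exact: tame_itv.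
  exact: measurable_sin_mul.
by move=> x; exact: sin_max.
Qed.

Lemma tame_spectral f : tame f -> tame (fun l =>
  \1_`]0, 1] l * (l ^+ 4 * (cos_coef f l ^+ 2 + sin_coef f l ^+ 2))).
Proof.
move=> tf.
have -> : (fun l => \1_`]0, 1] l * (l ^+ 4 * (cos_coef f l ^+ 2 + sin_coef f l ^+ 2))) =
  fun l => (\1_`[0, 1] l * l ^+ 4) * ((\1_`]0, 1] l * cos_coef f l) *
     (\1_`]0, 1] l * cos_coef f l) +
     (\1_`]0, 1] l * sin_coef f l) * (\1_`]0, 1] l * sin_coef f l)).
  apply/funext => l; rewrite !indicE.
  have [l01|l01] := boolP (l \in `]0, 1]%classic); last by rewrite /= !mul0r addr0 mulr0.
  have l01' : l \in `[0, 1]%classic.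
    by move: l01; rewrite !inE/= !in_itv/= => /andP[/ltW -> ->].
  by rewrite l01' /=; ring.
apply: tameM; first by apply: tame_cont_itv; exact: is_derive_continuous.
by apply: tameD; apply: tameM; [exact: tame_window_cos_coef..|
  exact: tame_window_sin_coef|exact: tame_window_sin_coef].
Qed.

Lemma kern_pairingE f : tame f -> kern_pairing f =
  integ (fun l => bump l * (sin_coef f l * (1 - cos l) - cos_coef f l * sin l)).
Proof.
move=> tf; pose D y := f y - f (y - 1).
have tD : tame D by apply: tameB => //; exact: tame_shift.
pose F (z : R * R) := (D z.1 * bump z.2) * sin (z.1 * z.2).
have tF : tame2 F.
  apply: (@tame2Mb _ _ _ 1); first by apply: tame2_prod => //; exact: tame_bump.
    exact: measurable_sin_mul.
  by move=> x; exact: sin_max.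
transitivity (integ2 F).
  rewrite /kern_pairing /integ2; congr integ; apply/funext => y.
  rewrite -integZ; last exact: tame_bump_sin.
  by congr integ; apply/funext => l; rewrite /F /= mulrA mulrA [l * y]mulrC.
rewrite integ2_swap// /integ2; congr integ; apply/funext => l.
rewrite /F /=.
have -> : (fun y => D y * bump l * sin (y * l)) =
  fun y => bump l * (f y * sin (l * y + 0) - f (y - 1) * sin (l * (y - 1) + l)).
  apply/funext => y; rewrite /D (_ : l * (y - 1) + l = y * l); last by ring.
  by rewrite (_ : l * y + 0 = y * l); [ring|ring].
have ts0 : tame (fun y => f y * sin (l * y + 0)) by exact: tame_mul_sin.
have ts1 : tame (fun y => f y * sin (l * y + l)) by exact: tame_mul_sin.
rewrite integZ; last by apply: tameB => //; exact: (tame_shift (-1) ts1).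
congr (_ * _); rewrite integB//; last exact: (tame_shift (-1) ts1).
rewrite (integ_shift (-1) ts1).
have -> : (fun y => f y * sin (l * y + l)) =
  fun y => cos l * (f y * sin (l * y + 0)) + sin l * (f y * cos (l * y + 0)).
  by apply/funext => y; rewrite sinD !addr0; ring.
have tc0 : tame (fun y => f y * cos (l * y + 0)) by exact: tame_mul_cos.
rewrite integD ?integZ//; [|exact: tameZ..].
rewrite /sin_coef /cos_coef; do ?under eq_fun do rewrite addr0.
under [in X in sin l * X]eq_fun do rewrite addr0; ring.
Qed.

(** By [kern_pairingE] the pairing is at most the integral of l^2 (|a| + |b|),
with a, b the two coefficients of f at l. Cauchy and Schwarz conclude, in the
form 2 x z <= x^2 / s + s z^2 with an optimal s. *)
Lemma spectral_mass_ge f : tame f -> 0 <= kern_pairing f ->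
  kern_pairing f ^+ 2 / 2 <= spectral_mass f.
Proof.
move=> tf; rewrite le_eqVlt => /predU1P[<-|T0].
  rewrite expr0n mul0r; apply: integ_ge0 => l.
  apply: mulr_ge0 => //; apply: mulr_ge0; first exact: exprn_even_ge0.
  by apply: addr_ge0; exact: sqr_ge0.
set T := kern_pairing f in T0 *.
suff H : T <= (2 * (T / 2))^-1 * spectral_mass f + T / 2.
  have : T / 2 <= (2 * (T / 2))^-1 * spectral_mass f by lra.
  have -> : 2 * (T / 2) = T by field.
  by rewrite ler_pdivlMl//; lra.
have : 0 < T / 2 by lra.
move: (T / 2) => t t0.
have tS := tame_spectral tf.
have tI : tame (\1_`]0, 1] : R -> R) by exact: tame_itv.
have EI : integ (fun l => (2 * t)^-1 *
   (\1_`]0, 1] l * (l ^+ 4 * (cos_coef f l ^+ 2 + sin_coef f l ^+ 2)))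
   + t * \1_`]0, 1] l) = (2 * t)^-1 * spectral_mass f + t.
  rewrite integD; [|exact: tameZ|exact: tameZ].
  by rewrite !integZ// integ_itv// subr0 mulr1.
rewrite -EI /T kern_pairingE//.
have -> : (fun l => bump l * (sin_coef f l * (1 - cos l) - cos_coef f l * sin l)) =
  fun l => (bump l * (1 - cos l)) * (\1_`]0, 1] l * sin_coef f l) -
           (bump l * sin l) * (\1_`]0, 1] l * cos_coef f l).
  apply/funext => l; rewrite /bump !indicE.
  have [l01|l01] := boolP (l \in `]0, 1]%classic); first by rewrite /=; ring.
  have [->|l0] := eqVneq l 0; first by rewrite /=; ring.
  have -> : (l \in `[0, 1]%classic) = false.
    apply/negbTE; move: l01; rewrite !notin_setE/= !in_itv/= => l01; apply: contra_not l01.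
    by rewrite lt_neqAle eq_sym l0.
  by rewrite /=; ring.
have tb1 : tame (fun l : R => bump l * (1 - cos l)).
  apply: (@tameMb _ _ _ 2); first exact: tame_bump.
    apply: continuous_measurable; exact: is_derive_continuous.
  by move=> x; rewrite (le_trans (ler_normB _ _))// normr1; have := cos_max x; lra.
have tb2 : tame (fun l : R => bump l * sin l).
  apply: (@tameMb _ _ _ 1); first exact: tame_bump.
    apply: continuous_measurable; exact: is_derive_continuous.
  by move=> x; exact: sin_max.
apply: le_integ.
- by apply: tameB; apply: tameM => //; [exact: tame_window_sin_coef|exact: tame_window_cos_coef].
- by apply: tameD; exact: tameZ.
move=> l; rewrite !indicE; have [l01|l01] := boolP (l \in `]0, 1]%classic); last first.
  by rewrite /= !mul0r !mulr0 subrr add0r.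
rewrite /= !mul1r mulr1.
move: l01; rewrite inE/= in_itv/= => /andP[l0 l1].
have b0 := bump_ge0 l; have bl := bump_le l.
rewrite indicE mem_set/= ?mul1r in bl; last by rewrite in_itv/= l1 ltW.
set a := cos_coef f l; set b := sin_coef f l.
move: (bump l) b0 bl => B b0 bl.
have h1 : B * (1 - cos l) * b <= l ^+ 2 * `|b|.
  rewrite (le_trans (ler_norm _))// !normrM (ger0_norm b0) ler_wpM2r// expr2.
  by apply: ler_pM => //; apply: abs_1Bcos_le; exact: ltW.
have h2 : - (B * sin l * a) <= l ^+ 2 * `|a|.
  rewrite (le_trans (ler_norm _))// normrN !normrM (ger0_norm b0) ler_wpM2r// expr2.
  by apply: ler_pM => //; apply: abs_sin_le; exact: ltW.
(* 2 x z <= x^2 / s + s z^2, here for z = 1 and x = l^2 |x| *)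
have key (x : R) : l ^+ 2 * `|x| <= (2 * t)^-1 * (l ^+ 4 * x ^+ 2) + t / 2.
  have -> : x ^+ 2 = `|x| ^+ 2 by rewrite real_normK// num_real.
  rewrite -subr_ge0.
  have -> : (2 * t)^-1 * (l ^+ 4 * `|x| ^+ 2) + t / 2 - l ^+ 2 * `|x| =
     (l ^+ 2 * `|x| - t) ^+ 2 / (2 * t) by field; rewrite gt_eqF.
  by apply: divr_ge0; [exact: sqr_ge0|lra].
have := key a; have := key b; lra.
Qed.

End profile.

(** * Concave profiles *)

Ltac positivity := lazymatch goal with
  | |- is_true (0 <= _%:R) => exact: ler0n
  | |- is_true (0 < _%:R) => by rewrite ltr0n
  | |- is_true (0 <= `|_|) => exact: normr_ge0
  | |- is_true (0 <= _ + _) => apply: addr_ge0; positivity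
  | |- is_true (0 < _ + _) => apply: addr_gt0; positivity
  | |- is_true (0 <= _ * _) => apply: mulr_ge0; positivity
  | |- is_true (0 < _ * _) => apply: mulr_gt0; positivity
  | |- is_true (0 <= _^-1) => rewrite invr_ge0; positivity
  | |- is_true (0 < _^-1) => rewrite invr_gt0; positivity
  | |- is_true (0 <= _ ^+ 2) => exact: sqr_ge0
  | |- is_true (0 <= _ ^+ _) => apply: exprn_ge0; positivity
  | |- is_true (0 < _ ^+ _) => apply: exprn_gt0; positivity
  | |- _ => first [assumption | apply: ltW; assumption | lra]
  end.

Section concave_profile.
Variable R : realType.
Implicit Types (f g : R -> R).

Definition concave_on f (B : R) : Prop := forall u v s : R,
  0 < u < B -> 0 < v < B -> 0 <= s <= 1 ->
  (1 - s) * f u + s * f v <= f ((1 - s) * u + s * v).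

(** What the lengths of the parallel chords of a convex body satisfy, with H a bound
for the lengths and B the width. *)
Definition profile f (H B : R) : Prop := [/\ tame f, forall y, 0 <= f y <= H,
  forall y, ~~ (0 < y < B) -> f y = 0 & concave_on f B].

(** The point u is a convex combination of v, with a coefficient as close to
u / v as desired, and of another point of ]0, B[ where f is nonnegative. *)
Lemma concave_left f B u v : concave_on f B -> (forall y, 0 <= f y) ->
  0 < u -> u <= v -> v < B -> u / v * f v <= f u.
Proof.
move=> cf f0 u0 uv vB; have v0 : 0 < v by exact: lt_le_trans uv.
move: uv; rewrite le_eqVlt => /predU1P[->|uv]; first by rewrite divff ?mul1r// gt_eqF.
rewrite leNgt; apply/negP => H.
have fv : 0 < f v.
  rewrite lt_neqAle f0 andbT; apply/eqP => fv; move: H; rewrite -fv mulr0.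
  by rewrite ltNge f0.
have r1 : f u / f v < u / v by rewrite ltr_pdivrMr.
have r0 : 0 <= f u / f v by rewrite divr_ge0// ltW.
have r2 : u / v < 1 by rewrite ltr_pdivrMr// mul1r.
(* any coefficient between f u / f v and u / v leads to f u > f u *)
pose s := (f u / f v + u / v) / 2.
have s1 : f u / f v < s by rewrite /s; lra.
have s2 : s < u / v by rewrite /s; lra.
have s3 : 0 < 1 - s by lra.
have sv : s * v < u by rewrite -ltr_pdivlMr.
pose w := (u - s * v) / (1 - s).
have w0 : 0 < w by apply: divr_gt0 => //; lra.
have wB : w < B.
  rewrite ltr_pdivrMr//; apply: (@le_lt_trans _ _ (v * (1 - s))); first by lra.
  by rewrite ltr_pM2r.
have := cf w v s; rewrite w0 wB v0 vB /= => /(_ isT isT).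
have -> : 0 <= s <= 1 by lra.
move=> /(_ isT); have -> : (1 - s) * w + s * v = u by rewrite /w; field; lra.
apply/negP; rewrite -ltNge; apply: (@lt_le_trans _ _ (s * f v)).
  by rewrite -ltr_pdivrMr.
by rewrite lerDr mulr_ge0// ltW.
Qed.

Lemma concave_right f B u v : concave_on f B -> (forall y, 0 <= f y) ->
  0 < v -> v <= u -> u < B -> (B - u) / (B - v) * f v <= f u.
Proof.
move=> cf f0 v0 vu uB.
have cg : concave_on (fun y => f (B - y)) B.
  move=> a b s a0 b0 s0; have -> : B - ((1 - s) * a + s * b) =
    (1 - s) * (B - a) + s * (B - b) by ring.
  by apply: cf => //; lra.
have := @concave_left _ _ (B - u) (B - v) cg (fun y => f0 _).
by rewrite !opprB !(addrC B) !subrK; apply; lra.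
Qed.

(** Since f vanishes on the negative axis, the integrand is f(y) J(y) >= 0 on
[0, 1]: the gain comes from [1/2, 1], and the losses occur after 1. *)
Lemma kern_pairing_ge f (H B a k : R) : profile f H B -> 0 < B -> 0 <= a -> 0 <= k ->
  (forall y, 2^-1 <= y <= 1 -> f 2^-1 / 2 <= f y) ->
  (forall y, 1 < y -> y <= B + 1 ->
     - (a / (1 + y ^+ 2) + k) <= (f y - f (y - 1)) * kern y) ->
  kern_lb R * f 2^-1 / 4 - 2 * a - k * (B + 1) <= kern_pairing f.
Proof.
move=> [tf f01 fout _] B0 a0 k0 fhalf Hy.
have B1 : 0 < B + 1 by lra.
have f0 y : 0 <= f y by case/andP: (f01 y).
pose m := kern_lb R * f 2^-1 / 2.
pose G y := m * \1_`[2^-1, 1] y -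
  (a * (\1_`[0, B + 1] y * (1 + y ^+ 2)^-1) + k * \1_`[0, B + 1] y).
have tI1 : tame (\1_`[2^-1, 1] : R -> R) by exact: tame_itv.
have tI2 : tame (\1_`[0, B + 1] : R -> R) by exact: tame_itv.
have tA : tame (fun y => \1_`[0, B + 1] y * (1 + y ^+ 2)^-1).
  exact/tame_cont_itv/continuous_atan_deriv.
have tG1 : tame (fun y => m * \1_`[2^-1, 1] y) by exact: tameZ.
have tG2 : tame (fun y => a * (\1_`[0, B + 1] y * (1 + y ^+ 2)^-1)) by exact: tameZ.
have tG3 : tame (fun y => k * \1_`[0, B + 1] y) by exact: tameZ.
have tG : tame G by apply: tameB => //; exact: tameD.
have EG : integ G = m / 2 -
   (a * integ (fun y => \1_`[0, B + 1] y * (1 + y ^+ 2)^-1) + k * (B + 1)).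
  rewrite /G integB//; last exact: tameD.
  rewrite integD// !integZ// !integ_itv//; [|lra|lra].
  by congr (_ - (_ + _)); [field|ring].
have IA := integ_atan_le B1.
apply: (@le_trans _ _ (integ G)).
  have : a * integ (fun y => \1_`[0, B + 1] y * (1 + y ^+ 2)^-1) <= a * 2.
    by rewrite ler_wpM2l.
  by rewrite EG /m; lra.
pose D y := f y - f (y - 1).
have tD : tame D by apply: tameB => //; exact: tame_shift.
have tDk : tame (fun y => D y * kern y).
  have -> : (fun y => D y * kern y) =
    fun y => integ (fun l => (D y * bump l) * sin (y * l)).
    apply/funext => y; rewrite -integZ; last exact: tame_bump_sin.
    by congr integ; apply/funext => l; rewrite mulrA [l * y]mulrC.
  apply: (@tame2_integ _ (fun z => (D z.1 * bump z.2) * sin (z.1 * z.2))).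
  apply: (@tame2Mb _ _ _ 1); first by apply: tame2_prod => //; exact: tame_bump.
    exact: measurable_sin_mul.
  by move=> x; exact: sin_max.
apply: le_integ => // y; rewrite /G /D.
have m0 : 0 <= m by have := kern_lb_gt0 R => kl0; have := f0 2^-1 => fh0; rewrite /m; positivity.
have p0 z : 0 <= z -> 0 <= k + a / (1 + z ^+ 2) :> R.
  by move=> z0; rewrite addr_ge0// divr_ge0// addr_ge0// exprn_ge0.
have inE1 : (y \in `[2^-1, 1]%classic) = (2^-1 <= y <= 1).
  by apply/idP/idP; rewrite inE/= in_itv.
have inE2 : (y \in `[0, B + 1]%classic) = (0 <= y <= B + 1).
  by apply/idP/idP; rewrite inE/= in_itv.
rewrite !indicE inE1 inE2.
have [y0|y0] := leP y 0.
  rewrite !fout; [|lra|lra].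
  rewrite subrr mul0r (_ : 2^-1 <= y <= 1 = false); last by lra.
  rewrite mulr0 sub0r oppr_le0; case: (0 <= y <= B + 1); rewrite /= ?mul1r ?mulr1.
    by have := @p0 `|y| (normr_ge0 y); rewrite real_normK ?num_real//; lra.
  by rewrite !mul0r !mulr0 addr0.
have [y1|y1] := leP y 1.
  rewrite [f (y - 1)]fout; last by lra.
  rewrite subr0 (_ : 0 <= y <= B + 1); last by lra.
  rewrite /= !mul1r mulr1; have := p0 y (ltW y0).
  have [yh1|yh1] := leP 2^-1 y.
    have yh : 2^-1 <= y <= 1 by rewrite yh1.
    have h1 := fhalf y yh; have h2 := kern_ge_lb yh; rewrite /= mulr1.
    have : f 2^-1 / 2 * kern_lb R <= f y * kern y.
      by apply: ler_pM => //; [rewrite divr_ge0|rewrite ltW// kern_lb_gt0].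
    rewrite /m; lra.
  rewrite /= mulr0 sub0r; have : 0 <= f y * kern y by rewrite mulr_ge0// kern_ge0.
  lra.
rewrite andbF /= mulr0 sub0r; have [yB|yB] := leP y (B + 1).
  have y0' : 0 <= y by lra.
  by rewrite y0' /= mul1r mulr1; apply: Hy.
rewrite andbF /= mul0r !mulr0 addr0 oppr0 !fout; first by rewrite subrr mul0r.
- by lra.
- by lra.
Qed.

Lemma kern_lb_le1 : kern_lb R <= 1.
Proof. by apply: le_trans (kern_le1 1); apply: kern_ge_lb; lra. Qed.

Lemma ler_mul_lb (D m k K : R) : - m <= D -> 0 <= k <= K -> 0 <= m ->
  - (m * K) <= D * k.
Proof.
move=> mD /andP[k0 kK] m0.
have : - m * k <= D * k by rewrite ler_wpM2r.
have : m * k <= m * K by rewrite ler_wpM2l.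
lra.
Qed.

Lemma profile_half f (H B : R) : profile f H B -> 2 <= B ->
  forall y, 2^-1 <= y <= 1 -> f 2^-1 / 2 <= f y.
Proof.
move=> [_ f01 _ cf] B2 y /andP[ya yb].
have f0 z : 0 <= f z by case/andP: (f01 z).
have yB : y < B by lra.
have h2 : 0 < 2^-1 :> R by lra.
apply: le_trans (concave_right cf f0 h2 ya yB).
by rewrite mulrC ler_wpM2r// ler_pdivlMr; lra.
Qed.

(** There is no loss where f increases, and the kernel is small beyond z. *)
Lemma kern_pairing_nondecreasing f (H B z : R) : profile f H B -> 2 <= B -> 0 < z ->
  (forall u v, 0 < u -> u < v -> v <= z -> f u <= f v) ->
  kern_lb R * f 2^-1 / 4 - 12 * H / z ^+ 3 * (B + 1) <= kern_pairing f.
Proof.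
move=> pf B2 z0 mono; have fhalf := profile_half pf B2.
have [tf f01 fout cf] := pf.
have H0 : 0 <= H by case/andP: (f01 0); exact: le_trans.
have k0 : 0 <= 12 * H / z ^+ 3 by positivity.
have B0 : 0 < B by lra.
have := kern_pairing_ge pf B0 (lexx 0) k0 fhalf; rewrite mulr0 subr0; apply.
move=> y ya yb; rewrite mul0r add0r.
have y0 : 0 < y by lra.
have [yz|yz] := leP y z.
  apply: (@le_trans _ _ 0); first by rewrite oppr_le0.
  by rewrite mulr_ge0 ?kern_ge0// subr_ge0; apply: mono => //; lra.
have -> : 12 * H / z ^+ 3 = H * (12 / z ^+ 3) by field; rewrite gt_eqF.
apply: ler_mul_lb => //.
- by have /andP[a _] := f01 y; have /andP[_ b] := f01 (y - 1); lra.
- rewrite kern_ge0//= (le_trans (kern_le3 y0))// ler_pM2l// lef_pV2 ?posrE ?exprn_gt0//.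
  by rewrite lerXn2r ?nnegrE// ltW.
Qed.

(** Concavity allows f to decrease by at most 2 H / B on an interval of length 1
of the first half of the support; on the second half J = O(B^-3). *)
Lemma kern_pairing_slope f (H B : R) : profile f H B -> 2 <= B ->
  kern_lb R * f 2^-1 / 4 - 288 * H / B <= kern_pairing f.
Proof.
move=> pf B2; have fhalf := profile_half pf B2.
have [tf f01 fout cf] := pf.
have f0 y : 0 <= f y by case/andP: (f01 y).
have fH y : f y <= H by case/andP: (f01 y).
have H0 : 0 <= H by exact: le_trans (fH 0).
have B0 : 0 < B by lra.
have Bn0 : B != 0 by rewrite gt_eqF.
have a0 : 0 <= 48 * H / B by positivity.
have k0 : 0 <= 96 * H / B ^+ 3 by positivity.
have := kern_pairing_ge pf B0 a0 k0 fhalf.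
set T := kern_pairing f; set m := kern_lb R * _ / 4 => HT.
apply: (@le_trans _ _ (m - 2 * (48 * H / B) - 96 * H / B ^+ 3 * (B + 1))).
  have : 96 * H / B ^+ 3 * (B + 1) <= 192 * H / B.
    have -> : 192 * H / B = 96 * H / B ^+ 3 * (2 * B ^+ 2) by field.
    rewrite ler_wpM2l//; have : B * 2 <= B ^+ 2 by rewrite expr2 ler_wpM2l//; lra.
    by lra.
  by lra.
apply: HT => y ya yb; have y0 : 0 < y by lra.
have a1 : 0 <= 48 * H / B / (1 + y ^+ 2).
  by apply: divr_ge0 => //; have := sqr_ge0 y; lra.
have [yh|yh] := leP y (B / 2).
  have slope : - (2 * H / B) <= f y - f (y - 1).
    have h1 : 0 < y - 1 by lra.
    have h2 : y - 1 <= y by lra.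
    have h3 : y < B by lra.
    have := concave_right cf f0 h1 h2 h3.
    have -> : (B - y) / (B - (y - 1)) = 1 - (B - (y - 1))^-1 by field; lra.
    have : (B - (y - 1))^-1 * f (y - 1) <= (B / 2)^-1 * H.
      by apply: ler_pM => //; rewrite ?invr_ge0 ?lef_pV2 ?posrE//; lra.
    have -> : (B / 2)^-1 * H = 2 * H / B by field.
    by lra.
  have m0 : 0 <= 2 * H / B by positivity.
  have kb : 0 <= kern y <= 24 / (1 + y ^+ 2) by rewrite kern_ge0// kern_le_atan.
  have := ler_mul_lb slope kb m0.
  have -> : 2 * H / B * (24 / (1 + y ^+ 2)) = 48 * H / B / (1 + y ^+ 2).
    by field; rewrite Bn0 gt_eqF//; have := sqr_ge0 y; lra.
  by lra.
have -> : 96 * H / B ^+ 3 = H * (12 / (B / 2) ^+ 3) by field.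
apply: (@le_trans _ _ (- (H * (12 / (B / 2) ^+ 3)))); first by lra.
apply: ler_mul_lb => //; first by have := f0 y; have := fH (y - 1); lra.
have B20 : 0 < B / 2 by lra.
rewrite kern_ge0//= (le_trans (kern_le3 y0))// ler_pM2l// lef_pV2 ?posrE ?exprn_gt0//.
by rewrite lerXn2r ?nnegrE// ltW.
Qed.

(** A concave function that is nonnegative on ]0, B[ lies above the segment from
(0, 0) to (v, f v), and above the one from (v, f v) to (B, 0). *)
Lemma profile_half_ge f (H B h0 v z : R) : profile f H B -> 2 <= B ->
  0 < v < B -> v <= z -> 1 <= z -> h0 <= f v -> h0 / (2 * z) <= f 2^-1.
Proof.
move=> [_ f01 _ cf] B2 /andP[v0 vB] vz z1 fv.
have f0 y : 0 <= f y by case/andP: (f01 y).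
have h2 : 0 < 2^-1 :> R by lra.
apply: (@le_trans _ _ (f v / (2 * z))).
  by rewrite ler_pM2r// invr_gt0; lra.
have [vh|vh] := leP 2^-1 v.
  apply: le_trans (concave_left cf f0 h2 vh vB).
  rewrite mulrC ler_wpM2r// -invfM lef_pV2 ?posrE; lra.
have hB : 2^-1 < B by lra.
apply: le_trans (concave_right cf f0 v0 (ltW vh) hB).
rewrite mulrC ler_wpM2r//.
apply: (@le_trans _ _ 2^-1); first by rewrite lef_pV2 ?posrE; lra.
by rewrite ler_pdivlMr; lra.
Qed.

Lemma concave_decreasing_after f (B u v y : R) : concave_on f B ->
  0 < u -> u < v -> v < y -> y < B -> f v < f u -> f y <= f v.
Proof.
move=> cf u0 uv vy yB fuv.
pose s := (v - u) / (y - u).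
have s0 : 0 < s by rewrite divr_gt0//; lra.
have s1 : s <= 1 by rewrite ler_pdivrMr; lra.
have uB : 0 < u < B by rewrite u0 (lt_trans uv)// (lt_trans vy).
have yB' : 0 < y < B by rewrite yB andbT (lt_trans u0)// (lt_trans uv).
have s01 : 0 <= s <= 1 by rewrite (ltW s0) s1.
have := cf u y s uB yB' s01.
have -> : (1 - s) * u + s * y = v by rewrite /s; field; lra.
move=> Hs; rewrite -(ler_pM2l s0).
have : (1 - s) * f v <= (1 - s) * f u by rewrite ler_wpM2l//; lra.
lra.
Qed.

Lemma sum4_le (a b c d x : R) : 0 < a -> 0 < b -> 0 < c -> 0 < d ->
  a + b + c + d <= x -> [/\ 0 < x, a <= x, b <= x, c <= x & d <= x].
Proof. by move=> *; split; lra. Qed.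

(** These are the error terms of [kern_pairing_slope] and
[kern_pairing_nondecreasing] against the lower bounds of f 2^-1 that are
available when these two lemmas are applied. A small e settles the first, then
a large r settles the second. *)
Lemma threshold_exists (H h0 w0 D kl : R) : 0 < h0 -> h0 <= H -> 0 < w0 -> 0 < D ->
  0 < kl -> kl <= 1 ->
  exists e r0 : R, [/\ 0 < e, e < w0, 0 < r0 & forall r B F : R, r0 <= r ->
    r * w0 < B -> B <= r * D ->
    [/\ 1 <= r * e, 1 <= r * D, 2 <= B,
     h0 / (2 * (r * D)) <= F -> 12 * H / (r * e) ^+ 3 * (B + 1) <= kl * F / 8
   & h0 / (2 * (r * e)) <= F -> 288 * H / B <= kl * F / 8]].
Proof.
move=> h00 h0H w00 D0 kl0 kl1; have H0 : 0 < H by exact: lt_le_trans h0H.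
(* 4608 = 288 . 16, so that 288 H 16 e = kl h0 w0 *)
exists (kl * h0 * w0 / (4608 * H)).
have e0 : 0 < kl * h0 * w0 / (4608 * H) by positivity.
have ew : kl * h0 * w0 / (4608 * H) < w0.
  rewrite ltr_pdivrMr; last by positivity.
  rewrite [ltRHS]mulrC ltr_pM2r//.
  apply: (@le_lt_trans _ _ (1 * H)); first by apply: ler_pM => //; exact: ltW.
  by rewrite ltr_pM2r//; lra.
have : 288 * H * 16 * (kl * h0 * w0 / (4608 * H)) = kl * h0 * w0.
  by field; rewrite gt_eqF.
move: (kl * h0 * w0 / (4608 * H)) e0 ew => e e0 ew eE.
pose r1 := 384 * H * D ^+ 2 / (e ^+ 3 * kl * h0).
have r10 : 0 < r1 by rewrite /r1; positivity.
have ie : 0 < e^-1 by rewrite invr_gt0.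
have iD : 0 < D^-1 by rewrite invr_gt0.
have iw : 0 < 2 / w0 by rewrite divr_gt0.
exists (e^-1 + D^-1 + 2 / w0 + r1); split=> //; first by positivity.
move=> r B F rr rB BrD.
have [r0 re' rD' rw' rr1] := sum4_le ie iD iw r10 rr.
have re : 1 <= r * e by rewrite -ler_pdivrMr// mul1r.
have rD : 1 <= r * D by rewrite -ler_pdivrMr// mul1r.
have rw : 2 <= r * w0 by rewrite -ler_pdivrMr.
have B2 : 2 <= B by rewrite (le_trans rw)// ltW.
have B0 : 0 < B by exact: lt_le_trans B2.
have re0 : 0 < r * e by exact: mulr_gt0.
split=> // hF.
  apply: (@le_trans _ _ (kl * (h0 / (2 * (r * D))) / 8)); last first.
    by rewrite ler_pM2r// ler_pM2l.
  apply: (@le_trans _ _ (12 * H / (r * e) ^+ 3 * (2 * (r * D)))).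
    rewrite ler_pM2l; last by positivity.
    by clear -rD BrD; lra.
  have -> : 12 * H / (r * e) ^+ 3 * (2 * (r * D)) =
      r1 * (kl * h0 / (16 * r ^+ 2 * D)).
    by rewrite /r1; field; rewrite !gt_eqF.
  have -> : kl * (h0 / (2 * (r * D))) / 8 = r * (kl * h0 / (16 * r ^+ 2 * D)).
    by field; rewrite !gt_eqF.
  by rewrite ler_pM2r//; positivity.
apply: (@le_trans _ _ (kl * (h0 / (2 * (r * e))) / 8)); last first.
  by rewrite ler_pM2r// ler_pM2l.
apply: (@le_trans _ _ (288 * H / (r * w0))).
  have rw0 : 0 < r * w0 by exact: mulr_gt0.
  rewrite ler_pM2l; last by positivity.
  by rewrite lef_pV2 ?posrE// ltW.
have -> : 288 * H / (r * w0) = 288 * H * 16 * e / (16 * e * (r * w0)).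
  by field; rewrite !gt_eqF.
rewrite eE le_eqVlt; apply/orP; left; apply/eqP.
by field; rewrite !gt_eqF.
Qed.

(** Either f increases up to r e, or by concavity it decreases from some point
v <= r e on. In the latter case f is already at least h0 at v, so that f 2^-1
is at least h0 / (2 r e), large enough to absorb the error of
[kern_pairing_slope] in spite of its order 1 / r. *)
Lemma kern_pairing_large (H h0 w0 D : R) : 0 < h0 -> h0 <= H -> 0 < w0 -> 0 < D ->
  exists2 r0 : R, 0 < r0 & forall (r B y0 : R) f, r0 <= r -> profile f H B ->
    B <= r * D -> 0 < y0 -> y0 + r * w0 < B ->
    (forall y, y0 <= y <= y0 + r * w0 -> h0 <= f y) ->
    kern_lb R / 8 * f 2^-1 <= kern_pairing f.
Proof.
move=> h00 h0H w00 D0.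
have [e [r0 [e0 ew r00 Hr]]] :=
  threshold_exists h00 h0H w00 D0 (kern_lb_gt0 R) kern_lb_le1.
exists r0 => // r B y0 f rr pf BrD y00 yB fh.
have rpos : 0 < r by exact: lt_le_trans rr.
have rwB : r * w0 < B by clear -y00 yB; lra.
have [re rD B2 H1 H2] := Hr _ _ (f 2^-1) rr rwB BrD.
have rew : r * e < r * w0 by rewrite ltr_pM2l.
have y10 : 0 < y0 + r * w0 by clear -y00 re rew; lra.
have fy1 : h0 <= f (y0 + r * w0).
  by apply: fh; rewrite lexx andbT lerDl mulr_ge0// ltW.
have [mono|] := pselect (forall u v, 0 < u -> u < v -> v <= r * e -> f u <= f v).
  have re0 : 0 < r * e by clear -re; lra.
  have := kern_pairing_nondecreasing pf B2 re0 mono.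
  have /H1 : h0 / (2 * (r * D)) <= f 2^-1.
    by apply: (profile_half_ge pf B2 _ _ rD fy1); rewrite ?y10//; clear -yB BrD; lra.
  move: (12 * _ / _ * _) => E; clear; lra.
move=> /existsNP[u /existsNP[v /not_implyP[u0 /not_implyP[uv /not_implyP[vre fuv]]]]].
have {}fuv : f v < f u by rewrite ltNge; apply/negP.
have vy1 : v < y0 + r * w0 by clear -vre rew y00; lra.
have fv : h0 <= f v.
  apply: (le_trans fy1); have [_ _ _ cf] := pf.
  exact: (concave_decreasing_after cf u0 uv).
have := kern_pairing_slope pf B2.
have /H2 : h0 / (2 * (r * e)) <= f 2^-1.
  apply: (profile_half_ge pf B2 _ vre re fv).
  by rewrite (lt_trans u0 uv) (lt_trans vy1 yB).
move: (288 * _ / _) => E; clear; lra.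
Qed.

End concave_profile.

(** * Fourier coefficients of dilated planar sets and lengths of sections *)

Section mass_bounds.
Variable R : realType.
Implicit Types (f g : R -> R).

Lemma spectral_mass_large (H h0 w0 D : R) : 0 < h0 -> h0 <= H -> 0 < w0 -> 0 < D ->
  exists r0 c : R, [/\ 0 < r0, 0 < c & forall (r B y0 : R) f, r0 <= r -> profile f H B ->
    B <= r * D -> 0 < y0 -> y0 + r * w0 < B ->
    (forall y, y0 <= y <= y0 + r * w0 -> h0 <= f y) ->
    c * f 2^-1 ^+ 2 <= spectral_mass f].
Proof.
move=> h00 h0H w00 D0; have [r0 r00 Hr] := kern_pairing_large h00 h0H w00 D0.
exists r0, ((kern_lb R / 8) ^+ 2 / 2); split=> //.
  by have := kern_lb_gt0 R => kl0; positivity.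
move=> r B y0 f rr pf BrD y00 yB fh; have Hf := Hr _ _ _ _ rr pf BrD y00 yB fh.
have [tf f01 _ _] := pf.
have F0 : 0 <= kern_lb R / 8 * f 2^-1.
  have /andP[f2 _] := f01 2^-1; have := kern_lb_gt0 R => kl0; positivity.
apply: le_trans (spectral_mass_ge tf (le_trans F0 Hf)).
rewrite mulrAC -exprMn ler_pM2r ?invr_gt0//.
by rewrite lerXn2r// nnegrE// (le_trans F0).
Qed.

(** For l <= 1 / (2 r D) all the cosines are at least 1/2 on the support, so the
cosine coefficient is at least half of the integral of f. This is far from
optimal for large r, but it is valid without a lower bound on r. *)
Lemma spectral_mass_small (H h0 w0 D r B y0 : R) f : 0 < h0 -> 0 < w0 -> 0 < D ->
  0 < r -> 1 <= r * D -> profile f H B -> B <= r * D -> 0 < y0 -> y0 + r * w0 < B ->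
  (forall y, y0 <= y <= y0 + r * w0 -> h0 <= f y) ->
  (4 * D) ^- 5 * (h0 * w0 / 2) ^+ 2 / r ^+ 3 <= spectral_mass f.
Proof.
move=> h00 w00 D0 r0 rD [tf f01 fout _] BrD y00 yB fh.
have f0 y : 0 <= f y by case/andP: (f01 y).
pose L := (2 * (r * D))^-1.
have L0 : 0 < L by rewrite invr_gt0; positivity.
have L1 : L <= 1 by rewrite invf_le1; lra.
have LB : L * B <= 2^-1.
  apply: (@le_trans _ _ (L * (r * D))); first by rewrite ler_pM2l.
  rewrite le_eqVlt; apply/orP; left; apply/eqP; rewrite /L; field.
  by rewrite !gt_eqF.
(* l ranges over [L / 2, L], where the cosine coefficient exceeds h0 r w0 / 2 *)
pose K := (L / 2) ^+ 4 * (h0 * (r * w0) / 2) ^+ 2.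
have rw0 : 0 < r * w0 by exact: mulr_gt0.
have K0 : 0 <= K by rewrite /K; positivity.
have tI : tame (\1_`[L / 2, L] : R -> R) by exact: tame_itv.
have -> : (4 * D) ^- 5 * (h0 * w0 / 2) ^+ 2 / r ^+ 3 =
    integ (fun l => K * \1_`[L / 2, L] l).
  rewrite integZ// integ_itv; last by clear -L0; lra.
  by rewrite /K /L; field; rewrite !gt_eqF.
apply: le_integ; [exact: tameZ|exact: tame_spectral|] => l.
rewrite [X in K * X]indicE.
have [l01|_] := boolP (l \in _); last first.
  rewrite mulr0; apply: mulr_ge0 => //; apply: mulr_ge0; first exact: exprn_even_ge0.
  by apply: addr_ge0; exact: sqr_ge0.
move: l01 => /set_mem/=; rewrite in_itv/= => /andP[l1 l2].
have l0 : 0 < l by clear -L0 l1; lra.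
rewrite indicE mem_set/= ?in_itv/= ?l0 ?(le_trans l2)// mul1r mulr1.
rewrite /K; apply: ler_pM; [positivity|positivity|..].
  by rewrite lerXn2r// nnegrE; clear -L0 l0; lra.
rewrite -[leLHS]addr0; apply: lerD; last exact: sqr_ge0.
suff : h0 * (r * w0) / 2 <= cos_coef f l.
  have c0 : 0 <= h0 * (r * w0) / 2 by positivity.
  by move=> Hc; rewrite lerXn2r// nnegrE// (le_trans c0).
have tJ : tame (\1_`[y0, y0 + r * w0] : R -> R) by exact: tame_itv.
have -> : h0 * (r * w0) / 2 = integ (fun y => h0 / 2 * \1_`[y0, y0 + r * w0] y).
  rewrite integZ// integ_itv; last by rewrite lerDl ltW.
  by rewrite addrAC subrr add0r; ring.
apply: le_integ; first exact: tameZ.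
  by have := tame_mul_cos l 0 tf; under eq_fun do rewrite addr0.
move=> y; have [yB'|yB'] := boolP (0 < y < B); last first.
  rewrite [f y]fout// mul0r indicE memNset ?mulr0//= in_itv/= => /andP[a b].
  move: yB'; rewrite (lt_le_trans y00 a) /=; apply/negP; rewrite negbK.
  exact: le_lt_trans yB.
move: yB' => /andP[ya yb].
have cy : 2^-1 <= cos (l * y).
  have ly0 : 0 <= l * y by rewrite mulr_ge0// ltW.
  have ly : l * y <= L * B by rewrite ler_pM// ltW.
  have := abs_1Bcos_le ly0; rewrite ler_norml => /andP[_ c1].
  by move: c1 ly LB; move: (cos (l * y)) (l * y) (L * B) => *; lra.
apply: (@le_trans _ _ (f y * 2^-1)); last by rewrite ler_wpM2l.
rewrite mulrAC ler_pM2r// indicE; have [yI|_] := boolP (y \in _).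
  by rewrite mulr1; apply: fh; move: yI => /set_mem/=; rewrite in_itv.
by rewrite mulr0.
Qed.

End mass_bounds.

Section planar.
Variable R : realType.
Implicit Types (x xi : R * R) (O : set (R * R)).

Definition dotp xi x : R := xi.1 * x.1 + xi.2 * x.2.

Definition dilate_ind O (l : R) x : R := \1_O (l^-1 * x.1, l^-1 * x.2).

Definition fourier_cos O xi (l : R) : R :=
  integ2 (fun x => dilate_ind O l x * cos (dotp xi x)).

Definition fourier_sin O xi (l : R) : R :=
  integ2 (fun x => dilate_ind O l x * sin (dotp xi x)).

Definition energy O xi (l : R) : R := fourier_cos O xi l ^+ 2 + fourier_sin O xi l ^+ 2.

(** A line x1 + s x2 = e u is parametrized by its second coordinate. The sign
e = 1 or - 1 decides from which side of the body the heights u are counted. *)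
Definition section_length O (e s u : R) : R := integ (fun v => \1_O (e * u - s * v, v)).

(** For heights counted from the support line u = a, with unit 1 / r; the choice
r = |xi.1| makes y the phase of the frequency xi at l = 1. *)
Definition section_profile O (e s a r : R) (y : R) : R :=
  section_length O e s (a + y / r).

Lemma tame2_shear (F : R * R -> R) (c d b : R) : c != 0 -> tame2 F ->
  tame2 (fun z => F (c * z.2 + d * z.1 + b, z.1)).
Proof.
move=> c0 [mF [M FM]]; split.
  apply: (measurableT_comp mF); apply: measurable_fun_pair => //=.
  apply: measurable_funD => //; apply: measurable_funD.
    by apply: (measurableT_comp (mulrl_measurable c)).
  by apply: (measurableT_comp (mulrl_measurable d)).
exists (Num.max M ((M + `|d| * M + `|b|) / `|c|)) => -[v y] /=.
have [F1 F2] := FM (c * y + d * v + b, v); split; first by rewrite le_max F1.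
rewrite !gt_max => H.
have [vM|vM] := ltP M `|v|; first by apply: F2; right.
case: H => /andP[Mv Hy]; first by move: Mv; rewrite ltNge vM.
apply: F2; left => /=; move: Hy; rewrite ltr_pdivrMr ?normr_gt0// => Hy.
have h1 : `|d * v| <= `|d| * M by rewrite normrM ler_wpM2l.
have h2 := lerB_normD (c * y) (d * v + b); have h3 := ler_normD (d * v) b.
rewrite -addrA; rewrite normrM (mulrC `|c|) in h2.
move: (`|y| * `|c|) (`|d * v|) (`|d| * M) (`|d * v + b|) (`|c * y + (d * v + b)|)
  (`|b|) Hy h1 h2 h3 => *; lra.
Qed.

Lemma measurable_dotp xi : measurable_fun setT (dotp xi).
Proof.
apply: measurable_funD.
  by apply: (measurableT_comp (mulrl_measurable xi.1)).
by apply: (measurableT_comp (mulrl_measurable xi.2)).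
Qed.

Lemma tame2_dilate O (l : R) : l != 0 -> tame2 (\1_O) -> tame2 (dilate_ind O l).
Proof.
move=> l0 tO; have li : l^-1 != 0 by rewrite invr_eq0.
have := tame2_affine 0 0 li li tO; rewrite /dilate_ind.
by under eq_fun do rewrite !addr0.
Qed.

Lemma tame2_dilate_trig O xi (l : R) (g : R -> R) : l != 0 -> tame2 (\1_O) ->
  continuous g -> (forall t, `|g t| <= 1) ->
  tame2 (fun x => dilate_ind O l x * g (dotp xi x)).
Proof.
move=> l0 tO cg g1; apply: (@tame2Mb _ _ _ 1) => //; first exact: tame2_dilate.
apply: (measurableT_comp (continuous_measurable cg)).
exact: measurable_dotp.
Qed.

Lemma tame_section_length O e s : e != 0 -> tame2 (\1_O) -> tame (section_length O e s).
Proof.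
move=> e0 tO; have := tame2_integ (tame2_swap (tame2_shear (- s) 0 e0 tO)).
rewrite /section_length; under eq_fun do under eq_fun do rewrite /= addr0 mulNr.
by [].
Qed.

Lemma tame_section_profile O e s a r : e != 0 -> r != 0 -> tame2 (\1_O) ->
  tame (section_profile O e s a r).
Proof.
move=> e0 r0 tO; have ri : r^-1 != 0 by rewrite invr_eq0.
have := tame_affine a ri (tame_section_length s e0 tO); rewrite /section_profile.
by under eq_fun do rewrite addrC mulrC.
Qed.

(** A shear maps the lines orthogonal to xi to the lines parallel to an axis. *)
Lemma integ2_dilate_trig O xi (l e a : R) (g : R -> R) :
  0 < l -> tame2 (\1_O) -> xi.1 != 0 -> e ^+ 2 = 1 ->
  continuous g -> (forall t, `|g t| <= 1) ->
  integ2 (fun x => dilate_ind O l x * g (dotp xi x)) =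
  l ^+ 2 / `|xi.1| * integ (fun y =>
     section_profile O e (xi.2 / xi.1) a `|xi.1| y *
     g (Num.sg xi.1 * e * (l * y + l * `|xi.1| * a))).
Proof.
move=> l0 tO x0 e1 cg g1; set r := `|xi.1|; set s := xi.2 / xi.1.
have r0 : 0 < r by rewrite normr_gt0.
have ln0 : l != 0 by rewrite gt_eqF.
have rn0 : r != 0 by rewrite gt_eqF.
have e0 : e != 0 by apply: contra_eq_neq e1 => ->; rewrite expr0n eq_sym oner_neq0.
have er0 : e / r != 0 by rewrite mulf_neq0// invr_eq0.
have ne : `|e| = 1.
  by apply/eqP; rewrite -(@eqrXn2 _ 2)// expr1n real_normK ?num_real// e1.
pose G x := dilate_ind O l x * g (dotp xi x).
have tG : tame2 G by exact: tame2_dilate_trig.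
pose F (z : R * R) := \1_O (e / r * z.2 + (- s) * z.1 + e * a, z.1) : R.
have tF : tame2 F by exact: tame2_shear.
pose t := Num.sg xi.1 * e.
have tF' : tame2 (fun z => F z * g (t * (l * z.2 + l * r * a))).
  apply: (@tame2Mb _ _ _ 1) => //.
  apply: (measurableT_comp (continuous_measurable cg)).
  apply: (measurableT_comp (mulrl_measurable t)).
  apply: measurable_funD => //.
  by apply: (measurableT_comp (mulrl_measurable l)).
rewrite (integ2_swap tG) /integ2 /=.
have tGs := tame2_integ (tame2_swap tG); rewrite /= in tGs.
rewrite (integ_affine 0 ln0 tGs) gtr0_norm//.
have -> : (fun v => integ (fun u => G (u, l * v + 0))) =
  fun v => l / r * integ (fun y => F (v, y) * g (t * (l * y + l * r * a))).
  apply/funext => v; rewrite addr0.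
  have c0 : l * e / r != 0 by rewrite !mulf_neq0// invr_eq0.
  rewrite (integ_affine (l * (e * a - s * v)) c0); last exact: tame2_section2.
  rewrite !normrM ne mulr1 gtr0_norm// gtr0_norm ?invr_gt0//; congr (_ * _).
  congr integ; apply/funext => y; rewrite /G /F /dilate_ind /dotp /=.
  congr (\1_O (_, _) * g _); first by field; rewrite ?ln0 ?rn0.
    by field; rewrite ?ln0 ?rn0.
  have E1 : xi.1 = Num.sg xi.1 * r by exact: numEsg.
  have E2 : xi.2 = s * xi.1 by rewrite /s mulfVK.
  transitivity (xi.1 * (l * e / r * y + l * e * a)); first by rewrite E2; ring.
  by rewrite {1}E1 /t; field; rewrite ?rn0.
have tI := tame2_integ tF'; rewrite /= in tI.
rewrite (integZ (l / r) tI).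
rewrite -/(integ2 (fun z => F z * g (t * (l * z.2 + l * r * a)))) integ2_swap//.
rewrite /integ2 mulrA; congr (_ * _); first by ring.
congr integ; apply/funext => y /=; set T := g _.
have -> : (fun v => F (v, y) * T) = (fun v => T * F (v, y)).
  by apply/funext => v; rewrite mulrC.
rewrite (integZ T (tame2_section2 y tF)) mulrC; congr (_ * _).
congr integ; apply/funext => v; rewrite /F /=.
by congr (\1_O (_, _)); field; rewrite ?rn0.
Qed.

(** The phase due to the base height a only rotates the pair formed by the cosine
and the sine coefficients. *)
Lemma energyE O xi (l e a : R) : 0 < l -> tame2 (\1_O) -> xi.1 != 0 -> e ^+ 2 = 1 ->
  let f := section_profile O e (xi.2 / xi.1) a `|xi.1| in
  energy O xi l = l ^+ 4 / xi.1 ^+ 2 * (cos_coef f l ^+ 2 + sin_coef f l ^+ 2).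
Proof.
move=> l0 tO x0 e1 f.
rewrite /energy /fourier_cos /fourier_sin.
rewrite (integ2_dilate_trig a l0 tO x0 e1 (@continuous_cos R) (@cos_max R)).
rewrite (integ2_dilate_trig a l0 tO x0 e1 (@continuous_sin R) (@sin_max R)).
rewrite -/f; set p := l * _ * a; set t := Num.sg _ * e.
have e0 : e != 0 by apply: contra_eq_neq e1 => ->; rewrite expr0n eq_sym oner_neq0.
have rn0 : `|xi.1| != 0 by rewrite normr_eq0.
have tf : tame f by exact: tame_section_profile.
have tc : tame (fun y => f y * cos (l * y)).
  by have := tame_mul_cos l 0 tf; under eq_fun do rewrite addr0.
have ts : tame (fun y => f y * sin (l * y)).
  by have := tame_mul_sin l 0 tf; under eq_fun do rewrite addr0.
have t2 : t ^+ 2 = 1.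
  by rewrite /t exprMn e1 mulr1 sqr_sg x0.
have -> : (fun y => f y * cos (t * (l * y + p))) =
   (fun y => cos p * (f y * cos (l * y)) - sin p * (f y * sin (l * y))).
  apply/funext => y.
  have /orP[/eqP ->|/eqP ->] : (t == 1) || (t == -1) by rewrite -eqf_sqr t2 expr1n.
    by rewrite mul1r cosD; ring.
  by rewrite mulN1r cosN cosD; ring.
have -> : (fun y => f y * sin (t * (l * y + p))) =
   (fun y => t * cos p * (f y * sin (l * y)) + t * sin p * (f y * cos (l * y))).
  apply/funext => y.
  have /orP[/eqP ->|/eqP ->] : (t == 1) || (t == -1) by rewrite -eqf_sqr t2 expr1n.
    by rewrite mul1r sinD; ring.
  by rewrite mulN1r sinN sinD; ring.
rewrite integB ?integZ//; [|exact: tameZ..].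
rewrite integD ?integZ//; [|exact: tameZ..].
rewrite -/(cos_coef f l) -/(sin_coef f l).
have -> : xi.1 ^+ 2 = `|xi.1| ^+ 2 by rewrite real_normK// num_real.
have := cos2Dsin2 p; move: (cos p) (sin p) => cp sp cs.
set A := cos_coef f l; set B := sin_coef f l.
have -> : (l ^+ 2 / `|xi.1| * (cp * A - sp * B)) ^+ 2 +
  (l ^+ 2 / `|xi.1| * (t * cp * B + t * sp * A)) ^+ 2 =
  l ^+ 4 / `|xi.1| ^+ 2 * ((cp * A - sp * B) ^+ 2 + t ^+ 2 * (cp * B + sp * A) ^+ 2).
  by field.
rewrite t2 mul1r.
have -> : (cp * A - sp * B) ^+ 2 + (cp * B + sp * A) ^+ 2 =
  (cp ^+ 2 + sp ^+ 2) * (A ^+ 2 + B ^+ 2) by ring.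
by rewrite cs mul1r.
Qed.

End planar.

(** * Sections of planar convex sets *)

Section planar_convex.
Variable R : realType.
Implicit Types (x y z : R * R) (O : set (R * R)).

Definition planar_open O : Prop := forall x, O x ->
  exists2 r : R, 0 < r & forall y, `|y.1 - x.1| < r -> `|y.2 - x.2| < r -> O y.

Definition planar_convex O : Prop := forall x y (t : R), O x -> O y -> 0 <= t <= 1 ->
  O ((1 - t) * x.1 + t * y.1, (1 - t) * x.2 + t * y.2).

Definition planar_bounded O (M : R) : Prop := forall x, O x -> `|x.1| <= M /\ `|x.2| <= M.

(** Only countably many boxes have rational vertices. *)
Lemma planar_open_measurable O : planar_open O -> measurable O.
Proof.
move=> oO.
pose box (q : (rat * rat) * (rat * rat)) : set (R * R) :=
  `]ratr q.1.1, ratr q.1.2[ `*` `]ratr q.2.1, ratr q.2.2[.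
have -> : O = \bigcup_q (if pselect (box q `<=` O) then box q else set0).
  apply/seteqP; split => [x Ox|x [q _ xq]]; last by move: xq; case: pselect => // h; exact: h.
  have [r r0 xO] := oO _ Ox.
  have l1 : x.1 - r < x.1 by rewrite ltrBlDr ltrDl.
  have l2 : x.1 < x.1 + r by rewrite ltrDl.
  have l3 : x.2 - r < x.2 by rewrite ltrBlDr ltrDl.
  have l4 : x.2 < x.2 + r by rewrite ltrDl.
  have [q1 /itvP h1] := rat_in_itvoo l1.
  have [q2 /itvP h2] := rat_in_itvoo l2.
  have [q3 /itvP h3] := rat_in_itvoo l3.
  have [q4 /itvP h4] := rat_in_itvoo l4.
  apply: (ex_intro2 _ _ ((q1, q2), (q3, q4))) => //=.
  case: pselect => [h|[]] /=; first by split; rewrite /= in_itv/= ?h1 ?h2 ?h3 ?h4.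
  case=> y1 y2 [/=]; rewrite !in_itv/= => /andP[a b] /andP[c d].
  apply: xO; rewrite /= ltr_norml ltrBlDl ltrBrDl.
    by rewrite (lt_trans _ a) ?h1// (lt_trans b) ?h2.
  by rewrite (lt_trans _ c) ?h3// (lt_trans d) ?h4.
apply: countable_bigcupT_measurable => // q.
case: pselect => h; last exact: measurable0.
by apply: measurableX; exact: measurable_itv.
Qed.

Lemma tame2_indic O M : measurable O -> planar_bounded O M -> tame2 (\1_O : R * R -> R).
Proof.
move=> mO bO; split; first exact: measurable_indic.
exists (Num.max 1 M) => x; split.
  by rewrite le_max indicE; case: (_ \in _); rewrite ?normr1 ?normr0 ?lexx ?ler01.
rewrite indicE; case: (boolP (x \in O)) => // /set_mem /bO[b1 b2].
by rewrite !gt_max ![M < _]ltNge b1 b2 !andbF => -[].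
Qed.

Definition line_convex (A : set R) : Prop := forall p q t : R, A p -> A q ->
  0 <= t <= 1 -> A ((1 - t) * p + t * q).

Lemma line_convex_itv (A : set R) (p q v : R) : line_convex A -> A p -> A q -> p <= v <= q -> A v.
Proof.
move=> cA Ap Aq /andP[]; rewrite le_eqVlt => /predU1P[<-//|pv].
rewrite le_eqVlt => /predU1P[->//|vq].
have pq : 0 < q - p by lra.
have -> : v = (1 - (v - p) / (q - p)) * p + (v - p) / (q - p) * q by field; lra.
apply: cA => //; rewrite divr_ge0 ?ler_pdivrMr//; lra.
Qed.

(** Chords need not contain their end points: any two of their points bound the
length from below. *)
Lemma length_ge (A : set R) (p q : R) : line_convex A -> tame (\1_A : R -> R) ->
  A p -> A q -> `|q - p| <= integ (\1_A).
Proof.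
move=> cA tA; wlog pq : p q / p <= q.
  move=> wl Ap Aq; have [pq|/ltW qp] := leP p q; first exact: wl.
  by rewrite distrC; exact: wl.
move=> Ap Aq; rewrite ger0_norm ?subr_ge0//.
rewrite -(integ_itv true false pq); apply: le_integ => // [|v]; first exact: tame_itv.
rewrite indicE; have [vI|_] := boolP (v \in _) => //.
rewrite indicE mem_set//; move: vI => /set_mem /=; rewrite in_itv/=.
exact: line_convex_itv.
Qed.

Lemma length_approx (A : set R) (e : R) : tame (\1_A : R -> R) ->
  has_sup A -> has_inf A -> 0 < e ->
  exists p q, [/\ A p, A q & integ (\1_A) <= q - p + e].
Proof.
move=> tA sA iA e0; have e20 : 0 < e / 2 by lra.
have [q Aq qs] := sup_adherent e20 sA.
have [p Ap pi_] := inf_adherent e20 iA.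
have is_ : inf A <= sup A.
  by apply: (@le_trans _ _ q); [apply: ge_inf; case: iA|apply: ub_le_sup; case: sA].
exists p, q; split=> //; apply: (@le_trans _ _ (sup A - inf A)); last by lra.
rewrite -(integ_itv true false is_); apply: le_integ => // [|v]; first exact: tame_itv.
rewrite indicE; have [vA|_] := boolP (v \in _) => //.
rewrite indicE mem_set//= in_itv/=; move: vA => /set_mem Av.
by apply/andP; split; [apply: ge_inf; case: iA|apply: ub_le_sup; case: sA].
Qed.

Section sections.
Variables (O : set (R * R)) (M e s : R).
Hypotheses (oO : planar_open O) (cO : planar_convex O) (bO : planar_bounded O M).
Hypotheses (e1 : e ^+ 2 = 1).

Let tO : tame2 (\1_O : R * R -> R).
Proof. exact: tame2_indic (planar_open_measurable oO) bO. Qed.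

Definition height (z : R * R) : R := e * (z.1 + s * z.2).
Definition heights : set R := height @` O.
Definition support : R := inf heights.
Definition width : R := sup heights - inf heights.
Definition slice (u : R) : set R := [set v | O (e * u - s * v, v)].

Lemma norm_sign : `|e| = 1.
Proof. by apply/eqP; rewrite -(@eqrXn2 _ 2)// expr1n real_normK ?num_real// e1. Qed.

Lemma sign_neq0 : e != 0.
Proof. by rewrite -normr_gt0 norm_sign. Qed.

Lemma sliceP u v : slice u v <-> exists2 z, O z & height z = u /\ z.2 = v.
Proof.
split=> [Ouv|[[z1 z2] Oz [<- <-]]].
  exists (e * u - s * v, v) => //; split=> //.
  by rewrite /height /= subrK mulrA -expr2 e1 mul1r.
by rewrite /slice /height /= mulrA -expr2 e1 mul1r addrK.
Qed.

Lemma height_bound z : O z -> `|height z| <= (1 + `|s|) * M.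
Proof.
move=> /bO[z1 z2]; rewrite /height normrM norm_sign mul1r (le_trans (ler_normD _ _))//.
by rewrite normrM mulrDl mul1r lerD// ler_wpM2l.
Qed.

Lemma slice_convex u : line_convex (slice u).
Proof.
move=> p q t Op Oq t01; have := cO Op Oq t01; rewrite /slice /=.
by congr (O (_, _)); ring.
Qed.

Lemma slice_tame u : tame (\1_(slice u) : R -> R).
Proof.
have e0 := sign_neq0.
have := tame2_section1 u (tame2_swap (tame2_shear (- s) 0 e0 tO)).
by under eq_fun do rewrite /= addr0 mulNr.
Qed.

Lemma section_lengthE u : section_length O e s u = integ (\1_(slice u) : R -> R).
Proof. by []. Qed.

Lemma slice_mix u0 u1 v0 v1 t : slice u0 v0 -> slice u1 v1 -> 0 <= t <= 1 ->
  slice ((1 - t) * u0 + t * u1) ((1 - t) * v0 + t * v1).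
Proof.
move=> O0 O1 t01; have := cO O0 O1 t01; rewrite /slice /=.
by congr (O (_, _)); ring.
Qed.

Lemma slice_has_bounds u : slice u !=set0 -> has_sup (slice u) /\ has_inf (slice u).
Proof.
move=> nS; split; split=> //.
  by exists M => v /bO[_] /=; rewrite ler_norml => /andP[].
by exists (- M) => v /bO[_] /=; rewrite ler_norml => /andP[].
Qed.

(** Two chords span a trapezoid contained in the body, whose intermediate section
has the interpolated length (the planar case of Brunn and Minkowski). *)
Lemma section_length_concave u0 u1 t : slice u0 !=set0 -> slice u1 !=set0 ->
  0 <= t <= 1 -> (1 - t) * section_length O e s u0 + t * section_length O e s u1 <=
    section_length O e s ((1 - t) * u0 + t * u1).
Proof.
move=> /slice_has_bounds[s0 i0] /slice_has_bounds[s1 i1] t01.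
apply/ler_addgt0Pr => d d0.
have [p0 [q0 [Op0 Oq0 H0]]] := length_approx (slice_tame u0) s0 i0 d0.
have [p1 [q1 [Op1 Oq1 H1]]] := length_approx (slice_tame u1) s1 i1 d0.
have := length_ge (@slice_convex _) (slice_tame _)
  (slice_mix Op0 Op1 t01) (slice_mix Oq0 Oq1 t01).
move: H0 H1; rewrite -!section_lengthE.
move: (section_length _ _ _ _) (section_length _ _ _ u1) (section_length _ _ _ u0).
move=> C B A HA HB; have /andP[t0 t1] := t01.
have {}HA : (1 - t) * A <= (1 - t) * (q0 - p0 + d) by rewrite ler_wpM2l//; lra.
have {}HB : t * B <= t * (q1 - p1 + d) by rewrite ler_wpM2l.
have := ler_norm ((1 - t) * q0 + t * q1 - ((1 - t) * p0 + t * p1)).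
move: (`|_|) => Z; lra.
Qed.

Lemma section_length_bound u : 0 <= M -> 0 <= section_length O e s u <= 2 * M.
Proof.
move=> M0; have L0 : 0 <= section_length O e s u by apply: integ_ge0.
rewrite L0 /= (_ : 2 * M = M - - M); last by ring.
have MM : - M <= M by lra.
rewrite section_lengthE -(integ_itv true false MM).
apply: le_integ => [||v]; [exact: slice_tame|exact: tame_itv|].
rewrite indicE; have [vS|_] := boolP (v \in _) => //.
rewrite indicE mem_set//= in_itv/= -ler_norml.
by move: vS => /set_mem /bO[].
Qed.

Lemma heightsP u : heights u <-> slice u !=set0.
Proof.
split=> [[z Oz <-]|[v /sliceP[z Oz [<- _]]]]; last by exists z.
by exists z.2; apply/sliceP; exists z.
Qed.

Lemma heights_convex : line_convex heights.
Proof.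
move=> p q t /heightsP[v0 S0] /heightsP[v1 S1] t01; apply/heightsP.
by exists ((1 - t) * v0 + t * v1); exact: slice_mix.
Qed.

Section nonempty.
Hypothesis nO : O !=set0.

Lemma bound_ge0 : 0 <= M.
Proof.
by case: nO => z /bO[z1 _]; exact: le_trans z1.
Qed.

Lemma heights_has_sup : has_sup heights.
Proof.
split; first by case: nO => z Oz; exists (height z), z.
exists ((1 + `|s|) * M) => _ [z Oz <-].
by rewrite (le_trans (ler_norm _))// height_bound.
Qed.

Lemma heights_has_inf : has_inf heights.
Proof.
split; first by case: nO => z Oz; exists (height z), z.
exists (- ((1 + `|s|) * M)) => _ [z Oz <-].
by have := height_bound Oz; rewrite ler_norml => /andP[].
Qed.

Lemma height_gt_support z : O z -> support < height z.
Proof.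
move=> Oz; have [r r0 zO] := oO Oz.
have O' : O (z.1 - e * (r / 2), z.2).
  apply: zO => /=; last by rewrite subrr normr0.
  rewrite addrAC subrr add0r normrN normrM norm_sign mul1r gtr0_norm; lra.
have : support <= height (z.1 - e * (r / 2), z.2).
  by apply: ge_inf; [case: heights_has_inf|exists (z.1 - e * (r / 2), z.2)].
have -> : height (z.1 - e * (r / 2), z.2) = height z - e ^+ 2 * (r / 2).
  by rewrite /height /=; ring.
by rewrite e1; lra.
Qed.

Lemma height_lt_support z : O z -> height z < support + width.
Proof.
move=> Oz; have [r r0 zO] := oO Oz.
have O' : O (z.1 + e * (r / 2), z.2).
  apply: zO => /=; last by rewrite subrr normr0.
  rewrite addrAC subrr add0r normrM norm_sign mul1r gtr0_norm; lra.
have : height (z.1 + e * (r / 2), z.2) <= sup heights.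
  by apply: ub_le_sup; [case: heights_has_sup|exists (z.1 + e * (r / 2), z.2)].
have -> : height (z.1 + e * (r / 2), z.2) = height z + e ^+ 2 * (r / 2).
  by rewrite /height /=; ring.
by rewrite e1 /support /width; lra.
Qed.

Lemma width_le : width <= 2 * (1 + `|s|) * M.
Proof.
have h1 : sup heights <= (1 + `|s|) * M.
  apply: ge_sup; first by case: heights_has_sup.
  by move=> _ [z Oz <-]; rewrite (le_trans (ler_norm _))// height_bound.
have h2 : - ((1 + `|s|) * M) <= inf heights.
  apply: lb_le_inf; first by case: heights_has_inf.
  by move=> _ [z Oz <-]; have := height_bound Oz; rewrite ler_norml => /andP[].
by rewrite /width; lra.
Qed.

Lemma slice_nonempty u : support < u < support + width -> slice u !=set0.
Proof.
move=> /andP[u0 u1]; apply/heightsP.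
have d0 : 0 < u - support by lra.
have d1 : 0 < support + width - u by lra.
have [p hp pu] := inf_adherent d0 heights_has_inf.
have [q hq qu] := sup_adherent d1 heights_has_sup.
apply: (line_convex_itv heights_convex hp hq).
by move: pu qu; rewrite /support /width; lra.
Qed.

Lemma slice_empty u : ~~ (support < u < support + width) -> section_length O e s u = 0.
Proof.
move=> ou; rewrite section_lengthE (_ : \1_(slice u) = fun=> 0) ?integ0//.
apply/funext => v; rewrite indicE memNset// => /sliceP[z Oz [zu _]].
by move: ou; rewrite -zu height_gt_support// height_lt_support.
Qed.

Lemma section_profileP r : 0 < r ->
  profile (section_profile O e s support r) (2 * M) (r * width).
Proof.
move=> r0; have rn0 : r != 0 by rewrite gt_eqF.
have inside (y : R) : (0 < y < r * width) = (support < support + y / r < support + width).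
  by rewrite ltrDl pmulr_lgt0 ?invr_gt0// ltrD2l ltr_pdivrMr// [width * r]mulrC.
split.
- exact: (tame_section_profile _ _ sign_neq0).
- by move=> y; apply: section_length_bound; exact: bound_ge0.
- by move=> y; rewrite inside; exact: slice_empty.
- move=> u v t; rewrite !inside => /slice_nonempty nu /slice_nonempty nv t01.
  rewrite /section_profile.
  have -> : support + ((1 - t) * u + t * v) / r =
     (1 - t) * (support + u / r) + t * (support + v / r) by field.
  exact: section_length_concave.
Qed.

(** A line that passes close enough to the centre of a box contained in O meets it
along a segment of controlled length. *)
Lemma section_length_ge_box (p : R * R) (d S : R) : 0 < d -> `|s| <= S ->
  (forall y, `|y.1 - p.1| < d -> `|y.2 - p.2| < d -> O y) ->
  forall u, `|u - height p| <= d / (2 * (1 + S)) ->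
  d / (1 + S) <= section_length O e s u /\ support < u < support + width.
Proof.
move=> d0 sS pO u up; have S0 : 0 <= S by exact: le_trans sS.
set d' := d / (2 * (1 + S)) in up *.
have d'0 : 0 < d' by rewrite divr_gt0// mulr_gt0//; lra.
have d'd : d' * (1 + S) < d.
  by rewrite /d' -mulrA invfM -[X in _ * X]mulrA mulVf ?mulr1 ?ltr_pdivrMr//; lra.
have inS v : `|v - p.2| <= d' -> slice u v.
  move=> vp; apply: pO => /=; last first.
    by apply: (le_lt_trans vp); apply: le_lt_trans d'd; rewrite ler_peMr//; lra.
  have -> : e * u - s * v - p.1 = e * (u - height p) - s * (v - p.2).
    have -> : e * (u - height p) = e * u - e ^+ 2 * (p.1 + s * p.2).
      by rewrite /height; ring.
    by rewrite e1; ring.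
  apply: le_lt_trans d'd; rewrite (le_trans (ler_normB _ _))// !normrM norm_sign mul1r.
  by rewrite mulrDr mulr1 lerD// mulrC ler_pM.
have h1 : slice u (p.2 - d').
  by apply: inS; rewrite addrAC subrr add0r normrN gtr0_norm.
have h2 : slice u (p.2 + d').
  by apply: inS; rewrite addrAC subrr add0r gtr0_norm.
split.
  have := length_ge (@slice_convex u) (slice_tame u) h1 h2.
  have -> : p.2 + d' - (p.2 - d') = d / (1 + S) by rewrite /d'; field; lra.
  by rewrite ger0_norm// divr_ge0//; lra.
have /sliceP[z Oz [<- _]] := h1.
by rewrite height_gt_support// height_lt_support.
Qed.

End nonempty.
End sections.
End planar_convex.

(** * Lower bounds for the weights *)

Section weights.
Variable R : realType.
Implicit Types (xi : R * R).

Definition weight (O : set (R * R)) xi : R :=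
  integ (fun l => \1_`]0, 1] l * energy O xi l).

Section weight_energy.
Variables (O : set (R * R)) (xi : R * R) (e a : R).
Hypotheses (tO : tame2 (\1_O : R * R -> R)) (x0 : xi.1 != 0) (e1 : e ^+ 2 = 1).
Let f := section_profile O e (xi.2 / xi.1) a `|xi.1|.

Lemma window_energyE : (fun l => \1_`]0, 1] l * energy O xi l) =
  fun l => (xi.1 ^+ 2)^-1 *
    (\1_`]0, 1] l * (l ^+ 4 * (cos_coef f l ^+ 2 + sin_coef f l ^+ 2))).
Proof.
apply/funext => l; rewrite indicE.
have [/set_mem/=|_] := boolP (l \in _); last by rewrite !mul0r mulr0.
rewrite in_itv/= => /andP[l0 _]; rewrite (energyE a l0 tO x0 e1) -/f.
by rewrite !mul1r; ring.
Qed.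

Let tf : tame f.
Proof.
apply: tame_section_profile => //; last by rewrite normr_eq0.
by apply: contra_eq_neq e1 => ->; rewrite expr0n eq_sym oner_neq0.
Qed.

Lemma tame_window_energy : tame (fun l => \1_`]0, 1] l * energy O xi l).
Proof. by rewrite window_energyE; apply: tameZ; exact: tame_spectral. Qed.

Lemma weightE : weight O xi = (xi.1 ^+ 2)^-1 * spectral_mass f.
Proof. by rewrite /weight window_energyE integZ//; exact: tame_spectral. Qed.

End weight_energy.

Section lower.
Variables (O : set (R * R)) (M S : R).
Hypotheses (oO : planar_open O) (cO : planar_convex O) (bO : planar_bounded O M).
Hypotheses (nO : O !=set0) (S0 : 0 <= S).

(** The common part of the two bounds that follow. The chord L is at depth 1/2 in
the unit 1 / |xi.1|; the bound in its square comes from [spectral_mass_large],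
and the crude last one from [spectral_mass_small] replaces it for small xi. *)
Lemma weight_bounds : exists c K h : R, [/\ 0 < c, 1 <= K, 0 < h &
  forall xi e, e ^+ 2 = 1 -> 1 <= `|xi.1| -> `|xi.2| <= S * `|xi.1| ->
  let L := section_length O e (xi.2 / xi.1)
             (support O e (xi.2 / xi.1) + 2^-1 / `|xi.1|) in
  [/\ K <= `|xi.1| -> c * L ^+ 2 / `|xi.1| ^+ 2 <= weight O xi,
      K <= `|xi.1| -> h / `|xi.1| <= L &
      c / `|xi.1| ^+ 5 <= weight O xi]].
Proof.
have M0 := bound_ge0 bO nO.
case: (nO) => p Op; have [d d0 pO] := oO Op.
have S10 : 0 < 1 + S by rewrite ltr_pwDl.
pose h0 := d / (1 + S); have h00 : 0 < h0 by rewrite divr_gt0.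
pose D := 2 * (1 + S) * M + 1.
have D1 : 1 <= D by rewrite /D lerDr; positivity.
have D0 : 0 < D by lra.
have profile_facts xi e : e ^+ 2 = 1 -> 1 <= `|xi.1| -> `|xi.2| <= S * `|xi.1| ->
    let s := xi.2 / xi.1 in let r := `|xi.1| in
    let f := section_profile O e s (support O e s) r in
    exists B y0, [/\ profile f (2 * M) B, B <= r * D, 0 < y0, y0 + r * h0 < B &
      forall y, y0 <= y <= y0 + r * h0 -> h0 <= f y].
  move=> e1 x1 xS s r f.
  have r0 : 0 < r by apply: lt_le_trans x1.
  have rn0 : r != 0 by rewrite gt_eqF.
  have sS : `|s| <= S by rewrite normrM normfV ler_pdivrMr.
  have box := section_length_ge_box oO cO bO e1 nO d0 sS pO.
  have h0E : d / (2 * (1 + S)) = h0 / 2 by rewrite /h0; field; rewrite gt_eqF.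
  rewrite h0E -/h0 in box.
  pose a := support O e s.
  have [_ /andP[lo _]] := box (height e s p - h0 / 2)
    (ltac:(rewrite addrAC subrr add0r normrN gtr0_norm; lra)).
  have [_ /andP[_ hi]] := box (height e s p + h0 / 2)
    (ltac:(rewrite addrAC subrr add0r gtr0_norm; lra)).
  exists (r * width O e s), (r * (height e s p - h0 / 2 - a)); split.
  - exact: (section_profileP s oO cO bO e1 nO r0).
  - rewrite ler_pM2l// /D.
    have := width_le s bO e1 nO; have : `|s| * M <= S * M by rewrite ler_wpM2r.
    have -> : 2 * (1 + `|s|) * M = 2 * M + 2 * (`|s| * M) by ring.
    have -> : 2 * (1 + S) * M = 2 * M + 2 * (S * M) by ring.
    by move: (width _ _ _) (`|s| * M) (S * M) => w t t' *; lra.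
  - by rewrite mulr_gt0// subr_gt0.
  - by rewrite -mulrDr ltr_pM2l//; rewrite /a; lra.
  - move=> y /andP[y1 y2]; apply: (box _ _).1.
    have {}y1 : height e s p - h0 / 2 - a <= y / r by rewrite ler_pdivlMr// mulrC.
    have {}y2 : y / r <= height e s p + h0 / 2 - a.
      by rewrite ler_pdivrMr// mulrC; apply: (le_trans y2); rewrite -mulrDr ler_pM2l//; lra.
    by rewrite -/a ler_norml; lra.
have h0H : h0 <= 2 * M.
  have e1 : 1 ^+ 2 = 1 :> R by rewrite expr1n.
  have [||B [y0 [[_ f01 _ _] _ _ _ fh]]] := @profile_facts (1, 0) 1 e1.
  - by rewrite /= normr1.
  - by rewrite /= normr0 normr1 mulr1.
  have /andP[_] := f01 y0; apply: le_trans; apply: fh.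
  by rewrite lexx lerDl mulr_ge0// ltW.
have [r0 [c [r00 c0 Hlarge]]] := spectral_mass_large h00 h0H h00 D0.
pose c' := (4 * D) ^- 5 * (h0 * h0 / 2) ^+ 2.
have c'0 : 0 < c' by rewrite /c'; positivity.
exists (Num.min c c'), (1 + r0 + 2 / h0), (h0 / (2 * D)).
have h20 : 0 < 2 / h0 by rewrite divr_gt0.
split; [by rewrite lt_min c0|by lra|by rewrite divr_gt0//; lra|].
move=> xi e e1 x1 xS L.
have x0 : xi.1 != 0 by rewrite -normr_gt0; lra.
have n0 : 0 < `|xi.1| by rewrite normr_gt0.
have mO := planar_open_measurable oO; have tO := tame2_indic mO bO.
have [B [y0 [pf BD y00 yB fh]]] := profile_facts xi e e1 x1 xS.
rewrite (weightE (support O e (xi.2 / xi.1)) tO x0 e1).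
have -> : xi.1 ^+ 2 = `|xi.1| ^+ 2 by rewrite real_normK// num_real.
set f := section_profile _ _ _ _ _ in pf fh *.
rewrite -/(f 2^-1) in L *; have LE : L = f 2^-1 by [].
split=> [Kx|Kx|].
- rewrite mulrC ler_pM2l ?invr_gt0 ?exprn_gt0//.
  apply: (@le_trans _ _ (c * L ^+ 2)).
    by rewrite ler_wpM2r ?sqr_ge0// ge_min lexx.
  by rewrite LE; apply: (Hlarge _ _ _ _ _ pf BD y00 yB fh); lra.
- have r2 : 2 <= `|xi.1| * h0 by rewrite -ler_pdivrMr//; lra.
  have B2 : 2 <= B by move: (`|xi.1| * h0) r2 yB => *; lra.
  have y1B : 0 < y0 + `|xi.1| * h0 < B.
    by rewrite yB andbT; move: (`|xi.1| * h0) r2 => *; lra.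
  have rD : 1 <= `|xi.1| * D by rewrite mulr_ege1.
  rewrite LE; have -> : h0 / (2 * D) / `|xi.1| = h0 / (2 * (`|xi.1| * D)).
    by field; rewrite !gt_eqF.
  apply: (profile_half_ge pf B2 y1B _ rD); last first.
    by apply: fh; rewrite lexx lerDl mulr_ge0// ltW.
  by apply: le_trans BD; exact: ltW.
- have rD : 1 <= `|xi.1| * D by rewrite mulr_ege1.
  have := spectral_mass_small h00 h00 D0 n0 rD pf BD y00 yB fh; rewrite -/c' => Hs.
  apply: (@le_trans _ _ ((`|xi.1| ^+ 2)^-1 * (c' / `|xi.1| ^+ 3))); last first.
    by rewrite ler_pM2l// invr_gt0 exprn_gt0.
  have -> : (`|xi.1| ^+ 2)^-1 * (c' / `|xi.1| ^+ 3) = c' / `|xi.1| ^+ 5.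
    by field; rewrite gt_eqF.
  by rewrite ler_pM2r ?invr_gt0 ?exprn_gt0// ge_min lexx orbT.
Qed.

(** Convexity makes L at least a multiple of 1 / |xi.1|. *)
Lemma weight_generic_lower : exists2 c : R, 0 < c &
  forall xi, 1 <= `|xi.1| -> `|xi.2| <= S * `|xi.1| -> c / `|xi.1| ^+ 4 <= weight O xi.
Proof.
have [c [K [h [c0 K1 h0 Hw]]]] := weight_bounds.
have K0 : 0 < K by lra.
exists (Num.min (c * h ^+ 2) (c / K)).
  by rewrite lt_min mulr_gt0 ?exprn_gt0//= divr_gt0.
move=> xi x1 xS; have [H1 H2 H3] := Hw xi 1 (expr1n _ _) x1 xS.
have n0 : 0 < `|xi.1| by apply: lt_le_trans x1.
have [Kx|xK] := leP K `|xi.1|.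
  apply: le_trans (H1 Kx).
  apply: (@le_trans _ _ (c * (h / `|xi.1|) ^+ 2 / `|xi.1| ^+ 2)).
    have -> : c * (h / `|xi.1|) ^+ 2 / `|xi.1| ^+ 2 = c * h ^+ 2 / `|xi.1| ^+ 4.
      by field; rewrite gt_eqF.
    by rewrite ler_pM2r ?invr_gt0 ?exprn_gt0// ge_min lexx.
  rewrite ler_pM2r ?invr_gt0 ?exprn_gt0// ler_pM2l//.
  have hx : 0 <= h / `|xi.1| by rewrite divr_ge0// ltW.
  by rewrite lerXn2r ?nnegrE// ?(le_trans hx)// H2.
apply: le_trans H3.
apply: (@le_trans _ _ (c / K / `|xi.1| ^+ 4)).
  by rewrite ler_pM2r ?invr_gt0 ?exprn_gt0// ge_min lexx orbT.
have -> : c / K / `|xi.1| ^+ 4 = c / `|xi.1| ^+ 5 * (`|xi.1| / K).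
  by field; rewrite !gt_eqF.
by rewrite ler_piMr ?ler_pdivrMr ?mul1r ?ltW// divr_gt0// exprn_gt0.
Qed.

(** Here L^2 is at least a multiple of 1 / |xi.1|, one order better than in the
generic case. *)
Lemma weight_cap_lower (k t0 : R) : 0 < k -> 0 < t0 -> exists2 c : R, 0 < c &
  forall xi e, e ^+ 2 = 1 -> 1 <= `|xi.1| -> `|xi.2| <= S * `|xi.1| ->
  (forall t, 0 < t <= t0 ->
     k * t <= section_length O e (xi.2 / xi.1) (support O e (xi.2 / xi.1) + t) ^+ 2) ->
  c / `|xi.1| ^+ 3 <= weight O xi.
Proof.
move=> k0 t00; have [c [K' [h [c0 K1 h0 Hw]]]] := weight_bounds.
pose K := K' + t0^-1; have it0 : 0 < t0^-1 by rewrite invr_gt0.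
have K0 : 0 < K by rewrite /K; lra.
exists (Num.min (c * k / 2) (c / K ^+ 2)).
  by rewrite lt_min !divr_gt0 ?mulr_gt0 ?exprn_gt0.
move=> xi e e1 x1 xS cap; have [H1 _ H3] := Hw xi e e1 x1 xS.
have n0 : 0 < `|xi.1| by apply: lt_le_trans x1.
have [Kx|xK] := leP K `|xi.1|.
  have KK : K' <= `|xi.1| by move: Kx; rewrite /K; lra.
  apply: le_trans (H1 KK).
  apply: (@le_trans _ _ (c * (k * (2^-1 / `|xi.1|)) / `|xi.1| ^+ 2)).
    have -> : c * (k * (2^-1 / `|xi.1|)) / `|xi.1| ^+ 2 = c * k / 2 / `|xi.1| ^+ 3.
      by field; rewrite gt_eqF.
    by rewrite ler_pM2r ?invr_gt0 ?exprn_gt0// ge_min lexx.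
  rewrite ler_pM2r ?invr_gt0 ?exprn_gt0// ler_pM2l//; apply: cap.
  rewrite divr_gt0//= ler_pdivrMr//.
  have : 1 <= t0 * `|xi.1| by rewrite mulrC -ler_pdivrMr// mul1r; move: Kx; rewrite /K; lra.
  by move: (t0 * _) => *; lra.
apply: le_trans H3.
apply: (@le_trans _ _ (c / K ^+ 2 / `|xi.1| ^+ 3)).
  by rewrite ler_pM2r ?invr_gt0 ?exprn_gt0// ge_min lexx orbT.
have -> : c / K ^+ 2 / `|xi.1| ^+ 3 = c / `|xi.1| ^+ 5 * (`|xi.1| / K) ^+ 2.
  by field; rewrite !gt_eqF.
rewrite ler_piMr//; first by rewrite ltW// divr_gt0// exprn_gt0.
by rewrite expr_le1// ?divr_ge0// ?ler_pdivrMr ?mul1r ?ltW.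
Qed.

End lower.
End weights.

(** * Structure factors on thin lattice boxes *)

Section lattice.
Variable R : realType.
Implicit Types (k p q : int * int) (u v x : R * R) (pts : seq (R * R)).

Definition freq k : R * R := (2 * pi * k.1%:~R, 2 * pi * k.2%:~R).

(** The squared modulus of the exponential sum of the points at the frequency k. *)
Definition structure_factor pts k : R :=
  (\sum_(u <- pts) cos (dotp (freq k) u)) ^+ 2 +
  (\sum_(u <- pts) sin (dotp (freq k) u)) ^+ 2.

Lemma sum_cosB (T : Type) (s : seq T) (a : T -> R) :
  \sum_(i <- s) \sum_(j <- s) cos (a i - a j) =
  (\sum_(i <- s) cos (a i)) ^+ 2 + (\sum_(i <- s) sin (a i)) ^+ 2.
Proof.
rewrite !expr2 !mulr_suml -big_split; apply: eq_bigr => i _ /=.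
by rewrite !mulr_sumr -big_split; apply: eq_bigr => j _ /=; rewrite cosB.
Qed.

Lemma structure_factor_ge0 pts k : 0 <= structure_factor pts k.
Proof. by apply: addr_ge0; exact: sqr_ge0. Qed.

Lemma structure_factor0 pts : structure_factor pts 0 = (size pts)%:R ^+ 2.
Proof.
rewrite /structure_factor /dotp /freq /=.
under eq_bigr do rewrite mulr0 !mul0r addr0 cos0.
under [X in _ + X ^+ 2]eq_bigr do rewrite mulr0 !mul0r addr0 sin0.
by rewrite big1_eq expr0n addr0 big_const_seq count_predT iter_addr_0.
Qed.

Lemma ler_sum_mem (T : eqType) (s : seq T) (f : T -> R) (i : T) :
  (forall j, 0 <= f j) -> i \in s -> f i <= \sum_(j <- s) f j.
Proof.
move=> f0; elim: s => // j s IH; rewrite inE big_cons => /predU1P[->|/IH h].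
  by rewrite lerDl sumr_ge0.
by rewrite (le_trans h)// lerDr.
Qed.

Lemma ler_sum_subset (T : eqType) (s t : seq T) (f : T -> R) :
  (forall j, 0 <= f j) -> uniq s -> {subset s <= t} ->
  \sum_(j <- s) f j <= \sum_(j <- t) f j.
Proof.
move=> f0; elim: s t => [|i s IH] t /=; first by rewrite big_nil sumr_ge0.
move=> /andP[is_ us] st; have it : i \in t by apply: st; rewrite mem_head.
rewrite big_cons (perm_big _ (perm_to_rem it)) big_cons lerD2l; apply: IH => // j js.
have := st j; rewrite inE js orbT => /(_ isT).
rewrite (perm_mem (perm_to_rem it)) inE => /predU1P[ji|//].
by move: is_; rewrite -ji js.
Qed.

(** After exchanging the sums, every pair of points contributes the squared modulus
of an exponential sum over W; the diagonal pairs contribute |W|^2 each. *)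
Lemma sum_structure_factor_ge (W : seq (int * int)) pts :
  (size pts)%:R * (size W)%:R ^+ 2 <=
  \sum_(p <- W) \sum_(q <- W) structure_factor pts (q - p).
Proof.
have -> : \sum_(p <- W) \sum_(q <- W) structure_factor pts (q - p) =
  \sum_(u <- pts) \sum_(v <- pts) ((\sum_(q <- W) cos (dotp (freq q) u - dotp (freq q) v)) ^+ 2 +
    (\sum_(q <- W) sin (dotp (freq q) u - dotp (freq q) v)) ^+ 2).
  transitivity (\sum_(u <- pts) \sum_(v <- pts) \sum_(q <- W) \sum_(p <- W)
      cos ((dotp (freq q) u - dotp (freq q) v) - (dotp (freq p) u - dotp (freq p) v))); last first.
    apply: eq_bigr => u _; apply: eq_bigr => v _.
    exact: (sum_cosB W (fun q => dotp (freq q) u - dotp (freq q) v)).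
  transitivity (\sum_(p <- W) \sum_(q <- W) \sum_(u <- pts) \sum_(v <- pts)
      cos ((dotp (freq q) u - dotp (freq q) v) - (dotp (freq p) u - dotp (freq p) v))).
    apply: eq_bigr => p _; apply: eq_bigr => q _.
    rewrite /structure_factor -(sum_cosB pts (dotp (freq (q - p)))).
    apply: eq_bigr => u _; apply: eq_bigr => v _.
    by congr cos; rewrite /dotp /freq /= !rmorphB /=; ring.
  under eq_bigr do rewrite exchange_big.
  rewrite exchange_big /=; apply: eq_bigr => u _.
  under eq_bigr do rewrite exchange_big.
  rewrite exchange_big /=; apply: eq_bigr => v _.
  by rewrite exchange_big.
have -> : (size pts)%:R * (size W)%:R ^+ 2 = \sum_(u <- pts) (size W)%:R ^+ 2 :> R.
  by rewrite big_const_seq count_predT iter_addr_0 mulr_natl.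
rewrite !big_seq; apply: ler_sum => u up.
pose g v := (\sum_(q <- W) cos (dotp (freq q) u - dotp (freq q) v)) ^+ 2 +
    (\sum_(q <- W) sin (dotp (freq q) u - dotp (freq q) v)) ^+ 2.
apply: le_trans (@ler_sum_mem _ pts g u _ up); last first.
  by move=> v; apply: addr_ge0; exact: sqr_ge0.
rewrite /g; under eq_bigr do rewrite subrr cos0.
by rewrite big_const_seq count_predT iter_addr_0 lerDl sqr_ge0.
Qed.

(** Such integers lie in an interval of length 2 r. *)
Lemma count_close_le (x r : R) (m : nat) : 0 < r ->
  (count (fun l => `|x - l%:R| < r) (iota 0 m))%:R <= 2 * r + 1.
Proof.
move=> r0; rewrite -size_filter.
pose s := [seq l <- iota 0 m | `|x - l%:R| < r]; rewrite -/s.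
have : sorted leq s by apply: sorted_filter; [exact: leq_trans|exact: iota_sorted].
have us : uniq s by rewrite filter_uniq// iota_uniq.
have sP l : l \in s -> `|x - l%:R| < r by rewrite mem_filter => /andP[].
case: s us sP => [|a s] us sP; first by rewrite /=; lra.
rewrite /= path_sortedE; last exact: leq_trans.
move=> /andP[/allP sa _].
have h : {subset a :: s <= iota a (Num.truncn (2 * r)).+1}.
  move=> l ls; have al : (a <= l)%N by move: ls; rewrite inE => /predU1P[->|/sa].
  rewrite mem_iota al /= addnS ltnS -leq_subLR -(ler_nat R) natrB//.
  have h1 := sP _ ls; have h2 := sP a (mem_head _ _).
  have : l%:R - a%:R < 2 * r by move: h1 h2; rewrite !ltr_norml; lra.
  move=> h3; have lr : 0 <= 2 * r by lra.
  rewrite -natrB// ler_nat truncn_ge_nat// natrB//.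
  exact: ltW.
have := uniq_leq_size us h; rewrite size_iota => hs.
apply: (@le_trans _ _ (Num.truncn (2 * r)).+1%:R); first by rewrite ler_nat.
by rewrite -natr1 lerD2r truncn_le//; lra.
Qed.

(** The lattice points at height at most Y above a segment of slope sl and
horizontal length X. *)
Definition sheared_box (sl : R) (X Y : nat) : seq (int * int) :=
  [seq (i%:Z, Num.floor (sl * i%:R) + j%:Z) | i <- iota 0 X, j <- iota 0 Y].

Definition near_line (sl : R) (X Y : nat) k : bool :=
  (`|k.1%:~R| < X%:R :> R) && (`|k.2%:~R - sl * k.1%:~R| < 2 * Y%:R).

Lemma size_sheared_box sl X Y : size (sheared_box sl X Y) = (X * Y)%N.
Proof. by rewrite size_allpairs !size_iota. Qed.

Lemma uniq_sheared_box sl X Y : uniq (sheared_box sl X Y).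
Proof.
apply: allpairs_uniq; [exact: iota_uniq..|] => -[i j] [i' j'] _ _ /= [->].
by move=> /addrI [->].
Qed.

Lemma sheared_box_diff sl X Y p q : p \in sheared_box sl X Y ->
  q \in sheared_box sl X Y -> near_line sl X Y (q - p).
Proof.
move=> /allpairsP[[i j] /= [iX jY ->]] /allpairsP[[i' j'] /= [iX' jY' ->]].
rewrite !mem_iota !add0n in iX jY iX' jY'.
have h1 : (i%:R : R) < X%:R by rewrite ltr_nat.
have h2 : (i'%:R : R) < X%:R by rewrite ltr_nat.
have h3 : (j%:R : R) + 1 <= Y%:R by rewrite natr1 ler_nat.
have h4 : (j'%:R : R) + 1 <= Y%:R by rewrite natr1 ler_nat.
have p1 := ler0n R i; have p2 := ler0n R i'; have p3 := ler0n R j; have p4 := ler0n R j'.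
rewrite /near_line /= !rmorphB !rmorphD /= !ltr_norml -!pmulrn.
have /andP[f1 f2] := floor_itv (sl * i%:R).
have /andP[f3 f4] := floor_itv (sl * i'%:R).
rewrite !rmorphD /= in f2 f4.
rewrite mulrBr.
move: (sl * i%:R) (sl * i'%:R) ((Num.floor _)%:~R) ((Num.floor (sl * i'%:R))%:~R) f1 f2 f3 f4.
move: i%:R i'%:R j%:R j'%:R X%:R Y%:R h1 h2 h3 h4 p1 p2 p3 p4.
move=> *; lra.
Qed.

(** The differences q - p with p fixed are pairwise distinct and near the line of
slope sl through 0, so each of the X Y inner sums of [sum_structure_factor_ge]
is at most the right-hand side plus the term q = p, equal to N^2. *)
Lemma sum_near_line_ge pts sl X Y (L : seq (int * int)) : (0 < X * Y)%N ->
  (forall p q, p \in sheared_box sl X Y -> q \in sheared_box sl X Y ->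
     q != p -> q - p \in L) ->
  (size pts)%:R * (X * Y)%:R - (size pts)%:R ^+ 2 <=
  \sum_(k <- L) (near_line sl X Y k)%:R * structure_factor pts k.
Proof.
move=> XY0 HL; set T := \sum_(k <- L) _; set N : R := (size pts)%:R.
have XYR : 0 < (X * Y)%:R :> R by rewrite ltr0n.
rewrite -(ler_pM2l XYR) mulrBr.
have := sum_structure_factor_ge (sheared_box sl X Y) pts.
rewrite size_sheared_box -/N.
have row p : p \in sheared_box sl X Y ->
    \sum_(q <- sheared_box sl X Y) structure_factor pts (q - p) <= N ^+ 2 + T.
  move=> pW; rewrite (bigD1_seq p)//=; last exact: uniq_sheared_box.
  rewrite subrr structure_factor0 lerD2l.
  pose s := [seq q - p | q <- sheared_box sl X Y & q != p].
  have us : uniq s.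
    by rewrite map_inj_uniq ?filter_uniq ?uniq_sheared_box//; exact: addIr.
  have -> : \sum_(q <- sheared_box sl X Y | q != p) structure_factor pts (q - p) =
      \sum_(k <- s) (near_line sl X Y k)%:R * structure_factor pts k.
    rewrite big_map big_filter big_seq_cond [RHS]big_seq_cond.
    apply: eq_bigr => q /andP[qW _].
    by rewrite (sheared_box_diff pW qW) mul1r.
  apply: ler_sum_subset => //.
    by move=> k; apply: mulr_ge0 => //; exact: structure_factor_ge0.
  move=> _ /mapP[q + ->]; rewrite mem_filter => /andP[qp qW].
  exact: HL.
have : \sum_(p <- sheared_box sl X Y)
    \sum_(q <- sheared_box sl X Y) structure_factor pts (q - p) <=
    \sum_(p <- sheared_box sl X Y) (N ^+ 2 + T).
  by rewrite !big_seq; apply: ler_sum => p pW; exact: row.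
rewrite big_const_seq count_predT iter_addr_0 size_sheared_box -(mulr_natr (N ^+ 2 + T)).
move=> h1 h2; have := le_trans h2 h1.
have -> : N * (X * Y)%:R ^+ 2 = (X * Y)%:R * (N * (X * Y)%:R) by ring.
by move: ((X * Y)%:R * (N * _)) => Z; rewrite mulrDl; lra.
Qed.

Section directions.
Variables s0 s1 cA cB : R.
Hypotheses (s01 : s0 < s1) (cA0 : 0 < cA) (cB0 : 0 < cB).

Let d := (s1 - s0) / 3.
Let slope (M l : nat) : R := s0 + d + d * l%:R / M%:R.

Let d0 : 0 < d.
Proof. by have := s01; rewrite /d; lra. Qed.

Lemma slope_range M l : (l < M)%N -> s0 + d <= slope M l <= s0 + 2 * d.
Proof.
move=> lM; have M0 : 0 < M%:R :> R by rewrite ltr0n (leq_trans _ lM).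
have h : 0 <= d * l%:R / M%:R by positivity.
have h' : d * l%:R / M%:R <= d.
  by rewrite ler_pdivrMr// ler_pM2l// ler_nat ltnW.
by rewrite /slope; move: d0 h h'; lra.
Qed.

(** The number of the M directions for which k can be a difference of two points of
the box along that direction. *)
Definition direction_count (M : nat) k : nat :=
  count (fun l => near_line (slope M l) (2 * M ^ 3) (M ^ 2) k) (iota 0 M).

(** For large k.1 the admissible slopes form an interval of length O(M^2 / |k.1|),
while consecutive slopes differ by d / M. *)
Lemma direction_count_le M k : (0 < M)%N -> k.1 != 0 ->
  (direction_count M k)%:R <= 4 * M%:R ^+ 3 / (d * `|k.1%:~R|) + 1.
Proof.
move=> M0 k10; have MR : 0 < M%:R :> R by rewrite ltr0n.
have kR : 0 < `|k.1%:~R| :> R by rewrite normr_gt0 intr_eq0.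
pose x : R := (k.2%:~R / k.1%:~R - s0 - d) * M%:R / d.
pose r : R := 2 * M%:R ^+ 3 / (d * `|k.1%:~R|).
have r0 : 0 < r by apply: divr_gt0; rewrite mulr_gt0// ?exprn_gt0.
have -> : 4 * M%:R ^+ 3 / (d * `|k.1%:~R|) + 1 = 2 * r + 1.
  by rewrite /r; congr (_ + 1); ring.
apply: le_trans (count_close_le x M r0); rewrite ler_nat; apply: sub_count => l.
move=> /andP[_]; rewrite natrX => h.
have k1n : k.1%:~R != 0 :> R by rewrite intr_eq0.
have -> : x - l%:R = (k.2%:~R - slope M l * k.1%:~R) * (M%:R / (d * k.1%:~R)).
  by rewrite /x /slope; field; rewrite k1n !gt_eqF.
rewrite normrM; have -> : `|M%:R / (d * k.1%:~R)| = M%:R / (d * `|k.1%:~R|).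
  by rewrite normrM normfV normrM (gtr0_norm MR) (gtr0_norm d0).
have -> : r = 2 * M%:R ^+ 2 * (M%:R / (d * `|k.1%:~R|)) by rewrite /r; ring.
by rewrite ltr_pM2r// divr_gt0// mulr_gt0.
Qed.

(** If |k.1| is at least 2 M^2 / d then k is in the cone and its count is
O(M^3 / |k.1|) by [direction_count_le]; as |k.1| < 2 M^3 the bound of order -3
suffices. Otherwise both coordinates are O(M^2), the count is at most M, and
M^-9 . M is the size of the bound of order -4. *)
Lemma weight_ge_direction_count : exists2 c : R, 0 < c &
  forall (w : int * int -> R) M, (0 < M)%N ->
  (forall k, k != 0 -> cB / (Num.max `|k.1%:~R| `|k.2%:~R|) ^+ 4 <= w k) ->
  (forall k, k.1 != 0 -> s0 <= k.2%:~R / k.1%:~R <= s1 ->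
     cA / `|k.1%:~R| ^+ 3 <= w k) ->
  forall k, k != 0 -> c / M%:R ^+ 9 * (direction_count M k)%:R <= w k.
Proof.
(* C1 M^3 / |k.1| bounds the count in the far case, C2 M^2 bounds |k| in the
   other one *)
pose C1 := 4 / d + 2; pose C2 := (`|s0| + `|s1|) * (2 / d) + 2 + 2 / d.
have id0 : 0 < d^-1 by rewrite invr_gt0.
have C10 : 0 < C1 by rewrite /C1; move: id0; move: (d^-1) => *; lra.
have C20 : 0 < C2.
  rewrite /C2 -addrA; apply: ltr_wpDl; [positivity|].
  by apply: addr_gt0; positivity.
exists (Num.min (cA / (4 * C1)) (cB / C2 ^+ 4)).
  by rewrite lt_min; apply/andP; split; positivity.
set c := Num.min _ _; have c1 : c <= cA / (4 * C1) by rewrite ge_min lexx.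
have c2 : c <= cB / C2 ^+ 4 by rewrite ge_min lexx orbT.
have c0 : 0 < c by rewrite lt_min; apply/andP; split; positivity.
move: c c0 c1 c2 => c c0 c1 c2.
move=> w M M0 HB HA k k0; have MR : 0 < M%:R :> R by rewrite ltr0n.
have M9 : 0 < M%:R ^+ 9 :> R by rewrite exprn_gt0.
have [n0|n0] := posnP (direction_count M k).
  rewrite n0 mulr0; apply: le_trans (HB _ k0).
  by rewrite divr_ge0 ?exprn_ge0 ?le_max ?normr_ge0// ltW.
have [l] : exists l, (l < M)%N /\ near_line (slope M l) (2 * M ^ 3) (M ^ 2) k.
  move: n0; rewrite -has_count => /hasP[l]; rewrite mem_iota => lM h.
  by exists l.
move=> [lM /andP[kX kY]]; have /andP[sl1 sl2] := slope_range lM.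
rewrite natrX in kY; rewrite natrM natrX in kX.
have [far|close] := leP (2 * M%:R ^+ 2 / d) `|k.1%:~R|.
  have kap : 0 < `|k.1%:~R| :> R.
    by apply: lt_le_trans far; rewrite divr_gt0// mulr_gt0// exprn_gt0.
  have k10 : k.1 != 0 by rewrite -(intr_eq0 R) -normr_gt0.
  have k1n : k.1%:~R != 0 :> R by rewrite intr_eq0.
  have cone : s0 <= k.2%:~R / k.1%:~R <= s1.
    have : `|k.2%:~R / k.1%:~R - slope M l| <= d.
      have -> : k.2%:~R / k.1%:~R - slope M l =
         (k.2%:~R - slope M l * k.1%:~R) / k.1%:~R by field.
      rewrite normrM normfV ler_pdivrMr// (le_trans (ltW kY))//.
      by rewrite [d * _]mulrC -ler_pdivrMr.
    rewrite ler_norml; move: sl1 sl2; rewrite /d; move: (slope M l) (k.2%:~R / k.1%:~R) => *; lra.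
  apply: le_trans (HA k k10 cone).
  have n1 := direction_count_le M0 k10.
  have n2 : (direction_count M k)%:R <= C1 * M%:R ^+ 3 / `|k.1%:~R|.
    apply: le_trans n1 _.
    have -> : C1 * M%:R ^+ 3 / `|k.1%:~R| = 4 * M%:R ^+ 3 / (d * `|k.1%:~R|) +
      (2 * M%:R ^+ 3) / `|k.1%:~R| by rewrite /C1; field; rewrite !gt_eqF.
    by rewrite lerD2l ler_pdivlMr// mul1r ltW.
  apply: (@le_trans _ _ (c / M%:R ^+ 9 * (C1 * M%:R ^+ 3 / `|k.1%:~R|))).
    by rewrite ler_pM2l// divr_gt0.
  have -> : c / M%:R ^+ 9 * (C1 * M%:R ^+ 3 / `|k.1%:~R|) =
     (c * C1 / M%:R ^+ 6 * `|k.1%:~R| ^+ 2) / `|k.1%:~R| ^+ 3.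
    by field; rewrite !gt_eqF.
  rewrite ler_pM2r ?invr_gt0 ?exprn_gt0//.
  apply: (@le_trans _ _ (c * C1 / M%:R ^+ 6 * (2 * M%:R ^+ 3) ^+ 2)).
    rewrite ler_pM2l; last by rewrite divr_gt0 ?mulr_gt0 ?exprn_gt0.
    by rewrite lerXn2r ?nnegrE ?ltW// mulr_gt0 ?exprn_gt0.
  have -> : c * C1 / M%:R ^+ 6 * (2 * M%:R ^+ 3) ^+ 2 = c * (4 * C1).
    by field; rewrite gt_eqF.
  by rewrite -ler_pdivlMr// mulr_gt0.
apply: le_trans (HB k k0).
have kmax : Num.max `|k.1%:~R| `|k.2%:~R| <= C2 * M%:R ^+ 2.
  have M2 : 0 < M%:R ^+ 2 :> R by rewrite exprn_gt0.
  have hs : `|slope M l| <= `|s0| + `|s1|.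
    have h1 := ler_norm s0; have h2 := ler_norm s1.
    have h3 := ler_norm (- s0); have h4 := ler_norm (- s1); rewrite !normrN in h3 h4.
    have : s0 <= slope M l <= s1 by move: sl1 sl2; rewrite /d; move: (slope M l) => *; lra.
    have : s0 < s1 by [].
    by rewrite ler_norml; move: (slope M l) (`|s0|) (`|s1|) h1 h2 h3 h4 => *; lra.
  have C2E : C2 * M%:R ^+ 2 = (`|s0| + `|s1|) * (2 * M%:R ^+ 2 / d) + 2 * M%:R ^+ 2 +
     2 * M%:R ^+ 2 / d by rewrite /C2; ring.
  have t1 : 0 <= (`|s0| + `|s1|) * (2 * M%:R ^+ 2 / d).
    by positivity.
  have t2 : `|k.2%:~R| <= (`|s0| + `|s1|) * (2 * M%:R ^+ 2 / d) + 2 * M%:R ^+ 2.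
    have -> : k.2%:~R = slope M l * k.1%:~R + (k.2%:~R - slope M l * k.1%:~R) :> R by ring.
    rewrite (le_trans (ler_normD _ _))// lerD ?(ltW kY)// normrM.
    by apply: ler_pM => //; exact: ltW.
  have t3 : 0 <= 2 * M%:R ^+ 2 / d by positivity.
  rewrite ge_max C2E; apply/andP; split.
    apply: (le_trans (ltW close)); rewrite lerDr; positivity.
  by apply: (le_trans t2); rewrite lerDl.
have max0 : 0 < Num.max `|k.1%:~R| `|k.2%:~R| :> R.
  rewrite lt_max !normr_gt0 !intr_eq0 -negb_and.
  by apply: contra k0 => /andP[/eqP h1 /eqP h2]; rewrite [k]surjective_pairing h1 h2.
apply: (@le_trans _ _ (cB / (C2 * M%:R ^+ 2) ^+ 4)); last first.
  rewrite ler_pM2l// lef_pV2 ?posrE ?exprn_gt0//; last by rewrite mulr_gt0 ?exprn_gt0.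
  by apply: lerXn2r; rewrite ?nnegrE; [exact: ltW|positivity|exact: kmax].
apply: (@le_trans _ _ (c / M%:R ^+ 9 * M%:R)).
  rewrite ler_pM2l ?divr_gt0// ler_nat /direction_count.
  by rewrite (leq_trans (count_size _ _))// size_iota.
have -> : c / M%:R ^+ 9 * M%:R = c / M%:R ^+ 8 by field; rewrite gt_eqF.
have -> : cB / (C2 * M%:R ^+ 2) ^+ 4 = cB / C2 ^+ 4 / M%:R ^+ 8.
  by field; rewrite !gt_eqF.
by rewrite ler_pM2r// invr_gt0 exprn_gt0.
Qed.

(** The witness is 1 + trunc(N^(1/5)), at most twice N^(1/5). *)
Lemma fifth_root_ceil (N : nat) : (1 <= N)%N -> exists M : nat,
  [/\ (0 < M)%N, N%:R <= M%:R ^+ 5 :> R & N%:R `^ (2 / 5) / 8 <= N%:R / M%:R ^+ 3 :> R].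
Proof.
move=> N1; have N0 : 0 < N%:R :> R by rewrite ltr0n.
pose t : R := N%:R `^ (1 / 5); have t0 : 0 < t by rewrite powR_gt0.
have t5 : t ^+ 5 = N%:R.
  by rewrite -powR_mulrn ?ltW// -powRrM -mulrA mulVf// mul1r powRr1// ltW.
have t2 : t ^+ 2 = N%:R `^ (2 / 5).
  by rewrite -powR_mulrn ?ltW// -powRrM; congr (_ `^ _); field.
have t1 : 1 <= t.
  rewrite leNgt; apply/negP => tlt; have : t ^+ 5 < 1 by rewrite exprn_ilt1 ?ltW.
  by rewrite t5 ltNge ler1n N1.
exists (Num.truncn t).+1; have /andP[tr1 tr2] := truncn_itv (ltW t0).
have M0 : 0 < (Num.truncn t).+1%:R :> R by rewrite ltr0n.
split=> //; first by rewrite -t5 lerXn2r ?nnegrE ?ltW.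
have M2t : (Num.truncn t).+1%:R <= 2 * t by rewrite -natr1; lra.
move: (_.+1%:R) M0 M2t {tr1 tr2} => m m0 m2t.
rewrite -t2 -t5 ler_pdivlMr ?exprn_gt0//.
apply: (@le_trans _ _ (t ^+ 2 / 8 * (2 * t) ^+ 3)).
  rewrite ler_pM2l; last by positivity.
  by apply: lerXn2r; rewrite ?nnegrE; [exact: ltW|positivity|].
by rewrite le_eqVlt; apply/orP; left; apply/eqP; field.
Qed.

(** L collects the nonzero differences of points of the M boxes. As each box has
2 M^5 >= 2 N points, [sum_near_line_ge] gives N M^5 per direction, and
[weight_ge_direction_count] converts multiplicities into weights. *)
Lemma lattice_energy_lower : exists2 c : R, 0 < c &
  forall (w : int * int -> R) pts, (1 <= size pts)%N ->
  (forall k, k != 0 -> cB / (Num.max `|k.1%:~R| `|k.2%:~R|) ^+ 4 <= w k) ->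
  (forall k, k.1 != 0 -> s0 <= k.2%:~R / k.1%:~R <= s1 ->
     cA / `|k.1%:~R| ^+ 3 <= w k) ->
  exists L : seq (int * int), [/\ uniq L, 0 \notin L &
    c * (size pts)%:R `^ (2 / 5) <= \sum_(k <- L) w k * structure_factor pts k].
Proof.
have [c c0 Hc] := weight_ge_direction_count.
exists (c / 8); first by rewrite divr_gt0.
move=> w pts N1 HB HA; have [M [M0 NM HM]] := fifth_root_ceil N1.
pose X := (2 * M ^ 3)%N; pose Y := (M ^ 2)%N; set N : R := (size pts)%:R in NM HM *.
have MR : 0 < M%:R :> R by rewrite ltr0n.
pose W l := sheared_box (slope M l) X Y.
pose L := [seq k <- undup (flatten [seq [seq q - p | p <- W l, q <- W l] | l <- iota 0 M])
            | k != 0].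
exists L; split.
- by rewrite filter_uniq// undup_uniq.
- by rewrite mem_filter eqxx.
have XY : (X * Y)%:R = 2 * M%:R ^+ 5 :> R by rewrite natrM {1}/X natrM natrX /Y natrX; ring.
have XY0 : (0 < X * Y)%N by rewrite -(ltr0n R) XY; positivity.
have LP l p q : (l < M)%N -> p \in W l -> q \in W l -> q != p -> q - p \in L.
  move=> lM pW qW qp; rewrite mem_filter subr_eq0 qp /= mem_undup.
  apply/flattenP; exists [seq q - p | p <- W l, q <- W l].
    by apply/mapP; exists l => //; rewrite mem_iota.
  by apply/allpairsP; exists (p, q).
have N0 : 0 <= N by [].
have h1 : M%:R * (N * M%:R ^+ 5) <=
    \sum_(k <- L) (direction_count M k)%:R * structure_factor pts k.
  have -> : \sum_(k <- L) (direction_count M k)%:R * structure_factor pts k =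
     \sum_(l <- iota 0 M) \sum_(k <- L) (near_line (slope M l) X Y k)%:R *
        structure_factor pts k.
    rewrite exchange_big /=; apply: eq_bigr => k _.
    rewrite -mulr_suml; congr (_ * _).
    by rewrite /direction_count -sum1_count natr_sum big_mkcond /=; apply: eq_bigr => l _;
      case: near_line.
  have -> : M%:R * (N * M%:R ^+ 5) = \sum_(l <- iota 0 M) (N * M%:R ^+ 5).
    by rewrite big_const_seq count_predT size_iota iter_addr_0 mulr_natl.
  rewrite !big_seq; apply: ler_sum => l; rewrite mem_iota add0n => lM.
  apply: le_trans (sum_near_line_ge pts XY0 (fun p q => LP l p q lM)).
  have : N ^+ 2 <= N * M%:R ^+ 5 by rewrite expr2 ler_wpM2l.
  have -> : N * (X * Y)%:R = 2 * (N * M%:R ^+ 5) by rewrite XY; ring.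
  by rewrite -/N; move: (N * _) (N ^+ 2) => *; lra.
apply: (@le_trans _ _ (c / M%:R ^+ 9 *
    \sum_(k <- L) (direction_count M k)%:R * structure_factor pts k)); last first.
  rewrite mulr_sumr !big_seq; apply: ler_sum => k.
  rewrite mem_filter => /andP[k0 _]; rewrite mulrA ler_wpM2r ?structure_factor_ge0//.
  exact: Hc.
apply: (@le_trans _ _ (c / M%:R ^+ 9 * (M%:R * (N * M%:R ^+ 5)))); last first.
  by rewrite ler_pM2l// divr_gt0// exprn_gt0.
have -> : c / M%:R ^+ 9 * (M%:R * (N * M%:R ^+ 5)) = c * (N / M%:R ^+ 3).
  by field; rewrite gt_eqF.
by rewrite -mulrA ler_pM2l// mulrC.
Qed.

End directions.
End lattice.

(** * Bessel's inequality on the torus *)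

Section torus_analysis.
Variable R : realType.
Implicit Types (k m : int * int) (t u v : R * R) (F : R * R -> R).

Definition unit_ind (t : R * R) : R := \1_`[0, 1[ t.1 * \1_`[0, 1[ t.2.

Definition shift_int (x : R * R) m : R * R := (x.1 + m.1%:~R, x.2 + m.2%:~R).

Lemma tame2_unit : tame2 unit_ind.
Proof. by apply: tame2_prod; exact: tame_itv. Qed.

Lemma sin_2pi_int (n : int) : sin (2 * pi * n%:~R) = 0 :> R.
Proof.
have pos (j : nat) : sin (2 * pi * j%:R) = 0 :> R.
  have h := periodicn (@sinD2pi R) j 0; rewrite add0r sin0 in h.
  transitivity (sin (pi *+ 2 *+ j) : R); last exact: h.
  by congr sin; rewrite -mulrnA -(mulr_natr pi) natrM; ring.
case: n => j; first exact: pos.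
by rewrite NegzE rmorphN /= mulrN sinN pos oppr0.
Qed.

Lemma cos_2pi_int (n : int) : cos (2 * pi * n%:~R) = 1 :> R.
Proof.
have pos (j : nat) : cos (2 * pi * j%:R) = 1 :> R.
  have h := periodicn (@cosD2pi R) j 0; rewrite add0r cos0 in h.
  transitivity (cos (pi *+ 2 *+ j) : R); last exact: h.
  by congr cos; rewrite -mulrnA -(mulr_natr pi) natrM; ring.
case: n => j; first exact: pos.
by rewrite NegzE rmorphN /= mulrN cosN pos.
Qed.

Lemma dotp_shift k (x : R * R) m :
  dotp (freq R k) (shift_int x m) =
  dotp (freq R k) x + 2 * pi * (k.1 * m.1 + k.2 * m.2)%:~R.
Proof. by rewrite /dotp /freq /shift_int /= rmorphD !rmorphM /=; ring. Qed.

Lemma cosD_2pi_int (a : R) (n : int) : cos (a + 2 * pi * n%:~R) = cos a.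
Proof. by rewrite cosD sin_2pi_int cos_2pi_int; ring. Qed.

Lemma sinD_2pi_int (a : R) (n : int) : sin (a + 2 * pi * n%:~R) = sin a.
Proof. by rewrite sinD sin_2pi_int cos_2pi_int; ring. Qed.

(** A fundamental domain has to be half-open for the unfolding, while the
fundamental theorem of calculus is about closed intervals. *)
Lemma integ_itv_co (f : R -> R) : continuous f ->
  integ (fun x => \1_`[0, 1[ x * f x) = integ (fun x => \1_`[0, 1] x * f x).
Proof.
move=> cf; rewrite /integ.
have E (i : interval R) : (fun x => \1_[set` i] x * f x) = (f \_ [set` i]).
  by apply/funext => x; rewrite patchE indicE; case: ifP => _; rewrite ?mul1r ?mul0r.
rewrite !E -!Rintegral_mkcond Rintegral_itv_bndo_bndc//.
have := tame_integrable (tame_cont_itv 0 1 cf).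
rewrite E => h.
have iS : (@lebesgue_measure R).-integrable `[0, 1]%classic (EFin \o f).
  rewrite integrable_mkcond//; move: h; congr (integrable _ _ _).
  by apply/funext => x; rewrite /= !patchE; case: ifP.
apply: (integrableS _ _ _ iS) => //.
by apply: subset_itvl; rewrite bnd_simp.
Qed.

Lemma integ_cos_unit (n : int) :
  integ (fun x => \1_`[0, 1[ x * cos (2 * pi * n%:~R * x)) = (n == 0)%:R :> R.
Proof.
rewrite (integ_itv_co (f := fun x => cos (2 * pi * n%:~R * x))); last first.
  exact: is_derive_continuous.
have [->|n0] := eqVneq n 0.
  have -> : (fun x : R => \1_`[0, 1] x * cos (2 * pi * 0%:~R * x)) = \1_`[0, 1].
    by apply/funext => x; rewrite mulr0 mul0r cos0 mulr1.
  by rewrite integ_itv// subr0.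
pose c : R := 2 * pi * n%:~R.
have c0 : c != 0 by rewrite /c !mulf_neq0 ?intr_eq0// gt_eqF// pi_gt0.
have dF (x : R) : is_derive x 1 (fun x => sin (c * x) / c) (cos (c * x)).
  have dl : is_derive x 1 (fun x : R => c * x) c.
    by apply: is_derive_eq; rewrite /GRing.scale/=; ring.
  have ds : is_derive x 1 (fun x : R => sin (c * x)) (cos (c * x) * c).
    by apply: is_derive_eq; rewrite /GRing.scale/=; ring.
  by apply: is_derive_eq; rewrite /GRing.scale/=; field.
rewrite (integ_FTC ltr01 dF); last exact: is_derive_continuous.
by rewrite mulr1 mulr0 sin0 sin_2pi_int mul0r subrr.
Qed.

Lemma integ_sin_unit (n : int) :
  integ (fun x => \1_`[0, 1[ x * sin (2 * pi * n%:~R * x)) = 0 :> R.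
Proof.
rewrite (integ_itv_co (f := fun x => sin (2 * pi * n%:~R * x))); last first.
  exact: is_derive_continuous.
have [->|n0] := eqVneq n 0.
  have -> : (fun x : R => \1_`[0, 1] x * sin (2 * pi * 0%:~R * x)) = fun=> 0.
    by apply/funext => x; rewrite mulr0 mul0r sin0 mulr0.
  by rewrite integ0.
pose c : R := 2 * pi * n%:~R.
have c0 : c != 0 by rewrite /c !mulf_neq0 ?intr_eq0// gt_eqF// pi_gt0.
have dF (x : R) : is_derive x 1 (fun x => - cos (c * x) / c) (sin (c * x)).
  have dl : is_derive x 1 (fun x : R => c * x) c.
    by apply: is_derive_eq; rewrite /GRing.scale/=; ring.
  have ds : is_derive x 1 (fun x : R => cos (c * x)) (- sin (c * x) * c).
    by apply: is_derive_eq; rewrite /GRing.scale/=; ring.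
  by apply: is_derive_eq; rewrite /GRing.scale/=; field.
rewrite (integ_FTC ltr01 dF); last exact: is_derive_continuous.
by rewrite mulr1 mulr0 cos0 cos_2pi_int subrr.
Qed.

Lemma tame_unit_trig (f : R -> R) : continuous f -> (forall x, `|f x| <= 1) ->
  tame (fun x => \1_`[0, 1[ x * f x).
Proof.
move=> cf f1; apply: (@tameMb _ _ _ 1) => //; first exact: tame_itv.
exact: continuous_measurable.
Qed.

Lemma tame2_trig F xi (g : R -> R) : tame2 F -> continuous g ->
  (forall x, `|g x| <= 1) -> tame2 (fun x => F x * g (dotp xi x)).
Proof.
move=> tF cg g1; apply: (@tame2Mb _ _ _ 1) => //.
apply: (measurableT_comp (continuous_measurable cg)); exact: measurable_dotp.
Qed.

Lemma tame2_cos F xi : tame2 F -> tame2 (fun x => F x * cos (dotp xi x)).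
Proof. by move=> tF; apply: tame2_trig => //; [exact: continuous_cos|exact: cos_max]. Qed.

Lemma tame2_sin F xi : tame2 F -> tame2 (fun x => F x * sin (dotp xi x)).
Proof. by move=> tF; apply: tame2_trig => //; [exact: continuous_sin|exact: sin_max]. Qed.

Section unit_trig.
Variable k : int * int.
Let c (n : int) (x : R) : R := \1_`[0, 1[ x * cos (2 * pi * n%:~R * x).
Let s (n : int) (x : R) : R := \1_`[0, 1[ x * sin (2 * pi * n%:~R * x).

Let tc n : tame (c n).
Proof.
apply: tame_unit_trig; last by move=> x; exact: cos_max.
exact: is_derive_continuous.
Qed.

Let ts n : tame (s n).
Proof.
apply: tame_unit_trig; last by move=> x; exact: sin_max.
exact: is_derive_continuous.
Qed.

Lemma integ2_unit_cos :
  integ2 (fun t => unit_ind t * cos (dotp (freq R k) t)) = (k == 0)%:R.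
Proof.
have -> : (fun t => unit_ind t * cos (dotp (freq R k) t)) =
  fun t => c k.1 t.1 * c k.2 t.2 - s k.1 t.1 * s k.2 t.2.
  by apply/funext => t; rewrite /unit_ind /dotp /freq /= cosD /c /s; ring.
rewrite integ2B; [|exact: tame2_prod..].
rewrite !integ2_prod//.
rewrite integ_cos_unit integ_cos_unit /s integ_sin_unit mul0r subr0 -natrM mulnb.
by case: k.
Qed.

Lemma integ2_unit_sin :
  integ2 (fun t => unit_ind t * sin (dotp (freq R k) t)) = 0.
Proof.
have -> : (fun t => unit_ind t * sin (dotp (freq R k) t)) =
  fun t => s k.1 t.1 * c k.2 t.2 + c k.1 t.1 * s k.2 t.2.
  by apply/funext => t; rewrite /unit_ind /dotp /freq /= sinD /c /s; ring.
rewrite integ2D; [|exact: tame2_prod..].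
rewrite !integ2_prod//.
by rewrite /s !integ_sin_unit mul0r mulr0 addr0.
Qed.

End unit_trig.

Section bessel.
Variables (E : R * R -> R) (L : seq (int * int)).
Hypotheses (tE : tame2 E) (uL : uniq L).

Definition cos_mode k : R := integ2 (fun t => E t * cos (dotp (freq R k) t)).
Definition sin_mode k : R := integ2 (fun t => E t * sin (dotp (freq R k) t)).
Definition mode k t : R :=
  cos_mode k * cos (dotp (freq R k) t) + sin_mode k * sin (dotp (freq R k) t).
(** The trigonometric polynomial with the coefficients of E at the frequencies of
L, in real form: a frequency and its opposite are the same real mode. *)
Definition trig_sum t : R := \sum_(k <- L) mode k t.

Lemma dotpN k t : dotp (freq R (- k)) t = - dotp (freq R k) t.
Proof. by rewrite /dotp /freq /= !rmorphN /=; ring. Qed.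

Lemma cos_modeN k : cos_mode (- k) = cos_mode k.
Proof. by congr integ2; apply/funext => t; rewrite dotpN cosN. Qed.

Lemma sin_modeN k : sin_mode (- k) = - sin_mode k.
Proof.
rewrite /sin_mode -[RHS]mulN1r -(integ2Z (-1) (tame2_sin (freq R k) tE)).
by congr integ2; apply/funext => t; rewrite dotpN sinN mulrN mulN1r.
Qed.

Lemma tame2_mode F k : tame2 F -> tame2 (fun t => F t * mode k t).
Proof.
move=> tF; have -> : (fun t => F t * mode k t) = fun t =>
   cos_mode k * (F t * cos (dotp (freq R k) t)) +
   sin_mode k * (F t * sin (dotp (freq R k) t)).
  by apply/funext => t; rewrite /mode; ring.
by apply: tame2D; apply: tame2Z; [exact: tame2_cos|exact: tame2_sin].
Qed.

Lemma tame2_trig_sum F : tame2 F -> tame2 (fun t => F t * trig_sum t).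
Proof.
move=> tF; rewrite /trig_sum; under eq_fun do rewrite mulr_sumr.
by apply: tame2_sum => k; exact: tame2_mode.
Qed.

Lemma integ2_mode F k : tame2 F -> integ2 (fun t => F t * mode k t) =
  cos_mode k * integ2 (fun t => F t * cos (dotp (freq R k) t)) +
  sin_mode k * integ2 (fun t => F t * sin (dotp (freq R k) t)).
Proof.
move=> tF; have -> : (fun t => F t * mode k t) = fun t =>
   cos_mode k * (F t * cos (dotp (freq R k) t)) +
   sin_mode k * (F t * sin (dotp (freq R k) t)).
  by apply/funext => t; rewrite /mode; ring.
have tc := tame2_cos (freq R k) tF; have ts := tame2_sin (freq R k) tF.
by rewrite integ2D ?integ2Z//; exact: tame2Z.
Qed.

Lemma integ2_trig_sum : integ2 (fun t => E t * trig_sum t) =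
  \sum_(k <- L) (cos_mode k ^+ 2 + sin_mode k ^+ 2).
Proof.
rewrite /trig_sum; under eq_fun do rewrite mulr_sumr.
rewrite integ2_sum; last by move=> k; exact: tame2_mode.
by apply: eq_bigr => k _; rewrite integ2_mode// !expr2.
Qed.

(** The case l = - k is not orthogonal to k in real form: the two modes coincide. *)
Lemma integ2_mode_mode k l : integ2 (fun t => unit_ind t * mode k t * mode l t) =
  2^-1 * (cos_mode k ^+ 2 + sin_mode k ^+ 2) * ((l == k)%:R + (l == - k)%:R).
Proof.
pose C j t := unit_ind t * cos (dotp (freq R j) t).
pose S j t := unit_ind t * sin (dotp (freq R j) t).
have tC j : tame2 (C j) by apply: tame2_cos; exact: tame2_unit.
have tS j : tame2 (S j) by apply: tame2_sin; exact: tame2_unit.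
have dD t : dotp (freq R (k + l)) t = dotp (freq R k) t + dotp (freq R l) t.
  by rewrite /dotp /freq /= !rmorphD /=; ring.
have dB t : dotp (freq R (k - l)) t = dotp (freq R k) t - dotp (freq R l) t.
  by rewrite /dotp /freq /= !rmorphB /=; ring.
set a := cos_mode k; set b := sin_mode k; set a' := cos_mode l; set b' := sin_mode l.
have -> : (fun t => unit_ind t * mode k t * mode l t) = fun t =>
    (a * a' + b * b') / 2 * C (k - l) t + (a * a' - b * b') / 2 * C (k + l) t +
    ((b * a' - a * b') / 2 * S (k - l) t + (b * a' + a * b') / 2 * S (k + l) t).
  apply/funext => t; rewrite /mode -/a -/b -/a' -/b' /C /S dD dB cosB cosD sinB sinD.
  by field.
rewrite !integ2D; [|by do ?apply: tame2D; apply: tame2Z..].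
rewrite !integ2Z// /C /S !integ2_unit_sin !integ2_unit_cos !mulr0 !addr0.
have -> : (k - l == 0) = (l == k) by rewrite subr_eq0 eq_sym.
have -> : (k + l == 0) = (l == - k) by rewrite addrC addr_eq0.
rewrite /a' /b' {a' b'}.
have [lk|_] := eqVneq l k; have [lNk|_] := eqVneq l (- k);
  rewrite ?lk ?lNk ?cos_modeN ?sin_modeN -/a -/b /=; try by field.
have := sin_modeN k; have := cos_modeN k; rewrite -lNk lk -/a -/b => _ bb.
have -> : b = 0 by move: bb; move: b => z; lra.
by rewrite /=; field.
Qed.

(** An inequality is enough; it may be strict when L contains k without - k. Each
k of L meets at most two values of l by [integ2_mode_mode]. *)
Lemma integ2_unit_trig_sum2 : integ2 (fun t => unit_ind t * trig_sum t ^+ 2) <=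
  \sum_(k <- L) (cos_mode k ^+ 2 + sin_mode k ^+ 2).
Proof.
have tm k : tame2 (fun t => unit_ind t * mode k t) by apply: tame2_mode; exact: tame2_unit.
have -> : (fun t => unit_ind t * trig_sum t ^+ 2) =
   fun t => \sum_(k <- L) \sum_(l <- L) unit_ind t * mode k t * mode l t.
  apply/funext => t; rewrite /trig_sum expr2 mulr_suml mulr_sumr.
  by apply: eq_bigr => k _; rewrite !mulr_sumr; apply: eq_bigr => l _; rewrite mulrA.
rewrite integ2_sum; last first.
  by move=> k; apply: tame2_sum => l; exact: (tame2_mode l (tm k)).
apply: ler_sum => k _; rewrite integ2_sum; last first.
  by move=> l; exact: (tame2_mode l (tm k)).
under eq_bigr do rewrite integ2_mode_mode.
rewrite -mulr_sumr big_split /=.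
have cnt j : \sum_(l <- L) (l == j)%:R <= 1 :> R.
  rewrite -natr_sum (_ : (\sum_(l <- L) (l == j))%N = count_mem j L); last first.
    by rewrite -sum1_count [RHS]big_mkcond; apply: eq_bigr => l _ /=; case: eqP.
  by rewrite count_uniq_mem// lern1 leq_b1.
have := cnt k; have := cnt (- k).
set x := \sum_(_ <- _) _; set y := \sum_(_ <- _) _ => hx hy.
have A0 : 0 <= cos_mode k ^+ 2 + sin_mode k ^+ 2 by positivity.
rewrite -mulrA mulrCA ler_piMr//; lra.
Qed.

Lemma trig_sum_bounded : exists2 K, 0 <= K & forall t, `|trig_sum t| <= K.
Proof.
exists (\sum_(k <- L) (`|cos_mode k| + `|sin_mode k|)).
  by apply: sumr_ge0 => k _; positivity.
move=> t; rewrite /trig_sum (le_trans (ler_norm_sum _ _ _))//; apply: ler_sum => k _.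
rewrite /mode (le_trans (ler_normD _ _))// !normrM.
by apply: lerD; rewrite ler_piMr// ?cos_max ?sin_max.
Qed.

End bessel.
End torus_analysis.

(** * Fourier coefficients of the discrepancy *)

Section unfolding.
Variable R : realType.
Implicit Types (k m : int * int) (t u v : R * R) (F : R * R -> R).

Definition int_range (K : nat) : seq int := [seq i%:Z - K%:Z | i <- iota 0 (2 * K + 1)].
Definition int_box (K : nat) : seq (int * int) :=
  [seq (a, b) | a <- int_range K, b <- int_range K].

Lemma uniq_int_range K : uniq (int_range K).
Proof.
rewrite map_inj_uniq ?iota_uniq// => i j /(@addIr _ _) [].
exact.
Qed.

Lemma mem_int_range K (a : int) : (a \in int_range K) = (`|a| <= K%:Z).
Proof.
apply/mapP/idP => [[i + ->]|aK].
  by rewrite mem_iota add0n => iK; lia.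
by exists (absz (a + K%:Z)%R); [rewrite mem_iota add0n; lia|lia].
Qed.

Lemma uniq_int_box K : uniq (int_box K).
Proof.
by apply: allpairs_uniq; [exact: uniq_int_range..|] => -[a b] [a' b'] _ _ [-> ->].
Qed.

Lemma mem_int_box K k : (k \in int_box K) = (`|k.1| <= K%:Z) && (`|k.2| <= K%:Z).
Proof.
rewrite -!mem_int_range; apply/allpairsP/idP => [[[a b]/= [aK bK ->]]|/andP[k1 k2]].
  by rewrite aK.
by exists k; split=> //; case: k {k1 k2}.
Qed.

Lemma sum_unit_range (x : R) K : `|x| + 1 <= K%:R ->
  \sum_(a <- int_range K) \1_`[0, 1[ (x + a%:~R) = 1 :> R.
Proof.
move=> xK; pose a0 := - Num.floor x.
have E a : \1_`[0, 1[ (x + a%:~R) = (a == a0)%:R :> R.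
  rewrite indicE; congr (_%:R); congr nat_of_bool; apply/idP/idP.
    rewrite inE/= in_itv/= => /andP[h1 h2]; rewrite /a0 -addr_eq0 addrC addr_eq0.
    rewrite floor_eq rmorphD rmorphN /=.
    by apply/andP; split; lra.
  move=> /eqP ->; rewrite inE/= in_itv/= /a0 rmorphN /=.
  by have /andP[] := floor_itv x; rewrite rmorphD /=; move: (Num.floor x)%:~R => *; lra.
under eq_bigr do rewrite E.
rewrite -natr_sum (_ : (\sum_(a <- _) (a == a0))%N = count_mem a0 (int_range K)); last first.
  by rewrite -sum1_count [RHS]big_mkcond; apply: eq_bigr => a _ /=; case: eqP.
rewrite count_uniq_mem ?uniq_int_range// mem_int_range /a0 normrN.
suff -> : `|Num.floor x| <= K%:Z by [].
rewrite -(ler_int R) intr_norm; have /andP[] := floor_itv x; rewrite rmorphD /=.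
move: xK; rewrite -[(Posz K)%:~R]pmulrn; move: (Num.floor x)%:~R => y.
have := ler_norm x; have := ler_norm (- x); rewrite normrN ler_norml; move: (`|x|) => *; lra.
Qed.

Lemma sum_unit_box t K : `|t.1| + 1 <= K%:R -> `|t.2| + 1 <= K%:R ->
  \sum_(m <- int_box K) unit_ind (shift_int t m) = 1.
Proof.
move=> t1 t2; rewrite /int_box big_allpairs /=.
rewrite /unit_ind /shift_int /=.
under eq_bigr do rewrite -mulr_sumr sum_unit_range// mulr1.
exact: sum_unit_range.
Qed.

Lemma tame2_reflect F v m : tame2 F -> tame2 (fun t => F (shift_int (v - t) m)).
Proof.
move=> tF; have n1 : -1 != 0 :> R by rewrite oppr_eq0 oner_neq0.
have := tame2_affine (v.1 + m.1%:~R) (v.2 + m.2%:~R) n1 n1 tF.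
congr tame2; apply/funext => t; rewrite /shift_int /= !mulN1r.
by congr (F (_, _)); ring.
Qed.

(** The integer translates of the unit square tile the plane; finitely many of them
meet the support of F. *)
Lemma unfolding F v K : tame2 F ->
  (forall y, F y != 0 -> `|v.1 - y.1| + 1 <= K%:R /\ `|v.2 - y.2| + 1 <= K%:R) ->
  \sum_(m <- int_box K) integ2 (fun t => unit_ind t * F (shift_int (v - t) m)) = integ2 F.
Proof.
move=> tF FK; have n1 : -1 != 0 :> R by rewrite oppr_eq0 oner_neq0.
(* substitute y = v - t *)
pose G t := F (-1 * t.1 + v.1, -1 * t.2 + v.2).
have tG : tame2 G by exact: tame2_affine.
have tU m : tame2 (fun t => unit_ind (shift_int t m) * G t).
  apply: tame2M => //.
  have := tame2_affine m.1%:~R m.2%:~R (oner_neq0 R) (oner_neq0 R) (@tame2_unit R).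
  by under eq_fun do rewrite !mul1r.
rewrite (integ2_affine v.1 v.2 n1 n1 tF) normrN1 !mul1r -/G.
have -> : G = fun t => \sum_(m <- int_box K) unit_ind (shift_int t m) * G t.
  apply/funext => t; rewrite -mulr_suml.
  have [->|Gt] := eqVneq (G t) 0; first by rewrite mulr0.
  have [] := FK _ Gt; rewrite /= !mulN1r => h1 h2.
  rewrite sum_unit_box ?mul1r//.
    by move: h1; rewrite opprD opprK addrCA subrr addr0.
  by move: h2; rewrite opprD opprK addrCA subrr addr0.
rewrite integ2_sum; last exact: tU.
apply: eq_bigr => m _.
rewrite (integ2_affine (- m.1%:~R) (- m.2%:~R) (oner_neq0 R) (oner_neq0 R) (tU m)).
rewrite normr1 !mul1r; congr integ2; apply/funext => -[t1 t2].
rewrite /G /shift_int /= !mul1r !subrK; congr (_ * F (_, _)); ring.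
Qed.

End unfolding.

Section torus_energy.
Variables (R : realType) (C O B : set (R * R)) (M l : R).
Hypotheses (mO : measurable O) (mB : measurable B).
Hypotheses (OC : O `<=` C) (CB : C `<=` B) (bB : planar_bounded B M).
Hypotheses (null : integ2 (fun x => \1_B x - \1_O x) = 0 :> R).
Hypotheses (l0 : 0 < l) (l1 : l <= 1).
Variable pts : seq (R * R).
Implicit Types (k m : int * int) (t u v y : R * R) (F : R * R -> R).

Let bO : planar_bounded O M.
Proof. by move=> y /OC/CB/bB. Qed.

Let tO : tame2 (\1_O : R * R -> R). Proof. exact: tame2_indic bO. Qed.
Let tB : tame2 (\1_B : R * R -> R). Proof. exact: tame2_indic bB. Qed.
Let ln0 : l != 0. Proof. by rewrite gt_eqF. Qed.

Let chi := dilate_ind O l.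
(** An upper bound for the difference between the indicators of l C and of l O. *)
Let rim y := dilate_ind B l y - dilate_ind O l y.
Let tchi : tame2 chi. Proof. exact: tame2_dilate. Qed.
Let trim : tame2 rim. Proof. by apply: tame2B; exact: tame2_dilate. Qed.

Lemma integ2_rim : integ2 rim = 0.
Proof.
rewrite /rim (integ2_affine 0 0 ln0 ln0 trim) /rim /dilate_ind /=.
have -> : (fun z : R * R => \1_B (l^-1 * (l * z.1 + 0), l^-1 * (l * z.2 + 0)) -
  \1_O (l^-1 * (l * z.1 + 0), l^-1 * (l * z.2 + 0))) = fun x => \1_B x - \1_O x :> R.
  by apply/funext => -[z1 z2] /=; rewrite !addr0 !mulKf.
by rewrite null mulr0.
Qed.

Lemma dilate_support (A : set (R * R)) y : A `<=` B -> dilate_ind A l y != 0 ->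
  `|y.1| <= M /\ `|y.2| <= M.
Proof.
move=> AB; rewrite /dilate_ind indicE; case: (boolP (_ \in A)) => [/set_mem/AB/bB|].
  move=> /= [h1 h2] _.
  have aux (x : R) : `|l^-1 * x| <= M -> `|x| <= M.
    rewrite normrM normfV (gtr0_norm l0) mulrC ler_pdivrMr// => /le_trans; apply.
    by rewrite ler_piMr//; exact: le_trans (normr_ge0 (l^-1 * y.1)) h1.
  by split; exact: aux.
by rewrite eqxx.
Qed.

Variables (V : R) (K : nat) (kappa : R).
Hypothesis ptsV : forall u, u \in pts -> `|u.1| <= V /\ `|u.2| <= V.
Hypothesis VK : V + M + 1 <= K%:R.

Let far u y : u \in pts -> `|y.1| <= M /\ `|y.2| <= M ->
  `|u.1 - y.1| + 1 <= K%:R /\ `|u.2 - y.2| + 1 <= K%:R.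
Proof.
move=> /ptsV[u1 u2] [y1 y2]; have := VK.
have := ler_normB u.1 y.1; have := ler_normB u.2 y.2.
move: (`|u.1 - y.1|) (`|u.2 - y.2|) (`|u.1|) (`|u.2|) (`|y.1|) (`|y.2|) u1 u2 y1 y2.
move=> *; split; lra.
Qed.

Definition discrepancy t : R :=
  \sum_(u <- pts) \sum_(m <- int_box K) chi (shift_int (u - t) m) - kappa.
Definition rim_count t : R :=
  \sum_(u <- pts) \sum_(m <- int_box K) rim (shift_int (u - t) m).
Definition windowed t : R := unit_ind t * discrepancy t.

Let sum_reflect F t : unit_ind t * (\sum_(u <- pts) \sum_(m <- int_box K) F (shift_int (u - t) m)) =
  \sum_(u <- pts) \sum_(m <- int_box K) unit_ind t * F (shift_int (u - t) m).
Proof. by rewrite mulr_sumr; apply: eq_bigr => u _; rewrite mulr_sumr. Qed.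

Let tame2_sum_reflect F : tame2 F -> tame2 (fun t =>
  \sum_(u <- pts) \sum_(m <- int_box K) unit_ind t * F (shift_int (u - t) m)).
Proof.
move=> tF; apply: tame2_sum => u; apply: tame2_sum => m.
by apply: tame2M; [exact: tame2_unit|exact: tame2_reflect].
Qed.

Lemma tame2_windowed : tame2 windowed.
Proof.
rewrite /windowed /discrepancy; under eq_fun do rewrite mulrBr sum_reflect mulrC.
by apply: tame2B; [exact: tame2_sum_reflect|apply: tame2Z; exact: tame2_unit].
Qed.

Lemma tame2_rim_count : tame2 (fun t => unit_ind t * rim_count t).
Proof. by rewrite /rim_count; under eq_fun do rewrite sum_reflect; exact: tame2_sum_reflect. Qed.

Lemma integ2_rim_count : integ2 (fun t => unit_ind t * rim_count t) = 0.
Proof.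
rewrite /rim_count; under eq_fun do rewrite sum_reflect.
have tm u m : tame2 (fun t => unit_ind t * rim (shift_int (u - t) m)).
  by apply: tame2M; [exact: tame2_unit|exact: tame2_reflect].
rewrite integ2_sum; last by move=> u; exact: tame2_sum.
rewrite big_seq big1// => u up; rewrite integ2_sum; last exact: tm.
rewrite (unfolding trim) ?integ2_rim// => y ry.
apply: far => //; have [cB|cB] := eqVneq (dilate_ind B l y) 0; last exact: dilate_support cB.
apply: (@dilate_support O) => //; first exact: subset_trans CB.
by move: ry; rewrite /rim cB sub0r oppr_eq0.
Qed.

Section modes.
Variable k : int * int.
Hypothesis k0 : k != 0.
Let th := dotp (freq R k).

Let th_shift u t m : exists n : int, th t = th u - th (shift_int (u - t) m) + 2 * pi * n%:~R.
Proof.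
exists (k.1 * m.1 + k.2 * m.2); rewrite /th dotp_shift.
have -> : dotp (freq R k) (u - t) = dotp (freq R k) u - dotp (freq R k) t.
  by rewrite /dotp /=; ring.
by ring.
Qed.

(** A trigonometric function of integer frequency is invariant under integer
shifts, so it can be moved inside the sum over the lattice and unfolded with the
indicator. The constant kappa disappears as k is not 0. *)
Let mode_sum (g : R -> R) : continuous g -> (forall x, `|g x| <= 1) ->
  (forall (a : R) (n : int), g (a + 2 * pi * n%:~R) = g a) ->
  integ2 (fun t => unit_ind t * g (th t)) = 0 ->
  integ2 (fun t => windowed t * g (th t)) =
  \sum_(u <- pts) integ2 (fun y => chi y * g (th u - th y)).
Proof.
move=> cg g1 gper g0.
have tg F : tame2 F -> tame2 (fun t => F t * g (th t)) by move=> tF; exact: tame2_trig.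
have tF u : tame2 (fun y => chi y * g (th u - th y)).
  have cg' : continuous (fun x => g (th u - x)).
    move=> x; apply: (@continuous_comp _ _ _ (fun x => th u - x) g); last exact: cg.
    exact: is_derive_continuous.
  by apply: (@tame2_trig _ _ _ (fun x => g (th u - x))).
have E t : windowed t * g (th t) = \sum_(u <- pts) \sum_(m <- int_box K)
    unit_ind t * ((fun y => chi y * g (th u - th y)) (shift_int (u - t) m)) -
    kappa * (unit_ind t * g (th t)).
  rewrite /windowed /discrepancy mulrBr sum_reflect mulrBl; congr (_ - _); last by ring.
  rewrite mulr_suml; apply: eq_bigr => u _; rewrite mulr_suml; apply: eq_bigr => m _.
  by have [n ->] := th_shift u t m; rewrite gper mulrA.
have tm u m : tame2 (fun t => unit_ind t *
    ((fun y => chi y * g (th u - th y)) (shift_int (u - t) m))).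
  by apply: tame2M; [exact: tame2_unit|exact: (tame2_reflect u m (tF u))].
have tu : tame2 (fun t => unit_ind t * g (th t)) by apply: tg; exact: tame2_unit.
under eq_fun do rewrite E.
rewrite integ2B; [|by apply: tame2_sum => u; exact: tame2_sum|exact: tame2Z].
rewrite integ2Z// g0 mulr0 subr0 integ2_sum; last by move=> u; exact: tame2_sum.
rewrite !big_seq; apply: eq_bigr => u up; rewrite integ2_sum; last exact: tm.
apply: (unfolding (tF u)) => y cy; apply: far => //; apply: (@dilate_support O).
  exact: subset_trans CB.
by apply: contra_neq cy => cy; rewrite /chi cy mul0r.
Qed.

Let A := fourier_cos O (freq R k) l.
Let S := fourier_sin O (freq R k) l.

Let tA : tame2 (fun y => chi y * cos (th y)). Proof. exact: tame2_cos. Qed.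
Let tS : tame2 (fun y => chi y * sin (th y)). Proof. exact: tame2_sin. Qed.

Lemma cos_mode_windowed : cos_mode windowed k =
  (\sum_(u <- pts) cos (th u)) * A + (\sum_(u <- pts) sin (th u)) * S.
Proof.
rewrite /cos_mode (mode_sum (@continuous_cos R) (@cos_max R) (@cosD_2pi_int R)).
  rewrite !mulr_suml -big_split; apply: eq_bigr => u _ /=.
  have -> : (fun y => chi y * cos (th u - th y)) =
    fun y => cos (th u) * (chi y * cos (th y)) + sin (th u) * (chi y * sin (th y)).
    by apply/funext => y; rewrite cosB; ring.
  by rewrite integ2D ?integ2Z//; exact: tame2Z.
by rewrite integ2_unit_cos (negbTE k0).
Qed.

Lemma sin_mode_windowed : sin_mode windowed k =
  (\sum_(u <- pts) sin (th u)) * A - (\sum_(u <- pts) cos (th u)) * S.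
Proof.
rewrite /sin_mode (mode_sum (@continuous_sin R) (@sin_max R) (@sinD_2pi_int R)).
  rewrite !mulr_suml -sumrB; apply: eq_bigr => u _ /=.
  have -> : (fun y => chi y * sin (th u - th y)) =
    fun y => sin (th u) * (chi y * cos (th y)) - cos (th u) * (chi y * sin (th y)).
    by apply/funext => y; rewrite sinB; ring.
  by rewrite integ2B ?integ2Z//; exact: tame2Z.
exact: integ2_unit_sin.
Qed.

(** The moduli of the coefficients multiply, as for complex exponentials. *)
Lemma mode_energy : cos_mode windowed k ^+ 2 + sin_mode windowed k ^+ 2 =
  structure_factor pts k * energy O (freq R k) l.
Proof.
rewrite cos_mode_windowed sin_mode_windowed /structure_factor /energy -/A -/S -/th.
by ring.
Qed.

End modes.

(** Bessel's inequality is the integral of d^2 >= 2 d g - g^2 for the trigonometric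
polynomial g of the discrepancy of O. The right-hand side is measurable, which
|d|^2 need not be, and replacing d by the discrepancy of O costs at most
2 |g| times the rim, whose integral is 0. *)
Lemma minorant (L : seq (int * int)) : uniq L -> 0 \notin L ->
  exists G : R * R -> R, [/\ tame2 (fun t => unit_ind t * G t),
    \sum_(k <- L) structure_factor pts k * energy O (freq R k) l <=
      integ2 (fun t => unit_ind t * G t) &
    forall t (d : R), `|d - discrepancy t| <= rim_count t -> G t <= d ^+ 2].
Proof.
move=> uL L0; have tw := tame2_windowed.
pose g := trig_sum windowed L; have [b b0 gb] := trig_sum_bounded windowed L.
exists (fun t => 2 * discrepancy t * g t - g t ^+ 2 - 2 * b * rim_count t).
have E : (fun t => unit_ind t * (2 * discrepancy t * g t - g t ^+ 2 - 2 * b * rim_count t)) =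
  fun t => (2 * (windowed t * g t) - unit_ind t * g t ^+ 2) - 2 * b * (unit_ind t * rim_count t).
  by apply/funext => t; rewrite /windowed; ring.
have t1 : tame2 (fun t => 2 * (windowed t * g t)) by apply: tame2Z; exact: tame2_trig_sum.
have t2 : tame2 (fun t => unit_ind t * g t ^+ 2).
  under eq_fun do rewrite expr2 mulrA.
  by do 2 apply: tame2_trig_sum; exact: tame2_unit.
have t3 : tame2 (fun t => 2 * b * (unit_ind t * rim_count t)).
  by apply: tame2Z; exact: tame2_rim_count.
split.
- by rewrite E; apply: tame2B => //; exact: tame2B.
- rewrite E integ2B//; last exact: tame2B.
  rewrite integ2B// integ2Z; last exact: tame2_trig_sum.
  rewrite integ2Z; last exact: tame2_rim_count.
  rewrite integ2_rim_count mulr0 subr0 integ2_trig_sum//.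
  have := integ2_unit_trig_sum2 tw uL; rewrite -/g.
  have -> : \sum_(k <- L) structure_factor pts k * energy O (freq R k) l =
     \sum_(k <- L) (cos_mode windowed k ^+ 2 + sin_mode windowed k ^+ 2).
    rewrite !big_seq; apply: eq_bigr => k kL; rewrite mode_energy//.
    by apply: contraNneq L0 => <-.
  by move: (\sum_(_ <- _) _) (integ2 _) => *; lra.
- move=> t d dr; have xb : `|g t| <= b := gb t.
  move: (g t) (discrepancy t) (rim_count t) xb dr => x D r xb dr.
  have h1 : `|(d - D) * x| <= r * b by rewrite normrM; exact: ler_pM.
  have h2 := sqr_ge0 (d - x).
  have h3 : - (r * b) <= (d - D) * x by move: h1; rewrite ler_norml => /andP[].
  have -> : d ^+ 2 = (d - x) ^+ 2 + 2 * D * x + 2 * ((d - D) * x) - x ^+ 2 by ring.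
  have -> : 2 * b * r = 2 * (r * b) by ring.
  by move: ((d - D) * x) ((d - x) ^+ 2) (r * b) (2 * D * x) (x ^+ 2) h2 h3 => *; lra.
Qed.

End torus_energy.

(** * The discrepancy integral over the torus *)

Local Open Scope quotient_scope.

Section torus_lower.
Variable R : realType.
Implicit Types (k m : int * int) (t u v y : R * R).

Lemma le_torus_integral (G : R * R -> R) (f : torus R -> \bar R) :
  tame2 (fun t => unit_ind t * G t) ->
  (forall t, 0 <= f (\pi_(torus R) t))%E ->
  (forall t, unit_square t -> (G t)%:E <= f (\pi_(torus R) t))%E ->
  ((integ2 (fun t => unit_ind t * G t))%:E <= torus_integral f)%E.
Proof.
move=> tG f0 Gf; rewrite /torus_integral integ2E//.
have mQ : measurable (@unit_square R) by apply: measurableX; exact: measurable_itv.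
have E t : unit_ind t * G t = (G \_ (@unit_square R)) t.
  rewrite patchE /unit_ind !indicE /unit_square.
  have -> : (t \in `[0, 1[ `*` `[0, 1[) = (t.1 \in `[0, 1[%classic) && (t.2 \in `[0, 1[%classic).
    by apply/idP/andP; rewrite !inE.
  by case: (t.1 \in _) => /=; case: (t.2 \in _); rewrite /= ?mul1r ?mul0r.
have -> : (\int[lebesgue2 R]_z (unit_ind z * G z)%:E =
  \int[lebesgue2 R]_(z in @unit_square R) (G z)%:E)%E.
  rewrite [RHS]integral_mkcond; apply: eq_integral => z _.
  by rewrite E !patchE; case: ifP.
apply: le_integral_integrable => //.
rewrite integrable_mkcond//; have := tame2_integrable tG.
congr (integrable _ _ _); apply/funext => z.
by rewrite /= E !patchE; case: ifP.
Qed.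

Lemma dilate_indicE (C : set (R * R)) (l : R) y : 0 < l ->
  \1_(dilate l C) y = dilate_ind C l y :> R.
Proof.
move=> l0; have ln0 : l != 0 by rewrite gt_eqF.
rewrite /dilate_ind !indicE; congr (_%:R); congr nat_of_bool.
apply/idP/idP; rewrite !inE.
  by move=> [[z1 z2] Cz <-] /=; rewrite !mulKf.
move=> Cy; exists (l^-1 * y.1, l^-1 * y.2) => //.
by case: y {Cy} => y1 y2; congr pair; rewrite /= /GRing.scale/= mulVKf.
Qed.

Lemma torus_energy_lower (C O B : set (R * R)) (M l kappa : R)
    (P : {fset torus R}) (L : seq (int * int)) :
  measurable O -> measurable B -> O `<=` C -> C `<=` B -> planar_bounded B M ->
  integ2 (fun x => \1_B x - \1_O x) = 0 :> R -> 0 < l -> l <= 1 ->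
  uniq L -> 0 \notin L ->
  ((\sum_(k <- L) structure_factor [seq repr p | p <- P] k * energy O (freq R k) l)%:E <=
   torus_integral (fun t : torus R =>
     (`|card_translate P (dilate l C) t - kappa| ^+ 2)%:E))%E.
Proof.
move=> mO mB OC CB bB null l0 l1 uL L0; set pts := [seq _ | _ <- _].
pose V : R := \sum_(u <- pts) (`|u.1| + `|u.2|).
have ptsV u : u \in pts -> `|u.1| <= V /\ `|u.2| <= V.
  move=> up; have := @ler_sum_mem R _ pts (fun u => `|u.1| + `|u.2|) u.
  move=> /(_ (fun u => addr_ge0 (normr_ge0 _) (normr_ge0 _)) up) h.
  by split; apply: le_trans h; rewrite ?lerDl ?lerDr.
pose K := (Num.truncn (Num.max 0 (V + M + 1))).+1.
have VK : V + M + 1 <= K%:R.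
  have h : 0 <= Num.max 0 (V + M + 1) by rewrite le_max lexx.
  have /andP[_ h'] := truncn_itv h; apply: le_trans (ltW h').
  by rewrite le_max lexx orbT.
have [G [tG HG GD]] :=
  minorant mO mB OC CB bB null l0 l1 kappa ptsV VK uL L0.
apply: (@le_trans _ _ (integ2 (fun t => unit_ind t * G t))%:E); first by rewrite lee_fin.
apply: le_torus_integral => // t tQ.
rewrite lee_fin real_normK ?num_real//; apply: GD.
rewrite (card_translateE _ _ _ (@reprK _ (torus R))).
pose F y : R := \1_(dilate l C) y.
have FB y : F y != 0 -> `|y.1| <= M /\ `|y.2| <= M.
  by rewrite /F dilate_indicE//; apply: (dilate_support bB l0 l1 CB).
have -> : \sum_(p <- P) \sum_(k \in [set: int * int])
      (\1_(dilate l C) (repr p - t + (k.1%:~R, k.2%:~R)) : R) =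
   \sum_(u <- pts) \sum_(m <- int_box K) F (shift_int (u - t) m).
  rewrite big_map !big_seq; apply: eq_bigr => p pP.
  have up : repr p \in pts by apply: map_f.
  rewrite (fsbigE (int_box K)) ?uniq_int_box//.
    by apply: eq_big => k; rewrite ?in_setT.
  move=> k _; apply: contraNeq => Fk; rewrite mem_int_box.
  have [y1 y2] := FB _ Fk; have [u1 u2] := ptsV _ up.
  move: tQ => [/=]; rewrite !in_itv/= => /andP[a1 a2] /andP[b1 b2].
  rewrite -!(ler_int R) !intr_norm -[(Posz K)%:~R]pmulrn.
  move: y1 y2 VK u1 u2; rewrite /= !ler_norml.
  move: (repr p).1 (repr p).2 => r1 r2.
  move: (k.1%:~R) (k.2%:~R) (K%:R) (V) => z1 z2 q w; move: a1 a2 b1 b2.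
  move: t.1 t.2 => t1 t2 *; lra.
have E (a b c : R) : a - c - (b - c) = a - b by ring.
rewrite /discrepancy /rim_count E -sumrB.
rewrite (le_trans (ler_norm_sum _ _ _))//; apply: ler_sum => u _.
rewrite -sumrB (le_trans (ler_norm_sum _ _ _))//; apply: ler_sum => m _.
rewrite /F dilate_indicE// /dilate_ind !indicE.
set z := (_, _); have [zO|zO] := boolP (z \in O).
  have zC : z \in C by rewrite inE; apply: OC; rewrite -inE.
  have zB : z \in B by rewrite inE; apply: CB; rewrite -inE.
  by rewrite zC zB subrr normr0.
have [zC|zC] := boolP (z \in C); last by rewrite subrr normr0 subr0.
have zB : z \in B by rewrite inE; apply: CB; rewrite -inE.
by rewrite zB /= !subr0 normr1.
Qed.

(** Take s halfway between a / b and 1. *)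
Lemma eq_of_scaled_le (a b : R) : 0 <= a -> a <= b ->
  (forall s, 0 < s < 1 -> s ^+ 2 * b <= a) -> a = b.
Proof.
move=> a0 ab H; apply/eqP; rewrite eq_le ab /= leNgt; apply/negP => ltab.
have b0 : 0 < b by exact: le_lt_trans ltab.
pose s := (a + b) / (2 * b).
have s0 : 0 < s by rewrite divr_gt0 ?mulr_gt0// ltr_wpDl.
have s1 : s < 1 by rewrite ltr_pdivrMr ?mulr_gt0//; lra.
have /H : 0 < s < 1 by rewrite s0.
have -> : s ^+ 2 * b = (a + b) ^+ 2 / (4 * b) by rewrite /s; field; rewrite gt_eqF.
rewrite ler_pdivrMr ?mulr_gt0//; have : 0 < (b - a) ^+ 2 by rewrite exprn_gt0// subr_gt0.
by nra.
Qed.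

(** The contraction of ratio s towards z maps B into O, so s^2 |B| <= |O| for
every s < 1. *)
Lemma null_rim (O B : set (R * R)) (M : R) (z : R * R) :
  measurable O -> measurable B -> O `<=` B -> planar_bounded B M ->
  (forall x s, B x -> 0 < s < 1 ->
     O (s * x.1 + (1 - s) * z.1, s * x.2 + (1 - s) * z.2)) ->
  integ2 (fun x => \1_B x - \1_O x) = 0 :> R.
Proof.
move=> mO mB OB bB star.
have tB : tame2 (\1_B : R * R -> R) by exact: tame2_indic bB.
have tO : tame2 (\1_O : R * R -> R) by apply: (@tame2_indic _ _ M) => // x /OB/bB.
rewrite integ2B//; apply/eqP; rewrite subr_eq0 eq_sym; apply/eqP.
apply: eq_of_scaled_le; first exact: integ2_ge0.
  apply: le_integ2 => // x; rewrite !indicE ler_nat.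
  by have [xO|//] := boolP (x \in O); rewrite mem_set//; apply: OB; exact: set_mem.
move=> s s01; have /andP[s0 s1] := s01; have sn0 : s != 0 by rewrite gt_eqF.
rewrite (integ2_affine ((1 - s) * z.1) ((1 - s) * z.2) sn0 sn0 tO).
rewrite gtr0_norm// -expr2; apply: ler_wpM2l; first exact: sqr_ge0.
apply: le_integ2 => //; first exact: tame2_affine.
move=> x; rewrite !indicE ler_nat.
by have [xB|//] := boolP (x \in B); rewrite mem_set//; apply: star => //; exact: set_mem.
Qed.

End torus_lower.

(** * Interior and closure of a convex body *)

Section convex_bodies.
Variable R : realType.
Implicit Types (x y z : R * R) (C : set (R * R)).

Lemma interior_planarP C x : interior C x <->
  exists2 r : R, 0 < r & forall y, `|y.1 - x.1| < r -> `|y.2 - x.2| < r -> C y.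
Proof.
split=> [/nbhs_ballP[r /= r0 rC]|[r r0 rC]].
  exists r => // y y1 y2; apply: rC; split; rewrite -ball_normE /= distrC//.
apply/nbhs_ballP; exists r => //= y [y1 y2].
by apply: rC; rewrite distrC; [move: y1|move: y2]; rewrite -ball_normE.
Qed.

Lemma closure_planarP C x : closure C x <->
  forall r : R, 0 < r -> exists y, [/\ C y, `|y.1 - x.1| < r & `|y.2 - x.2| < r].
Proof.
split=> [clC r r0|H V /nbhs_ballP[r /= r0 rV]].
  have [y [Cy [y1 y2]]] := clC _ (nbhsx_ballx x r r0).
  by exists y; split=> //; rewrite distrC; [move: y1|move: y2]; rewrite -ball_normE.
have [y [Cy y1 y2]] := H r r0; exists y; split=> //.
by apply: rV; split; rewrite -ball_normE /= distrC.
Qed.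

Lemma convex_set_planar C : convex_set C -> planar_convex C.
Proof.
move=> cC x y t Cx Cy /andP[t0 t1].
have u0 : 0 <= 1 - t by rewrite subr_ge0.
have u1 : 1 - t <= 1 by rewrite lerBlDr lerDl.
have := cC x y (Itv01 u0 u1); rewrite !inE => /(_ Cx Cy).
congr (C _).
by rewrite /conv /= /unstable.onem subKr.
Qed.

Lemma bounded_set_planar C : bounded_set C -> exists M : R, planar_bounded C M.
Proof.
move=> [M [_ MC]]; exists (M + 1) => x Cx.
have := MC (M + 1) (ltr_pwDr ltr01 (lexx M)) x Cx.
by rewrite /= prod_normE /= ge_max => /andP.
Qed.

Lemma planar_bounded_closure C (M : R) : planar_bounded C M -> planar_bounded (closure C) M.
Proof.
move=> bC x /closure_planarP clx; split; apply/ler_addgt0Pr => e e0;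
  have [y [/bC[h1 h2] y1 y2]] := clx e e0.
  have := ler_normD (x.1 - y.1) y.1; rewrite subrK distrC; move: y1 h1.
  by move: (`|y.1 - x.1|) => *; lra.
have := ler_normD (x.2 - y.2) y.2; rewrite subrK distrC; move: y2 h2.
by move: (`|y.2 - x.2|) => *; lra.
Qed.

Lemma planar_bounded_interior C (M : R) :
  planar_bounded (closure C) M -> planar_bounded (interior C) M.
Proof. by move=> bC x /interior_subset Cx; apply: bC; exact: subset_closure. Qed.

Lemma planar_open_interior C : planar_open (interior C).
Proof.
move=> x /interior_planarP[r r0 rC]; exists (r / 2); first by rewrite divr_gt0.
move=> y y1 y2; apply/interior_planarP; exists (r / 2); first by rewrite divr_gt0.
move=> w w1 w2; apply: rC.
  have := ler_normD (w.1 - y.1) (y.1 - x.1); rewrite addrA subrK.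
  by move: (`|w.1 - y.1|) (`|y.1 - x.1|) w1 y1 => *; lra.
have := ler_normD (w.2 - y.2) (y.2 - x.2); rewrite addrA subrK.
by move: (`|w.2 - y.2|) (`|y.2 - x.2|) w2 y2 => *; lra.
Qed.

(** A point of C close to x and a point of the box around z average to any point
close to the average of x and z. *)
Lemma star_closure C x z (s : R) : planar_convex C -> closure C x -> interior C z ->
  0 <= s < 1 -> interior C (s * x.1 + (1 - s) * z.1, s * x.2 + (1 - s) * z.2).
Proof.
move=> cC /closure_planarP clx /interior_planarP[r r0 rC] /andP[s0 s1].
have t0 : 0 < 1 - s by lra.
pose d := (1 - s) * r / 2; have d0 : 0 < d by rewrite /d !mulr_gt0.
have [x' [Cx' x1 x2]] := clx d d0.
apply/interior_planarP; exists d => // p /= p1 p2.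
pose w : R * R := ((p.1 - s * x'.1) / (1 - s), (p.2 - s * x'.2) / (1 - s)).
have tn0 : 1 - s != 0 by rewrite gt_eqF.
have aux (a b c e : R) : `|a - (s * b + (1 - s) * c)| < d -> `|e - b| < d ->
    `|(a - s * e) / (1 - s) - c| < r.
  move=> h1 h2; have -> : (a - s * e) / (1 - s) - c =
     ((a - (s * b + (1 - s) * c)) - s * (e - b)) / (1 - s) by field.
  rewrite normrM normfV (gtr0_norm t0) ltr_pdivrMr// (le_lt_trans (ler_normB _ _))//.
  rewrite normrM (ger0_norm s0).
  have : s * `|e - b| <= `|e - b| by rewrite ler_piMl// ltW.
  by move: h1 h2; rewrite /d; set A := `|_ - (_ + _)|; set B := `|e - b|; move=> *; nra.
have Cw : C w by apply: rC; rewrite /w /=; [exact: aux p1 x1|exact: aux p2 x2].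
have := cC x' w (1 - s) Cx' Cw; rewrite /w /= !mulrA.
have -> : 0 <= 1 - s <= 1 by rewrite ltW//=; lra.
move=> /(_ isT); congr (C _); case: p {p1 p2 w Cw} => p1 p2 /=.
by congr pair; field.
Qed.

Lemma planar_convex_interior C : planar_convex C -> planar_convex (interior C).
Proof.
move=> cC x y t Ox Oy /andP[t0 t1].
have [->|tn1] := eqVneq t 1; first by rewrite subrr !mul0r !mul1r !add0r; case: y Oy.
rewrite [_ * x.1 + _]addrC [_ * x.2 + _]addrC; apply: star_closure => //.
  exact: (subset_closure (interior_subset Oy)).
by rewrite t0 lt_neqAle tn1.
Qed.

Lemma closure_planar_measurable C : measurable (closure C).
Proof.
rewrite -[closure C]setCK; apply: measurableC; apply: planar_open_measurable.
move=> x; have := @closed_closure _ C; rewrite -openC openE => /(_ x) h /h.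
by move=> /interior_planarP.
Qed.

Section body.
Variable C : set (R * R).
Hypothesis bodyC : convex_body C.

Lemma body_convex : planar_convex C.
Proof. by case: bodyC => /convex_set_planar. Qed.

Lemma body_bounded : exists M : R, planar_bounded (closure C) M.
Proof.
by case: bodyC => _ /bounded_set_planar[M bC] _; exists M; exact: planar_bounded_closure.
Qed.

Lemma body_null_boundary : integ2 (fun x => \1_(closure C) x - \1_(interior C) x) = 0 :> R.
Proof.
have [M bC] := body_bounded; case: bodyC => _ _ [z Oz].
apply: (null_rim (z := z) _ _ _ bC).
- by apply: planar_open_measurable; exact: planar_open_interior.
- exact: closure_planar_measurable.
- by move=> x /interior_subset Cx; exact: subset_closure.
- move=> x s clx /andP[s0 s1]; apply: star_closure => //; first exact: body_convex.
  by rewrite ltW.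
Qed.

End body.
End convex_bodies.

(** * Caps at a curved arc *)

Section caps.
Variable R : realType.
Variables (O B : set (R * R)) (M : R) (x y dx dy : R -> R) (a b K : R).
Hypotheses (oO : planar_open O) (cO : planar_convex O) (bO : planar_bounded O M).
Hypothesis bB : planar_bounded B M.
Hypothesis starO : forall p z (s : R), B p -> O z -> 0 <= s < 1 ->
  O (s * p.1 + (1 - s) * z.1, s * p.2 + (1 - s) * z.2).
Hypothesis arcB : forall s, a <= s <= b -> B (x s, y s) /\ ~ O (x s, y s).
Hypothesis unit_speed : forall s, a <= s <= b -> dx s ^+ 2 + dy s ^+ 2 = 1.
Hypothesis K0 : 0 < K.
Hypothesis taylor_x : forall s v, a <= s <= b -> a <= s + v <= b ->
  `|x (s + v) - x s - v * dx s| <= K * v ^+ 2.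
Hypothesis taylor_y : forall s v, a <= s <= b -> a <= s + v <= b ->
  `|y (s + v) - y s - v * dy s| <= K * v ^+ 2.

(** With g = (x, y): if z = g(s) + A g'(s) were in O, then g(s) would lie
strictly between the boundary point g(s - A d) and a point of O close to z, for d
small, hence in O. *)
Lemma tangent_avoids s z : a < s < b -> O z ->
  dx s * (z.2 - y s) != dy s * (z.1 - x s).
Proof.
move=> /andP[sa sb] Oz; apply/eqP => det0; have [r r0 zO] := oO Oz.
have sI : a <= s <= b by rewrite !ltW.
have u1 := unit_speed sI.
pose A := dx s * (z.1 - x s) + dy s * (z.2 - y s).
have z1 : z.1 = x s + A * dx s.
  have -> : z.1 = x s + (dx s ^+ 2 + dy s ^+ 2) * (z.1 - x s) by rewrite u1; ring.
  congr (_ + _); rewrite mulrDl !expr2 -!mulrA -det0 /A; ring.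
have z2 : z.2 = y s + A * dy s.
  have -> : z.2 = y s + (dx s ^+ 2 + dy s ^+ 2) * (z.2 - y s) by rewrite u1; ring.
  congr (_ + _); rewrite mulrDl !expr2 -!mulrA det0 /A; ring.
pose m := Num.min (Num.min (s - a) (b - s)) r.
have m0 : 0 < m by rewrite !lt_min !subr_gt0 sa sb.
have [ma mb mr] : [/\ m <= s - a, m <= b - s & m <= r].
  by rewrite /m; split; rewrite !ge_min lexx ?orbT.
pose D := `|A| + K * A ^+ 2 + 1.
have KA : 0 <= K * A ^+ 2 by rewrite mulr_ge0 ?sqr_ge0// ltW.
have D0 : 0 < D by rewrite /D; have := normr_ge0 A; move: KA => *; lra.
(* d is the weight given to the point of O; D makes the step A d stay inside the
   arc and the error K A^2 d smaller than r *)
pose d := m / D; have d0 : 0 < d by rewrite divr_gt0.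
have vm : `|A * d| <= m.
  rewrite normrM (gtr0_norm d0) /d mulrCA ler_piMr ?(ltW m0)// ler_pdivrMr// mul1r /D.
  by rewrite -addrA lerDl addr_ge0.
have Kd : K * A ^+ 2 * d < r.
  apply: lt_le_trans mr; rewrite /d mulrCA gtr_pMr// ltr_pdivrMr// mul1r /D.
  by have := normr_ge0 A; move: KA => *; lra.
have vI : a <= s + - (A * d) <= b.
  have := ler_norm (A * d); have := ler_norm (- (A * d)); rewrite normrN => h1 h2.
  by move: vm ma mb h1 h2; move: (`|_|) => *; apply/andP; split; lra.
have [Bq _] := arcB vI.
have hx := taylor_x sI vI; have hy := taylor_y sI vI.
set Rx := x (s + _) - _ - _ in hx; set Ry := y (s + _) - _ - _ in hy.
have small (r1 : R) : `|r1| <= K * (- (A * d)) ^+ 2 -> `|r1 / d| < r.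
  move=> h; apply: le_lt_trans Kd.
  rewrite normrM normfV (gtr0_norm d0) ler_pdivrMr//.
  by apply: (le_trans h); rewrite sqrrN exprMn; rewrite le_eqVlt; apply/predU1P; left; ring.
have Op : O (z.1 - Rx / d, z.2 - Ry / d).
  by apply: zO => /=; rewrite addrAC subrr add0r normrN; exact: small.
have dn : 1 + d != 0 by rewrite gt_eqF// addr_gt0.
have s01 : 0 <= (1 + d)^-1 < 1.
  by rewrite invr_ge0 invf_lt1 ?addr_gt0//; apply/andP; split; lra.
have := starO Bq Op s01; case: (arcB sI) => _; apply: contra_not.
have dn0 : d != 0 by rewrite gt_eqF.
rewrite /= /Rx /Ry z1 z2; congr (O (_, _)); field; exact/andP.
Qed.

Let slope s := - dx s / dy s.

(** By [tangent_avoids] the linear form whose kernel is the tangent direction does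
not take on O its value at g(s), so it stays on one side of it by convexity. *)
Lemma tangent_support s : a < s < b -> dy s != 0 -> O !=set0 ->
  exists e : R, e ^+ 2 = 1 /\ support O e (slope s) = e * (x s + slope s * y s).
Proof.
move=> sI dy0 [z0 Oz0].
pose h (z : R * R) := (z.1 - x s) + slope s * (z.2 - y s).
have hn0 z : O z -> h z != 0.
  move=> /(tangent_avoids sI); apply: contra => /eqP hz.
  have -> : z.1 - x s = - slope s * (z.2 - y s) by move: hz; rewrite /h; lra.
  by rewrite /slope; apply/eqP; field.
pose e := Num.sg (h z0).
have e1 : e ^+ 2 = 1.
  by rewrite /e sqr_sg hn0.
have e0 : 0 < e * h z0 by rewrite -normrEsg normr_gt0 hn0.
have pos z : O z -> 0 < e * h z.
  move=> Oz; rewrite ltNge; apply/negP => ez.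
  have hd : 0 < e * h z0 - e * h z by lra.
  pose t := e * h z0 / (e * h z0 - e * h z).
  have t01 : 0 <= t <= 1.
    rewrite divr_ge0 ?(ltW e0) ?(ltW hd)//= ler_pdivrMr// mul1r; lra.
  have /hn0 := cO Oz0 Oz t01.
  have -> : h ((1 - t) * z0.1 + t * z.1, (1 - t) * z0.2 + t * z.2) =
      (1 - t) * h z0 + t * h z by rewrite /h /=; ring.
  have en0 : e != 0 by apply: contraTneq e0 => ->; rewrite mul0r ltxx.
  rewrite -(inj_eq (mulfI en0)) mulr0 => /negP; apply; apply/eqP.
  have -> : e * ((1 - t) * h z0 + t * h z) = e * h z0 - t * (e * h z0 - e * h z) by ring.
  by rewrite /t divfK ?subrr// gt_eqF.
exists e; split=> //.
have hE z : height e (slope s) z = e * (x s + slope s * y s) + e * h z.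
  by rewrite /height /h; ring.
have nO : O !=set0 by exists z0.
apply/eqP; rewrite eq_le; apply/andP; split; last first.
  apply: lb_le_inf; first by exists (height e (slope s) z0), z0.
  by move=> _ [z Oz <-]; rewrite hE lerDl ltW// pos.
apply/ler_addgt0Pr => d d0.
pose t := Num.min 1 (d / (e * h z0)).
have t0 : 0 < t by rewrite lt_min ltr01 divr_gt0.
have t1 : t <= 1 by rewrite ge_min lexx.
have td : t * (e * h z0) <= d by rewrite -ler_pdivlMr// ge_min lexx orbT.
have /andP[/ltW sa /ltW sb] := sI.
have [Bs _] : B (x s, y s) /\ ~ O (x s, y s) by apply: arcB; rewrite sa.
have t01 : 0 <= 1 - t < 1 by apply/andP; split; lra.
have Op := starO Bs Oz0 t01.
apply: (@le_trans _ _ (height e (slope s) ((1 - t) * x s + (1 - (1 - t)) * z0.1,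
  (1 - t) * y s + (1 - (1 - t)) * z0.2))).
  apply: ge_inf; last by exists ((1 - t) * x s + (1 - (1 - t)) * z0.1,
    (1 - t) * y s + (1 - (1 - t)) * z0.2).
  by case: (heights_has_inf (slope s) bO e1 nO).
rewrite hE lerD2l (le_trans _ td)// /h /=.
by rewrite le_eqVlt; apply/predU1P; left; ring.
Qed.

(** The boundary point g(s + w) has depth at most E w^2. Moving it towards the
centre p of a fixed box of O, until the depth is exactly t = 2 E w^2, displaces
it by O(w^2) and brings it into O. *)
Lemma chord_end s w r p e (E t : R) : a < s < b -> a <= s + w <= b -> dy s != 0 -> 0 < r ->
  (forall z, `|z.1 - p.1| < r -> `|z.2 - p.2| < r -> O z) ->
  e ^+ 2 = 1 -> support O e (slope s) = e * (x s + slope s * y s) ->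
  K * (1 + `|slope s|) <= E -> t = 2 * E * w ^+ 2 -> 0 < t <= r / 4 ->
  exists2 v, slice O e (slope s) (support O e (slope s) + t) v &
    `|v - (y s + w * dy s)| <= (K + 24 * M * E / r) * w ^+ 2.
Proof.
move=> sI wI dy0 r0 pO e1 supE KE tE /andP[t0 tr].
have Op : O p by apply: pO; rewrite subrr normr0.
have nO : O !=set0 by exists p.
have /andP[/ltW sa /ltW sb] := sI.
have sI' : a <= s <= b by rewrite sa.
have [Bq _] := arcB wI.
have hx := taylor_x sI' wI; have hy := taylor_y sI' wI.
pose q : R * R := (x (s + w), y (s + w)).
pose dep z := height e (slope s) z - support O e (slope s).
have depE (z z' : R * R) (l : R) : dep (l * z.1 + (1 - l) * z'.1, l * z.2 + (1 - l) * z'.2) =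
   l * dep z + (1 - l) * dep z' by rewrite /dep /height /=; ring.
have w20 : 0 <= w ^+ 2 by exact: sqr_ge0.
have dq : `|dep q| <= E * w ^+ 2.
  apply: le_trans (_ : K * (1 + `|slope s|) * w ^+ 2 <= _); last exact: ler_wpM2r.
  have -> : dep q = e * ((x (s + w) - x s - w * dx s) + slope s * (y (s + w) - y s - w * dy s)).
    by rewrite /dep supE /height /q /slope /=; field.
  rewrite normrM (norm_sign e1) mul1r (le_trans (ler_normD _ _))// normrM.
  have -> : K * (1 + `|slope s|) * w ^+ 2 = K * w ^+ 2 + `|slope s| * (K * w ^+ 2) by ring.
  by apply: lerD => //; apply: ler_wpM2l.
have dp : r / 2 <= dep p.
  have Op' : O (p.1 - e * (r / 2), p.2).
    apply: pO => /=; last by rewrite subrr normr0.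
    by rewrite addrAC subrr add0r normrN normrM (norm_sign e1) mul1r gtr0_norm; lra.
  have := height_gt_support (slope s) oO bO e1 nO Op'.
  have -> : height e (slope s) (p.1 - e * (r / 2), p.2) =
     height e (slope s) p - e ^+ 2 * (r / 2) by rewrite /height /=; ring.
  by rewrite e1 /dep; lra.
have E0 : 0 <= E * w ^+ 2 by move: t0; rewrite tE; lra.
have Er : E * w ^+ 2 <= r / 8 by move: tr; rewrite tE; lra.
have tE' : t = 2 * (E * w ^+ 2) by rewrite tE; ring.
have /andP[dq1 dq2] : - (E * w ^+ 2) <= dep q <= E * w ^+ 2 by rewrite -ler_norml.
have den : r / 4 <= dep p - dep q by lra.
have den0 : 0 < dep p - dep q by lra.
(* the barycentre of q and p with this coefficient has depth exactly t *)
pose th := (t - dep q) / (dep p - dep q).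
have th0 : 0 < th by rewrite /th divr_gt0//; lra.
have th1 : th <= 1 by rewrite /th ler_pdivrMr// mul1r; lra.
have thE : th <= 12 * (E * w ^+ 2) / r.
  rewrite /th ler_pdivrMr// mulrAC ler_pdivlMr//.
  have : 12 * (E * w ^+ 2) * (r / 4) <= 12 * (E * w ^+ 2) * (dep p - dep q).
    by rewrite ler_wpM2l// mulr_ge0.
  have : (t - dep q) * r <= (3 * (E * w ^+ 2)) * r by rewrite ler_pM2r//; lra.
  have -> : 12 * (E * w ^+ 2) * (r / 4) = 3 * (E * w ^+ 2) * r by field.
  exact: le_trans.
have s01 : 0 <= 1 - th < 1 by apply/andP; split; lra.
have Oz := starO Bq Op s01; set z := (_, _) in Oz.
exists z.2.
  apply/(sliceP _ _ e1); exists z => //; split=> //.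
  have : dep z = (1 - th) * dep q + (1 - (1 - th)) * dep p by rewrite -depE.
  have -> : (1 - th) * dep q + (1 - (1 - th)) * dep p = dep q + th * (dep p - dep q) by ring.
  by rewrite /th divfK ?gt_eqF// [dep z]/dep; lra.
have -> : z.2 - (y s + w * dy s) = (y (s + w) - y s - w * dy s) + th * (p.2 - y (s + w)).
  by rewrite /z /=; ring.
apply: (le_trans (ler_normD _ _)).
have -> : (K + 24 * M * E / r) * w ^+ 2 = K * w ^+ 2 + 12 * (E * w ^+ 2) / r * (2 * M).
  by field; rewrite gt_eqF.
apply: lerD => //; rewrite normrM (gtr0_norm th0).
apply: ler_pM => //; first exact: ltW.
have [_ b1] := bO Op; have [_ b2] := bB Bq.
by rewrite (le_trans (ler_normB _ _))// mulr2n mulrDl mul1r lerD.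
Qed.

(** [chord_end] with w and - w gives two points of the section at depth t whose
second coordinates differ by 2 w |dy s| - O(w^2), where w is of order sqrt t. *)
Lemma cap_section s1 s2 y0 r p : a < s1 -> s2 < b -> 0 < y0 -> 0 < r ->
  (forall s, s1 <= s <= s2 -> y0 <= `|dy s|) ->
  (forall z, `|z.1 - p.1| < r -> `|z.2 - p.2| < r -> O z) ->
  exists k t0 : R, [/\ 0 < k, 0 < t0 & forall s, s1 <= s <= s2 ->
    exists2 e : R, e ^+ 2 = 1 & forall t, 0 < t <= t0 ->
      k * t <= section_length O e (- dx s / dy s)
                 (support O e (- dx s / dy s) + t) ^+ 2].
Proof.
move=> as1 s2b y00 r0 dyy pO.
have Op : O p by apply: pO; rewrite subrr normr0.
have nO : O !=set0 by exists p.
have M0 : 0 <= M by apply: bound_ge0 bO nO.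
pose E := K * (1 + y0^-1).
have E0 : 0 < E by rewrite mulr_gt0// addr_gt0 ?invr_gt0.
pose A := K + 24 * M * E / r.
have A0 : 0 < A.
  rewrite /A ltr_pwDl// divr_ge0 ?(ltW r0)// mulr_ge0 ?(ltW E0)// mulr_ge0//.
pose m := Num.min (s1 - a) (b - s2).
have m0 : 0 < m by rewrite lt_min !subr_gt0 as1.
(* below v0 the points of parameters s - v and s + v are on the arc, and the
   error terms leave half of the length of the chord *)
pose v0 := Num.min m (y0 / (2 * A)).
have v00 : 0 < v0 by rewrite lt_min m0 divr_gt0// mulr_gt0.
pose t0 := Num.min (2 * E * v0 ^+ 2) (r / 4).
exists (y0 ^+ 2 / (2 * E)), t0; split.
- by rewrite divr_gt0 ?exprn_gt0// mulr_gt0.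
- by rewrite lt_min pmulr_rgt0 ?exprn_gt0 ?divr_gt0// mulr_gt0.
move=> s /andP[ss1 ss2]; have dys := dyy s (introT andP (conj ss1 ss2)).
have sI : a < s < b by rewrite (lt_le_trans as1)//= (le_lt_trans ss2).
have sI' : a <= s <= b by rewrite !ltW//; case/andP: sI.
have dyn0 : dy s != 0 by rewrite -normr_gt0 (lt_le_trans y00).
have [e [e1 supE]] := tangent_support sI dyn0 nO.
exists e => // t /andP[t_0 tt0].
have slope_le : `|slope s| <= y0^-1.
  rewrite /slope normrM normrN normfV -[y0^-1]mul1r ler_pM ?invr_ge0//.
    rewrite -(@ler_pXn2r _ 2) ?nnegrE// expr1n real_normK ?num_real//.
    by rewrite -(unit_speed sI') lerDl sqr_ge0.
  by rewrite lef_pV2 ?posrE// ?normr_gt0.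
have KE : K * (1 + `|slope s|) <= E by rewrite /E ler_pM2l// lerD2l.
have E2 : 0 < 2 * E by rewrite mulr_gt0.
pose v := Num.sqrt (t / (2 * E)).
have v20 : v ^+ 2 = t / (2 * E) by rewrite sqr_sqrtr// divr_ge0 ?ltW.
have tE : t = 2 * E * v ^+ 2 by rewrite v20; field; rewrite gt_eqF.
have v_0 : 0 < v by rewrite sqrtr_gt0 divr_gt0.
have vv0 : v <= v0.
  rewrite -(@ler_pXn2r _ 2) ?nnegrE ?(ltW v_0) ?(ltW v00)// v20 ler_pdivrMr// mulrC.
  by apply: (le_trans tt0); rewrite ge_min lexx.
have tr : 0 < t <= r / 4 by rewrite t_0 (le_trans tt0)// ge_min lexx orbT.
have vm : v <= m by rewrite (le_trans vv0)// ge_min lexx.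
have vA : 2 * A * v <= y0.
  have : v <= y0 / (2 * A) by rewrite (le_trans vv0)// ge_min lexx orbT.
  by rewrite ler_pdivlMr ?mulr_gt0// mulrC.
have [ma mb] : m <= s1 - a /\ m <= b - s2 by rewrite /m !ge_min !lexx orbT.
have pI : a <= s + v <= b by move: v_0 => *; apply/andP; split; lra.
have nI : a <= s + - v <= b by move: v_0 => *; apply/andP; split; lra.
have [q Sq hq] := chord_end sI pI dyn0 r0 pO e1 supE KE tE tr.
have tE' : t = 2 * E * (- v) ^+ 2 by rewrite sqrrN.
have [q' Sq' hq'] := chord_end sI nI dyn0 r0 pO e1 supE KE tE' tr.
rewrite sqrrN in hq'.
have mO := planar_open_measurable oO.
have tS : tame (\1_(slice O e (slope s) (support O e (slope s) + t)) : R -> R).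
  exact: (slice_tame (slope s) oO bO e1).
have cS := @slice_convex _ O e (slope s) cO (support O e (slope s) + t).
have len := length_ge cS tS Sq' Sq.
rewrite -section_lengthE in len.
have lv : v * y0 <= section_length O e (slope s) (support O e (slope s) + t).
  apply: le_trans len.
  have h1 : 2 * v * `|dy s| = `|(y s + v * dy s) - (y s + - v * dy s)|.
    have -> : (y s + v * dy s) - (y s + - v * dy s) = 2 * v * dy s by ring.
    by rewrite normrM (gtr0_norm (mulr_gt0 (ltr0n _ 2) v_0)).
  have h2 : `|(y s + v * dy s) - (y s + - v * dy s)| <=
      `|q - q'| + (`|q - (y s + v * dy s)| + `|q' - (y s + - v * dy s)|).
    have -> : (y s + v * dy s) - (y s + - v * dy s) =
      (q - q') + (- (q - (y s + v * dy s)) + (q' - (y s + - v * dy s))) by ring.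
    rewrite (le_trans (ler_normD _ _))// lerD2l (le_trans (ler_normD _ _))//.
    by rewrite normrN.
  have h3 : v * y0 <= v * `|dy s| by rewrite ler_pM2l.
  have h4 : 2 * A * v * v <= y0 * v by rewrite ler_pM2r.
  rewrite -h1 in h2; move: h2 h3 h4 hq hq'; rewrite -/A expr2.
  move: (`|q - q'|) (`|q - _|) (`|q' - _|) (`|dy s|) => c1 c2 c3 c4 *; nra.
have -> : y0 ^+ 2 / (2 * E) * t = (v * y0) ^+ 2.
  by rewrite tE; field; rewrite gt_eqF.
have vy0 : 0 <= v * y0 by rewrite mulr_ge0 ?ltW.
by apply: lerXn2r; rewrite ?nnegrE//; exact: le_trans lv.
Qed.

End caps.

(** * Cones of directions with large caps *)

Section curvature.
Variable R : realType.
Implicit Types (f g : R -> R).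

Lemma near_radius (P : R -> Prop) (s : R) : (\forall u \near s, P u) ->
  exists2 r : R, 0 < r & forall u, `|u - s| <= r -> P u.
Proof.
move=> /nbhs_ballP[r /= r0 rP]; exists (r / 2); first by rewrite divr_gt0.
move=> u us; apply: rP; rewrite -ball_normE /= distrC (le_lt_trans us)//.
by move: r0 => *; lra.
Qed.

Lemma continuous_ge_half f (s : R) : continuous f -> f s != 0 ->
  exists2 r : R, 0 < r & forall u, `|u - s| <= r -> `|f s| / 2 <= `|f u|.
Proof.
move=> cf fs0; apply: near_radius.
have f0 : 0 < `|f s| / 2 by rewrite divr_gt0 ?normr_gt0.
near=> u.
have : `|f s - f u| <= `|f s| / 2 by near: u; exact: cvgr_dist_le (cf s) _ f0.
have := ler_normD (f s - f u) (f u); rewrite subrK.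
move: (`|f s - f u|) (`|f s|) (`|f u|) => A D E *; lra.
Unshelve. all: by end_near.
Qed.

Lemma mean_value_sym f df (p q : R) : (forall s : R, is_derive s 1 f (df s)) ->
  exists2 c, Num.min p q <= c <= Num.max p q & f q - f p = df c * (q - p).
Proof.
move=> fdf; have [pq|qp] := leP p q.
  by have [c cI cE] := mean_value fdf pq; exists c.
have [c cI cE] := mean_value fdf (ltW qp).
by exists c => //; rewrite -opprB cE; ring.
Qed.

(** Taylor's formula by two applications of the mean value theorem. *)
Lemma taylor_bound f df ddf (a b : R) : (forall s : R, is_derive s 1 f (df s)) ->
  (forall s : R, is_derive s 1 df (ddf s)) -> continuous ddf -> a <= b ->
  exists2 K, 0 < K & forall s v, a <= s <= b -> a <= s + v <= b ->
    `|f (s + v) - f s - v * df s| <= K * v ^+ 2.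
Proof.
move=> fdf dfddf cddf ab.
have cn : {within `[a, b], continuous (fun s => `|ddf s|)}.
  apply: continuous_subspaceT => s.
  by apply: continuous_comp; [exact: cddf|exact: norm_continuous].
have [m _ mK] := EVT_max ab cn.
exists (`|ddf m| + 1); first by rewrite ltr_wpDl.
move=> s v sI vI.
have [c cI cE] := mean_value_sym s (s + v) fdf.
have [d dI dE] := mean_value_sym s c dfddf.
have cin : a <= c <= b.
  by move: cI sI vI; rewrite ge_min le_max => /andP[/orP[|] ? /orP[|] ?] /andP[? ?] /andP[? ?];
    apply/andP; split; lra.
have din : d \in `[a, b].
  rewrite in_itv/=; move: dI sI cin; rewrite ge_min le_max.
  by move=> /andP[/orP[|] ? /orP[|] ?] /andP[? ?] /andP[? ?]; apply/andP; split; lra.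
have -> : f (s + v) - f s - v * df s = ddf d * (c - s) * v by rewrite cE -dE; ring.
rewrite !normrM -[v ^+ 2]real_normK ?num_real// expr2 mulrA.
apply: ler_wpM2r => //; apply: ler_pM => //.
  by rewrite (le_trans (mK _ din))// lerDl.
move: cI; rewrite ge_min le_max ler_norml.
have [v0|v0] := leP 0 v; [rewrite (ger0_norm v0)|rewrite (ltr0_norm v0)];
  by move=> /andP[/orP[|] ? /orP[|] ?]; apply/andP; split; lra.
Qed.

(** The derivative stays away from 0 in a neighbourhood. *)
Lemma nonzero_derivative_moves f df (s : R) : (forall s : R, is_derive s 1 f (df s)) ->
  continuous df -> df s != 0 ->
  exists2 r : R, 0 < r & forall h, 0 < h <= r -> f (s + h) != f s.
Proof.
move=> fdf cdf dfs; have [r r0 rP] := continuous_ge_half cdf dfs.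
exists r => // h /andP[h0 hr].
have sh : s <= s + h by rewrite lerDl ltW.
have [c /andP[c1 c2] cE] := mean_value fdf sh.
rewrite -subr_eq0 cE mulf_neq0//; last by rewrite addrAC subrr add0r gt_eqF.
rewrite -normr_gt0 (lt_le_trans _ (rP _ _)) ?divr_gt0 ?normr_gt0//.
by rewrite ger0_norm; lra.
Qed.

(** Where the boundary is curved the chord of a cap is of the order of the square root
of its depth; squaring avoids the root. *)
Definition cap_growth (O : set (R * R)) (s0 s1 : R) : Prop :=
  exists k t0 : R, [/\ 0 < k, 0 < t0 & forall s, s0 <= s <= s1 ->
    exists2 e : R, e ^+ 2 = 1 & forall t, 0 < t <= t0 ->
      k * t <= section_length O e s (support O e s + t) ^+ 2].

Section arc.
Variables (O B : set (R * R)) (M : R) (x dx ddx y dy ddy : R -> R) (a b : R).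
Hypotheses (oO : planar_open O) (cO : planar_convex O) (bO : planar_bounded O M).
Hypothesis nO : O !=set0.
Hypothesis bB : planar_bounded B M.
Hypothesis starO : forall p z (s : R), B p -> O z -> 0 <= s < 1 ->
  O (s * p.1 + (1 - s) * z.1, s * p.2 + (1 - s) * z.2).
Hypothesis arcB : forall s, a <= s <= b -> B (x s, y s) /\ ~ O (x s, y s).
Hypothesis unit_speed : forall s, a <= s <= b -> dx s ^+ 2 + dy s ^+ 2 = 1.
Hypotheses (xdx : forall s : R, is_derive s 1 x (dx s))
  (dxddx : forall s : R, is_derive s 1 dx (ddx s)) (cddx : continuous ddx).
Hypotheses (ydy : forall s : R, is_derive s 1 y (dy s))
  (dyddy : forall s : R, is_derive s 1 dy (ddy s)) (cddy : continuous ddy).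

(** This is half of the derivative of the squared speed; a nonzero value would make
the speed change to the right of s. *)
Lemma curvature_orthogonal s : a < s < b -> dx s * ddx s + dy s * ddy s = 0.
Proof.
move=> /andP[sa sb]; apply/eqP; apply: contraT => n0.
pose F u := dx u ^+ 2 + dy u ^+ 2; pose F' u := 2 * (dx u * ddx u + dy u * ddy u).
have FF' (u : R) : is_derive u 1 F (F' u).
  have h1 := dxddx u; have h2 := dyddy u.
  by apply: is_derive_eq; rewrite /F' /GRing.scale/=; ring.
have cF' : continuous F'.
  have c1 := is_derive_continuous dxddx; have c2 := is_derive_continuous dyddy.
  move=> u; apply: cvgM; first exact: cvg_cst.
  by apply: cvgD; apply: cvgM; [exact: c1|exact: cddx|exact: c2|exact: cddy].
have F'n0 : F' s != 0 by rewrite mulf_neq0// pnatr_eq0.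
have [r r0 rP] := nonzero_derivative_moves FF' cF' F'n0.
pose h := Num.min r (b - s).
have h0 : 0 < h by rewrite lt_min r0 subr_gt0.
have hr : h <= r by rewrite ge_min lexx.
have hb : h <= b - s by rewrite ge_min lexx orbT.
have := rP h; rewrite h0 hr => /(_ isT); rewrite /F !unit_speed ?eqxx//; apply/andP; split; lra.
Qed.

(** A vector orthogonal to the unit tangent and not zero is not parallel to it, so
the direction of the tangent moves near sc; its slope - x' / y' then takes
all the values of an interval, and [cap_section] applies to each of them. *)
Lemma curved_cap sc : a < sc < b -> dy sc != 0 -> ~ (ddx sc = 0 /\ ddy sc = 0) ->
  exists s0 s1 : R, s0 < s1 /\ cap_growth O s0 s1.
Proof.
move=> scI dyn0 flat; have curved : (ddx sc != 0) || (ddy sc != 0).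
  by apply: contraT; rewrite negb_or !negbK => /andP[/eqP x0 /eqP y0]; case: flat.
have /andP[sca scb] := scI.
have scI' : a <= sc <= b by rewrite !ltW.
have ab : a <= b by rewrite ltW// (lt_trans sca).
have orth := curvature_orthogonal scI.
pose F u := dx u * dy sc - dy u * dx sc; pose F' u := ddx u * dy sc - ddy u * dx sc.
have FF' (u : R) : is_derive u 1 F (F' u).
  have h1 := dxddx u; have h2 := dyddy u.
  by apply: is_derive_eq; rewrite /F' /GRing.scale/=; ring.
have cF' : continuous F'.
  move=> u; apply: cvgB; apply: cvgM; do ?[exact: cvg_cst].
    exact: cddx.
  exact: cddy.
have F'n0 : F' sc != 0.
  apply: contraTneq curved; rewrite /F' negb_or !negbK => d0.
  have u1 := unit_speed scI'.
  (* coordinates of the second derivative in the orthonormal frame formed by the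
     tangent and the normal *)
  have E1 : ddx sc = dy sc * (ddx sc * dy sc - ddy sc * dx sc) +
     dx sc * (dx sc * ddx sc + dy sc * ddy sc).
    by rewrite -[LHS]mul1r -u1; ring.
  have E2 : ddy sc = - dx sc * (ddx sc * dy sc - ddy sc * dx sc) +
     dy sc * (dx sc * ddx sc + dy sc * ddy sc).
    by rewrite -[LHS]mul1r -u1; ring.
  by move: E1 E2; rewrite d0 orth !mulr0 addr0 => -> ->; rewrite eqxx.
have [r r0 rP] := nonzero_derivative_moves FF' cF' F'n0.
have cdy := is_derive_continuous dyddy; have cdx := is_derive_continuous dxddx.
have [r' r'0 r'P] := continuous_ge_half cdy dyn0.
pose h := Num.min (Num.min r r') ((b - sc) / 2).
have h0 : 0 < h by rewrite !lt_min r0 r'0 divr_gt0// subr_gt0.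
have [hr hr' hb] : [/\ h <= r, h <= r' & h <= (b - sc) / 2].
  by rewrite /h !ge_min !lexx ?orbT.
have y00 : 0 < `|dy sc| / 2 by rewrite divr_gt0 ?normr_gt0.
have dyy u : sc <= u <= sc + h -> `|dy sc| / 2 <= `|dy u|.
  by move=> /andP[u1 u2]; apply: r'P; rewrite ger0_norm; lra.
have dyn u : sc <= u <= sc + h -> dy u != 0.
  by move=> /dyy uy; rewrite -normr_gt0 (lt_le_trans y00).
have [Kx Kx0 KxP] := taylor_bound xdx dxddx cddx ab.
have [Ky Ky0 KyP] := taylor_bound ydy dyddy cddy ab.
pose K := Num.max Kx Ky.
have K0 : 0 < K by rewrite lt_max Kx0.
have KxP' s v : a <= s <= b -> a <= s + v <= b -> `|x (s + v) - x s - v * dx s| <= K * v ^+ 2.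
  by move=> sI vI; rewrite (le_trans (KxP _ _ sI vI))// ler_wpM2r ?sqr_ge0// le_max lexx.
have KyP' s v : a <= s <= b -> a <= s + v <= b -> `|y (s + v) - y s - v * dy s| <= K * v ^+ 2.
  by move=> sI vI; rewrite (le_trans (KyP _ _ sI vI))// ler_wpM2r ?sqr_ge0// le_max lexx orbT.
have [p Op] := nO; have [d d0 dO] := oO Op.
have shb : sc + h < b by lra.
have [k [t0 [k0 t00 capP]]] := cap_section oO cO bO bB starO arcB unit_speed K0 KxP' KyP'
  sca shb y00 d0 dyy dO.
pose slope u := - dx u / dy u.
have moved : slope (sc + h) != slope sc.
  have hI : sc <= sc + h <= sc + h by rewrite lexx lerDl ltW.
  have := rP h; rewrite h0 hr => /(_ isT); apply: contra => /eqP.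
  rewrite /slope => /eqP; rewrite eqr_div ?dyn// ?lexx ?lerDl ?(ltW h0)// => /eqP E.
  by rewrite /F; apply/eqP; move: E => *; lra.
have cslope : {within `[sc, sc + h], continuous slope}.
  apply: continuous_in_subspaceT => u; rewrite inE/= in_itv/= => uI.
  apply: cvgM; first by apply: cvgN; exact: cdx.
  by apply: cvgV; [exact: dyn|exact: cdy].
exists (Num.min (slope sc) (slope (sc + h))), (Num.max (slope sc) (slope (sc + h))).
split.
  by rewrite lt_max !gt_min !ltxx/= orbF -neq_lt.
exists k, t0; split=> // s sI.
have sh : sc <= sc + h by rewrite lerDl ltW.
have [u uI <-] := IVT sh cslope sI.
by apply: capP; move: uI; rewrite in_itv.
Qed.

End arc.
End curvature.

(** * Curved arcs of a boundary that is not polygonal *)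

Section nonpolygon.
Variable R : realType.

Lemma C2_is_derive (f : R -> R) : C2 f ->
  [/\ forall s : R, is_derive s 1 f (derive1 f s),
      forall s : R, is_derive s 1 (derive1 f) (derive1n 2 f s) & continuous (derive1n 2 f)].
Proof.
move=> [d1 d2 c2]; split; last exact: c2.
  by move=> s; rewrite derive1E; apply: derivableP; exact: d1.
by move=> s; rewrite /derive1n /= derive1E; apply: derivableP; exact: d2.
Qed.

(** The one-sided values at a and b are not assumed to vanish, hence the use of the
mean value theorem with an interior point. *)
Lemma affine_of_zero_curvature (f df ddf : R -> R) (a b : R) :
  (forall s : R, is_derive s 1 f (df s)) -> (forall s : R, is_derive s 1 df (ddf s)) ->
  (forall s, a < s < b -> ddf s = 0) ->
  forall s, a <= s <= b -> f s = f a + (s - a) * df a.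
Proof.
move=> fdf dfddf z s /andP[]; rewrite le_eqVlt => /predU1P[<-|sa] sb.
  by rewrite subrr mul0r addr0.
have [c cI cE] := MVT sa (fun u _ => fdf u)
  (continuous_subspaceT (is_derive_continuous fdf)).
move: cI; rewrite in_itv/= => /andP[ac cs].
have [d dI dE] := MVT ac (fun u _ => dfddf u)
  (continuous_subspaceT (is_derive_continuous dfddf)).
move: dI; rewrite in_itv/= => /andP[ad dc].
have dc0 : df c = df a.
  by apply/eqP; rewrite -subr_eq0 dE z ?mul0r// ad (lt_le_trans dc)// (le_trans (ltW cs)).
by rewrite -dc0 mulrC -cE addrC subrK.
Qed.

Lemma segmentP (p q z : R * R) : segment p q z <-> exists2 t : R, 0 <= t <= 1 &
  z = ((1 - t) * p.1 + t * q.1, (1 - t) * p.2 + t * q.2).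
Proof.
split=> [[t _ <-]|[t /andP[t0 t1] ->]].
  exists (1 - t%:num); first by rewrite subr_ge0 gerBl ge0 le1.
  by rewrite /conv /= /unstable.onem subKr.
have u0 : 0 <= 1 - t by rewrite subr_ge0.
have u1 : 1 - t <= 1 by rewrite lerBlDr lerDl.
by exists (Itv01 u0 u1) => //; rewrite /conv /= /unstable.onem subKr.
Qed.

Lemma partition_cover (a t : R) (s : seq R) : s != [::] -> a <= t <= last a s ->
  exists2 i, (i < size s)%N & (a :: s)`_i <= t <= s`_i.
Proof.
elim: s a => // b s IH a _ /= /andP[ta tl].
have [tb|bt] := leP t b; first by exists 0%N; rewrite //= ta.
have s0 : s != [::].
  by apply: contraTneq tl => -> /=; rewrite -ltNge.
have [|i iI H] := IH b s0; first by rewrite (ltW bt).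
by exists i.+1.
Qed.

(** Otherwise every arc is the segment between its end points, and the boundary is
the closed polygonal chain of these points. *)
Lemma curved_arc (C : set (R * R)) : ~ polygon C -> piecewise_C2_boundary C ->
  exists (a b c : R) (x y : R -> R), [/\ C2 x, C2 y, a < c < b,
    forall s, a <= s <= b -> boundary C (x s, y s) /\ derive1 x s ^+ 2 + derive1 y s ^+ 2 = 1 &
    ~ (derive1n 2 x c = 0 /\ derive1n 2 y c = 0)].
Proof.
move=> nP [L [g [s [part _ gL img arcs]]]]; apply: contrapT => none; apply: nP.
have [s0|s0] := eqVneq s [::].
  move: part img; rewrite s0 => /itv_partition_nil <- img.
  exists [:: g 0]; rewrite -img; apply/seteqP; split=> p /=.
    move=> [t]; rewrite /= in_itv/= => /andP[t1 t2] <-; exists 0%N => //=.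
    have -> : t = 0 by apply/eqP; rewrite eq_le t1 t2.
    apply/segmentP; exists 0; first by rewrite lexx ler01.
    by rewrite subr0 !mul1r !mul0r !addr0; case: (g 0).
  move=> [[|//] _ /= /segmentP[t t01 ->]]; exists 0; first by rewrite in_itv/= lexx.
  by rewrite -!mulrDl subrK !mul1r; case: (g 0).
have lastL : last 0 s = L by case: part => _ /eqP.
have pge i : (i < size s)%N -> 0 <= (0 :: s)`_i.
  move=> si; have si' : (i < size (0%R :: s))%N by exact: leqW.
  rewrite (set_nth_default L 0 si'); exact: (itv_partition_nth_ge si' part).
have ple i : (i < size s)%N -> s`_i <= L.
  move=> si; rewrite (set_nth_default L 0 si).
  have si' : (i.+1 < size (0%R :: s))%N by [].
  exact: (itv_partition_nth_le si' part).
pose v := [seq g t | t <- belast 0 s].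
have sv : size v = size s by rewrite size_map size_belast.
have v1 i : (i < size s)%N -> v`_i = g (0 :: s)`_i.
  move=> si; rewrite (nth_map 0) ?size_belast//.
  by rewrite lastI nth_rcons size_belast si.
have v2 i : (i < size s)%N -> (rot 1 v)`_i = g s`_i.
  move=> si; have -> : rot 1 v = [seq g t | t <- s].
    rewrite /v; move: gL; rewrite -lastL; case: (s) s0 => // s1 s' _ gL.
    by rewrite /= rot1_cons -gL -map_rcons /= -lastI.
  by rewrite (nth_map 0).
exists v; rewrite sv -img.
have piece i : (i < size s)%N ->
    segment (g (0 :: s)`_i) (g s`_i) = g @` `[(0 :: s)`_i, s`_i].
  move=> si; have [x [y [Cx Cy gE]]] := arcs i si.
  have ab : (0 :: s)`_i < s`_i by case: part => /(pathP 0) /(_ i si).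
  have ab' := ltW ab.
  have inner c : (0 :: s)`_i < c < s`_i -> derive1n 2 x c = 0 /\ derive1n 2 y c = 0.
    move=> cI; apply: contrapT => n0; apply: none.
    exists (0 :: s)`_i, s`_i, c, x, y; split=> //.
      move=> u uI; have uI' : u \in `[(0 :: s)`_i, s`_i] by rewrite in_itv.
      have [gu ->] := gE u uI'; split=> //.
      rewrite -gu -img; exists u => //=; rewrite in_itv/=.
      have /andP[u1 u2] := uI; apply/andP; split.
        by apply: le_trans u1; exact: pge.
      by apply: (le_trans u2); exact: ple.
  have [xd xdd _] := C2_is_derive Cx; have [yd ydd _] := C2_is_derive Cy.
  have xE := affine_of_zero_curvature xd xdd (fun u uI => (inner u uI).1).
  have yE := affine_of_zero_curvature yd ydd (fun u uI => (inner u uI).2).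
  have aI : (0 :: s)`_i <= (0 :: s)`_i <= s`_i by rewrite lexx ab'.
  have bI : (0 :: s)`_i <= s`_i <= s`_i by rewrite lexx ab'.
  have gI u : (0 :: s)`_i <= u <= s`_i -> g u = (x u, y u).
    by move=> uI; have [] := gE u uI.
  have ba0 : 0 < s`_i - (0 :: s)`_i by rewrite subr_gt0.
  have ban : s`_i - (0 :: s)`_i != 0 by rewrite gt_eqF.
  rewrite (gI _ aI) (gI _ bI); apply/seteqP; split=> p.
    move=> /segmentP[t /andP[t0 t1] ->] /=.
    pose u := (0 :: s)`_i + t * (s`_i - (0 :: s)`_i).
    have uI : (0 :: s)`_i <= u <= s`_i.
      rewrite /u lerDl mulr_ge0 ?(ltW ba0)//=.
      by rewrite -lerBrDl ler_piMl// ltW.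
    exists u; first by rewrite in_itv.
    rewrite (gI _ uI) (xE _ uI) (yE _ uI) (xE _ bI) (yE _ bI).
    by congr pair; rewrite /u; ring.
  move=> [u /=]; rewrite in_itv/= => uI <-; apply/segmentP.
  exists ((u - (0 :: s)`_i) / (s`_i - (0 :: s)`_i)).
    rewrite divr_ge0 ?(ltW ba0) ?ler_pdivrMr ?mul1r ?lerD2r//; first by case/andP: uI.
    by case/andP: uI => u1 _; rewrite subr_ge0.
  rewrite (gI _ uI) (xE _ uI) (yE _ uI) (xE _ bI) (yE _ bI) /=.
  by congr pair; field.
apply/seteqP; split=> p /=.
  rewrite -lastL => -[t tI <-]; move: tI; rewrite in_itv/= => /(partition_cover s0)[i si tI].
  by exists i => //; rewrite v1// v2// piece//; exists t => //=; rewrite in_itv.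
move=> [i si]; rewrite v1// v2// piece// => -[u /=]; rewrite in_itv/= => /andP[u1 u2] <-.
exists u => //; rewrite in_itv/=; apply/andP; split.
  by apply: le_trans u1; exact: pge.
by apply: (le_trans u2); exact: ple.
Qed.

End nonpolygon.

(** * Exchange of the coordinates *)

Section transposition.
Variable R : realType.
Implicit Types (xi x : R * R) (O A : set (R * R)) (k : int * int) (pts : seq (R * R)).

Definition transpose T (z : T * T) : T * T := (z.2, z.1).

(** The slope of a line or of a frequency is a quotient by one of the coordinates;
when it vanishes the coordinates are exchanged. *)
Definition transposed A : set (R * R) := [set z | A (transpose z)].

Lemma transposeK T : involutive (@transpose T).
Proof. by case. Qed.

Lemma transpose_eq0 k : (transpose k == 0) = (k == 0).
Proof. by case: k => a b; rewrite !xpair_eqE andbC. Qed.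

Lemma transposed_open O : planar_open O -> planar_open (transposed O).
Proof.
move=> oO x /oO[r r0 rO]; exists r => // y y1 y2; exact: rO.
Qed.

Lemma transposed_convex O : planar_convex O -> planar_convex (transposed O).
Proof. by move=> cO x y t Ox Oy t01; exact: cO Ox Oy t01. Qed.

Lemma transposed_bounded O (M : R) : planar_bounded O M -> planar_bounded (transposed O) M.
Proof. by move=> bO x /bO[]. Qed.

Lemma transposed_nonempty O : O !=set0 -> transposed O !=set0.
Proof. by move=> [z Oz]; exists (transpose z); rewrite /transposed /= transposeK. Qed.

Lemma energy_transpose O xi (l : R) : tame2 (\1_O : R * R -> R) -> l != 0 ->
  energy (transposed O) (transpose xi) l = energy O xi l.
Proof.
move=> tO l0; have bcos t : `|cos t : R| <= 1 by rewrite ler_norml cos_geN1 cos_le1.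
have bsin t : `|sin t : R| <= 1 by rewrite ler_norml sin_geN1 sin_le1.
have ccos : continuous (cos : R -> R) by exact: continuous_cos.
have csin : continuous (sin : R -> R) by exact: continuous_sin.
have tE (g : R -> R) : continuous g -> (forall t, `|g t| <= 1) ->
    integ2 (fun x => dilate_ind (transposed O) l x * g (dotp (transpose xi) x)) =
    integ2 (fun x => dilate_ind O l x * g (dotp xi x)).
  move=> cg bg; rewrite [RHS]integ2_swap; last exact: tame2_dilate_trig.
  congr integ2; apply/funext => x; congr (_ * g _).
  by rewrite /dotp /transpose /=; ring.
by rewrite /energy /fourier_cos /fourier_sin !tE.
Qed.

Lemma window_energy_transpose O xi : tame2 (\1_O : R * R -> R) ->
  (fun l => \1_`]0, 1] l * energy (transposed O) (transpose xi) l) =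
  (fun l => \1_`]0, 1] l * energy O xi l).
Proof.
move=> tO; apply/funext => l; rewrite indicE.
have [/set_mem/=|_] := boolP (l \in _); last by rewrite !mul0r.
rewrite in_itv/= => /andP[l0 _]; rewrite energy_transpose//.
by rewrite gt_eqF.
Qed.

Lemma weight_transpose O xi : tame2 (\1_O : R * R -> R) ->
  weight (transposed O) (transpose xi) = weight O xi.
Proof.
by move=> tO; exact: (congr1 (@integ R) (window_energy_transpose xi tO)).
Qed.

Lemma freq_transpose k : freq R (transpose k) = transpose (freq R k).
Proof. by []. Qed.

Lemma structure_factor_transpose pts k :
  structure_factor (map (@transpose _) pts) k = structure_factor pts (transpose k).
Proof.
rewrite /structure_factor !big_map.
by congr (_ ^+ 2 + _ ^+ 2); apply: eq_bigr => u _; congr (_ _);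
  rewrite freq_transpose /dotp /transpose /=; ring.
Qed.

Lemma tame_freq_energy O k : tame2 (\1_O : R * R -> R) -> k != 0 ->
  tame (fun l => \1_`]0, 1] l * energy O (freq R k) l).
Proof.
move=> tO k0; have pi2 : 2 * pi != 0 :> R by rewrite mulf_neq0 ?gt_eqF ?pi_gt0.
have [k10|k10] := eqVneq k.1 0; last first.
  apply: (@tame_window_energy _ _ _ 1 0) => //; last by rewrite expr1n.
  by rewrite /freq /= mulf_neq0// intr_eq0.
rewrite -window_energy_transpose//.
apply: (@tame_window_energy _ _ _ 1 0); last by rewrite expr1n.
  exact: (tame2_swap tO).
rewrite /freq /= mulf_neq0// intr_eq0; apply: contra k0 => /eqP k20.
by case: k k10 k20 => a b /= -> ->.
Qed.

Lemma norm_freq1 k : k.1 != 0 -> `|(freq R k).1| = 2 * pi * `|k.1%:~R| /\ 1 <= `|(freq R k).1|.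
Proof.
move=> k0; have pi2 : 1 <= 2 * pi :> R by have := pi_ge2 R; lra.
have E : `|(freq R k).1| = 2 * pi * `|k.1%:~R| :> R.
  by rewrite /freq /= normrM ger0_norm//; lra.
split=> //; rewrite E; apply: mulr_ege1 => //; apply: norm_intr_ge1; first exact: intr_int.
by rewrite intr_eq0.
Qed.

Section lower.
Variables (O : set (R * R)) (M : R).
Hypotheses (oO : planar_open O) (cO : planar_convex O) (bO : planar_bounded O M).
Hypothesis nO : O !=set0.

Let tO : tame2 (\1_O : R * R -> R).
Proof. exact: tame2_indic (planar_open_measurable oO) bO. Qed.

(** [weight_generic_lower] for the larger of the two coordinates, used as a
denominator after an exchange if necessary. *)
Lemma weight_all_frequencies : exists2 c : R, 0 < c & forall k, k != 0 ->
  c / (Num.max `|k.1%:~R| `|k.2%:~R|) ^+ 4 <= weight O (freq R k).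
Proof.
have [c1 c10 H1] := weight_generic_lower oO cO bO nO ler01.
have [c2 c20 H2] := weight_generic_lower (transposed_open oO) (transposed_convex cO)
  (transposed_bounded bO) (transposed_nonempty nO) ler01.
have pi20 : 0 < 2 * pi :> R by rewrite mulr_gt0 ?pi_gt0.
exists (Num.min c1 c2 / (2 * pi) ^+ 4).
  by rewrite divr_gt0 ?exprn_gt0// lt_min c10.
have main (A : set (R * R)) (c : R) k :
    (forall xi, 1 <= `|xi.1| -> `|xi.2| <= 1 * `|xi.1| -> c / `|xi.1| ^+ 4 <= weight A xi) ->
    Num.min c1 c2 <= c -> k != 0 -> `|k.2%:~R| <= `|k.1%:~R| :> R ->
    Num.min c1 c2 / (2 * pi) ^+ 4 / `|k.1%:~R| ^+ 4 <= weight A (freq R k).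
  move=> H cc k0 k21; have k10 : k.1 != 0.
    apply: contra k0 => /eqP k10; move: k21; rewrite k10 normr0 normr_le0 intr_eq0.
    by case: k k10 => a b /= -> /eqP ->.
  have [E F] := norm_freq1 k10; have := H (freq R k) F.
  have -> : `|(freq R k).2| <= 1 * `|(freq R k).1|.
    by rewrite mul1r /freq /= !normrM ler_wpM2l.
  move=> /(_ isT); apply: le_trans.
  rewrite E (exprMn 4 (2 * pi)) (invfM (_ ^+ 4)) [leRHS]mulrA.
  rewrite ler_pM2r; last by rewrite invr_gt0 exprn_gt0// normr_gt0 intr_eq0.
  by rewrite ler_pM2r// invr_gt0 exprn_gt0.
move=> k k0; have [k21|k12] := leP `|k.2%:~R : R| `|k.1%:~R|.
  by apply: (main _ c1 k H1) => //; rewrite ge_min lexx.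
rewrite -(weight_transpose _ tO) -freq_transpose.
apply: (main _ c2 (transpose k) H2); last exact: ltW.
  by rewrite ge_min lexx orbT.
by rewrite transpose_eq0.
Qed.

Lemma weight_cone (s0 s1 : R) : cap_growth O s0 s1 -> exists2 c : R, 0 < c &
  forall k, k.1 != 0 -> s0 <= k.2%:~R / k.1%:~R <= s1 ->
  c / `|k.1%:~R| ^+ 3 <= weight O (freq R k).
Proof.
move=> [k0 [t0 [k00 t00 cap]]].
pose S := Num.max `|s0| `|s1|.
have S0 : 0 <= S by rewrite le_max normr_ge0.
have [c c0 H] := weight_cap_lower oO cO bO nO S0 k00 t00.
have pi20 : 0 < 2 * pi :> R by rewrite mulr_gt0 ?pi_gt0.
exists (c / (2 * pi) ^+ 3); first by rewrite divr_gt0 ?exprn_gt0.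
move=> k kn0 sI; have [E F] := norm_freq1 kn0.
have k1R : k.1%:~R != 0 :> R by rewrite intr_eq0.
have slopeE : (freq R k).2 / (freq R k).1 = k.2%:~R / k.1%:~R.
  by rewrite /freq /= -mulf_div divff ?mul1r// gt_eqF.
have [e e1 capk] := cap _ sI.
have -> : c / (2 * pi) ^+ 3 / `|k.1%:~R| ^+ 3 = c / `|(freq R k).1| ^+ 3.
  by rewrite E (exprMn 3 (2 * pi)) (invfM (_ ^+ 3)) [RHS]mulrA.
apply: (H _ e) => //; last by rewrite slopeE.
have f0 : (freq R k).1 != 0 by rewrite -normr_gt0 (lt_le_trans ltr01).
rewrite -ler_pdivrMr ?normr_gt0// -normf_div slopeE ler_norml.
have /andP[h1 h2] := sI; apply/andP; split.
  rewrite (le_trans _ h1)// lerNl (le_trans (ler_norm _))// normrN.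
  by rewrite /S le_max lexx.
by rewrite (le_trans h2)// (le_trans (ler_norm _))// /S le_max lexx orbT.
Qed.

End lower.
End transposition.

(** * The discrepancy of a convex body *)

Section discrepancy.
Variable R : realType.
Implicit Types (C O : set (R * R)) (pts : seq (R * R)).

(** At the curved point one of the coordinates of the tangent vector is not 0. *)
Lemma body_cap C : convex_body C -> ~ polygon C -> piecewise_C2_boundary C ->
  exists s0 s1 : R, s0 < s1 /\
    (cap_growth (interior C) s0 s1 \/ cap_growth (transposed (interior C)) s0 s1).
Proof.
move=> bodyC nP /(curved_arc nP)[a [b [c [x [y [C2x C2y cI arc curved]]]]]].
have [M bB] := body_bounded bodyC; have cC := body_convex bodyC.
have bO := planar_bounded_interior bB.
have nO : interior C !=set0 by case: bodyC.
have oO := @planar_open_interior _ C; have cO := planar_convex_interior cC.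
have star p z (s : R) : closure C p -> interior C z -> 0 <= s < 1 ->
    interior C (s * p.1 + (1 - s) * z.1, s * p.2 + (1 - s) * z.2).
  exact: star_closure.
have [xd xdd cx] := C2_is_derive C2x; have [yd ydd cy] := C2_is_derive C2y.
have arcB s : a <= s <= b -> closure C (x s, y s) /\ ~ interior C (x s, y s).
  by move=> /arc[[]].
have speed s : a <= s <= b -> derive1 x s ^+ 2 + derive1 y s ^+ 2 = 1.
  by move=> /arc[].
move: (derive1 x) (derive1 y) (derive1n 2 x) (derive1n 2 y) xd xdd cx yd ydd cy speed curved.
move=> dx dy ddx ddy xd xdd cx yd ydd cy speed curved.
have [dy0|dy0] := eqVneq (dy c) 0; last first.
  have [s0 [s1 [s01 cap]]] := curved_cap oO cO bO nO bB star arcB speed xd xdd cx yd ydd cy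
    cI dy0 curved.
  by exists s0, s1; split=> //; left.
have dx0 : dx c != 0.
  have cI' : a <= c <= b by case/andP: cI => /ltW -> /ltW ->.
  apply: contra_eqN (speed _ cI') => /eqP ->.
  by rewrite dy0 expr0n addr0 eq_sym oner_eq0.
have starT p z (s : R) : transposed (closure C) p -> transposed (interior C) z -> 0 <= s < 1 ->
    transposed (interior C) (s * p.1 + (1 - s) * z.1, s * p.2 + (1 - s) * z.2).
  exact: star.
have arcBT s : a <= s <= b ->
    transposed (closure C) (y s, x s) /\ ~ transposed (interior C) (y s, x s).
  exact: arcB.
have speedT s : a <= s <= b -> dy s ^+ 2 + dx s ^+ 2 = 1.
  by rewrite addrC; exact: speed.
have curvedT : ~ (ddy c = 0 /\ ddx c = 0) by move=> [h1 h2]; apply: curved.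
have [s0 [s1 [s01 cap]]] := curved_cap (transposed_open oO) (transposed_convex cO)
  (transposed_bounded bO) (transposed_nonempty nO) (transposed_bounded bB) starT arcBT speedT
  yd ydd cy xd xdd cx cI dx0 curvedT.
by exists s0, s1; split=> //; right.
Qed.

Lemma cone_energy_lower O (M s0 s1 : R) : planar_open O -> planar_convex O ->
  planar_bounded O M -> O !=set0 -> s0 < s1 -> cap_growth O s0 s1 ->
  exists2 c : R, 0 < c & forall pts, (1 <= size pts)%N ->
  exists L : seq (int * int), [/\ uniq L, 0 \notin L &
    c * (size pts)%:R `^ (2 / 5) <=
      \sum_(k <- L) weight O (freq R k) * structure_factor pts k].
Proof.
move=> oO cO bO nO s01 cap.
have [cB cB0 HB] := weight_all_frequencies oO cO bO nO.
have [cA cA0 HA] := weight_cone oO cO bO nO cap.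
have [c c0 Hc] := lattice_energy_lower s01 cA0 cB0.
by exists c => // pts pts1; exact: Hc.
Qed.

(** If the cone of directions comes from the exchanged body, the points and the
frequencies are exchanged as well. *)
Lemma body_energy_lower C : convex_body C -> ~ polygon C -> piecewise_C2_boundary C ->
  exists2 c : R, 0 < c & forall pts, (1 <= size pts)%N ->
  exists L : seq (int * int), [/\ uniq L, 0 \notin L &
    c * (size pts)%:R `^ (2 / 5) <=
      \sum_(k <- L) weight (interior C) (freq R k) * structure_factor pts k].
Proof.
move=> bodyC nP pw; have [s0 [s1 [s01 cap]]] := body_cap bodyC nP pw.
have [M bB] := body_bounded bodyC; have cC := body_convex bodyC.
have bO := planar_bounded_interior bB.
have nO : interior C !=set0 by case: bodyC.
have oO := @planar_open_interior _ C; have cO := planar_convex_interior cC.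
have tO := tame2_indic (planar_open_measurable oO) bO.
case: cap => cap; first exact: cone_energy_lower oO cO bO nO s01 cap.
have [c c0 Hc] := cone_energy_lower (transposed_open oO) (transposed_convex cO)
  (transposed_bounded bO) (transposed_nonempty nO) s01 cap.
exists c; [exact: c0|move=> pts pts1].
have [|L [uL L0 HL]] := Hc (map (@transpose _) pts); first by rewrite size_map.
exists (map (@transpose _) L); split.
- by rewrite map_inj_uniq//; exact/inv_inj/transposeK.
- apply: contra L0 => /mapP[k kL k0].
  by rewrite (_ : 0 = k)//; apply/eqP; rewrite eq_sym -transpose_eq0 -k0.
move: HL; rewrite size_map => /le_trans; apply; rewrite big_map ler_sum// => k _.
by rewrite structure_factor_transpose -(weight_transpose _ tO) -freq_transpose transposeK.
Qed.

(** The minorant of the inner integral given by [torus_energy_lower] is measurable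
in l, and the integral of its terms is the weight times the structure factor. *)
Lemma discrepancy_energy C (w : R) (P : {fset torus R}) (L : seq (int * int)) (kappa : R -> R) :
  convex_body C -> uniq L -> 0 \notin L ->
  w <= \sum_(k <- L) weight (interior C) (freq R k) *
         structure_factor [seq repr p | p <- P] k ->
  (w%:E <= \int[@lebesgue_measure R]_(l in `[0%R, 1%R])
     torus_integral (fun t : torus R =>
       (`|card_translate P (dilate l C) t - kappa l| ^+ 2)%:E))%E.
Proof.
move=> bodyC uL L0 wle; set pts := [seq _ | _ <- _] in wle.
have [M bB] := body_bounded bodyC.
have oO := @planar_open_interior _ C.
have mO := planar_open_measurable oO.
have bO := planar_bounded_interior bB.
have tO := tame2_indic mO bO.
have Lnz k : k \in L -> k != 0 by move=> kL; apply: contraNneq L0 => <-.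
pose h (k : int * int) l := (k != 0)%:R * structure_factor pts k *
  (\1_`]0, 1] l * energy (interior C) (freq R k) l).
have th k : tame (h k).
  rewrite /h; have [_|k0] := eqVneq k 0.
    by under eq_fun do rewrite !mul0r; exact: tame0.
  by apply: tameZ; exact: tame_freq_energy.
pose g l := \sum_(k <- L) h k l.
have tg : tame g by exact: tame_sum.
have gE : w <= integ g.
  rewrite /g integ_sum//; apply: (le_trans wle); rewrite le_eqVlt; apply/predU1P; left.
  rewrite big_seq [RHS]big_seq; apply: eq_bigr => k kL.
  rewrite /h Lnz// mul1r (integZ _ (tame_freq_energy tO (Lnz _ kL))).
  exact: mulrC.
apply: (@le_trans _ _ (integ g)%:E); first by rewrite lee_fin.
have g0 l : ~~ (0 < l <= 1) -> g l = 0.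
  move=> l01; rewrite /g big1// => k _; rewrite /h indicE memNset ?mul0r ?mulr0//.
  by rewrite /= in_itv/=; exact/negP.
rewrite EFin_integ//.
have -> : (\int[@lebesgue_measure R]_l (g l)%:E =
    \int[@lebesgue_measure R]_(l in `[0%R, 1%R]) (g l)%:E)%E.
  rewrite [RHS]integral_mkcond; apply: eq_integral => l _; rewrite patchE.
  case: ifPn => // /negP lI; rewrite g0//; apply/negP => /andP[l0 l1]; apply: lI.
  by rewrite inE /= in_itv/= (ltW l0).
apply: le_integral_integrable => //.
- apply: (integrableS _ _ _ (tame_integrable tg)) => //.
- by move=> l _; apply: integral_ge0 => t _; rewrite lee_fin exprn_ge0.
move=> l; rewrite /= in_itv/= => /andP[]; rewrite le_eqVlt => /predU1P[<-|l0] l1.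
  rewrite g0 ?ltxx//; apply: integral_ge0 => t _; rewrite lee_fin exprn_ge0//.
have OC : interior C `<=` C := @interior_subset _ C.
have CB : C `<=` closure C := @subset_closure _ C.
have := torus_energy_lower (kappa l) P mO (@closure_planar_measurable _ C) OC CB bB
  (body_null_boundary bodyC) l0 l1 uL L0.
apply: le_trans; rewrite lee_fin /g big_seq [leRHS]big_seq ler_sum// => k kL.
have k0 := Lnz k kL.
by rewrite /h k0 mul1r indicE mem_set/= ?mul1r// in_itv/= l0.
Qed.

End discrepancy.

Theorem proposition10 (R : realType) (C : set (plane R)) :
  convex_body C -> ~ polygon C -> piecewise_C2_boundary C ->
  exists2 c : R, 0 < c &
    forall (N : nat) (P : {fset torus R}), (1 <= N)%N -> #|` P| = N ->
      ((c * N%:R `^ (2 / 5))%R%:E <=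
       \int[@lebesgue_measure R]_(l in `[0%R, 1%R])
         torus_integral (fun t : torus R =>
           (`|card_translate P (dilate l C) t
              - l ^+ 2 * N%:R * area C| ^+ 2)%R%:E))%E.
Proof.
move=> bodyC nP pw; have [c c0 Hc] := body_energy_lower bodyC nP pw.
exists c; first exact: c0.
move=> N P N1 PN; set pts := [seq repr p | p <- P].
have sN : size pts = N by rewrite size_map -PN.
have [|L [uL L0 HL]] := Hc pts; first by rewrite sN.
rewrite sN in HL.
exact: (discrepancy_energy (fun l => l ^+ 2 * N%:R * area C) bodyC uL L0 HL).
Qed.
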